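(* Assume the distribution of the attenuation coefficients $d_{k,l,m}$ does not depend on $N$ or $m$ (only on $(k,l)$), and let $N\to\infty$ with $K/N=\beta$ fixed. Then the achievable average ergodic rate of simultaneous decoding satisfies $$\lim_{N\to\infty,\;K/N=\beta} r^{(N)}_{\rm SD}=\frac{\tau_d}{\tau_c}\cdot\frac{1}{L\beta}\min_{k\in\mathcal L}\Psi\big(A^{\rm Net}_k,\beta\big).$$
   Context: System model (uplink multi-cell MIMO). Fix integers $L\ge 1$ (cells), $N$ (antennas per base station, BS) and $K$ (single-antenna user terminals, UTs, per cell); $\mathcal L=\{1,\dots,L\}$, $\mathcal K=\{1,\dots,K\}$. For $k,l\in\mathcal L$, $D_{k,l}$ is a random $K\times K$ diagonal matrix with strictly positive diagonal entries $d_{k,l,1},\dots,d_{k,l,K}$ (attenuation between the UTs of cell $l$ and BS $k$); all $d_{k,l,m}$ are mutually independent and, for fixed $(k,l)$, $d_{k,l,1},\dots,d_{k,l,K}$ are identically distributed. $H_{k,l}\in\mathbb C^{N\times K}$ has i.i.d. zero-mean unit-variance proper (circularly symmetric) complex Gaussian entries; the matrices $H_{k,l}$ are mutually independent and independent of all $D_{k,l}$; $G_{k,l}=H_{k,l}D_{k,l}$. Block fading with coherence $\tau_c$ symbols, $\tau_p\ge K$ pilot and $\tau_d=\tau_c-\tau_p$ data symbols; BS $k$ knows $\{D_{k,l}\}_{l}$; noise at BS $k$ is i.i.d. zero-mean proper complex Gaussian with covariance $\sigma_w^2I_N$, $\sigma_w^2>0$. Pilots: a deterministic $K\times\tau_p$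 matrix $S$ with $SS^H=\tau_pI_K$ used in all cells. Logarithms are base 2, $|\cdot|$ is the determinant. Definitions: $b_{k,l,m}=\dfrac{\tau_p d_{k,l,m}^2}{\sigma_w^2+\tau_p\sum_{l'=1}^{L}d_{k,l',m}^2}$; $B_{k,l}=\mathrm{diag}(b_{k,l,1},\dots,b_{k,l,K})$; $M$ is an $N\times K$ matrix with i.i.d. zero-mean unit-variance proper complex Gaussian entries independent of all $D_{k,l}$; $T_k=\sum_{l=1}^{L}\mathrm{Tr}((I_K-B_{k,l})D_{k,l}^2)+\sigma_w^2$; $\Phi^{\rm Net}_k=T_k^{-1}B_{k,k}D_{k,k}^{-2}\sum_{l=1}^{L}D_{k,l}^4$; and $r^{(N)}_{\rm SD}=\frac{\tau_d}{\tau_c}\frac{1}{LK}\min_{k\in\mathcal L}\mathbb E\{\log|I_N+M\Phi^{\rm Net}_kM^H|\}$ (the achievable average ergodic rate when each BS decodes all UTs in the network). Random variable: $A^{\rm Net}_k=\dfrac{b_{k,k,1}d_{k,k,1}^{-2}\sum_{l=1}^{L}d_{k,l,1}^4}{\beta\sum_{l=1}^{L}\mathbb E\{(1-b_{k,l,1})d_{k,l,1}^2\}}$. For a nonnegative real random variable $A$ and $\beta>0$, $\Psi(A,\beta)=\beta\,\mathbb E\{\log(1+\eta A)\}-\log\eta+(\eta-1)\log e$, where $\eta\in(0,1]$ is the solution of $\beta=\dfrac{1-\eta}{1-\mathbb E\{1/(1+\eta A)\}}$. *)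

(* Defs.v *)
From HB Require Import structures.
From mathcomp Require Import all_boot all_order all_algebra.
From mathcomp Require Import all_classical all_reals all_analysis.
From mathcomp Require Import normal_distribution.
From mathcomp Require Import complex.

Set Implicit Arguments.
Unset Strict Implicit.
Unset Printing Implicit Defensive.

Import Order.TTheory GRing.Theory Num.Theory.
Import numFieldNormedType.Exports.

Local Open Scope classical_set_scope.
Local Open Scope ring_scope.

Definition log2 {R : realType} (x : R) : R := ln x / ln 2.

Definition prob {d} {T : measurableType d} {R : realType}
  (P : probability T R) (A : set T) : R := fine (P A).

(** Mutual independence of a finite family of real random variables:
    each is measurable and the joint law is the product of the marginals
    (product rule for every choice of Borel sets, which implies the product
    rule for every subfamily by taking B i = setT). *)
Definition mutually_independent {d} {T : measurableType d} {R : realType}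
  (P : probability T R) {I : finType} (X : I -> T -> R) : Prop :=
  (forall i, measurable_fun setT (X i)) /\
  forall B : I -> set R, (forall i, measurable (B i)) ->
    prob P (\bigcap_i (X i @^-1` B i)) = \prod_(i : I) prob P (X i @^-1` B i).

Definition Ex {d} {T : measurableType d} {R : realType}
  (P : probability T R) (f : T -> R) : \bar R := (\int[P]_x (f x)%:E)%E.

Section Model.
Variables (R : realType) (L K N : nat) (tau_p sigma2 : R).

Definition bcoef (d : 'I_L -> 'I_L -> 'I_K -> R) (k l : 'I_L) (m : 'I_K) : R :=
  tau_p * d k l m ^+ 2 / (sigma2 + tau_p * \sum_(l' < L) d k l' m ^+ 2).

Definition Dmx (d : 'I_L -> 'I_L -> 'I_K -> R) k l : 'M[R]_K :=
  diag_mx (\row_m d k l m).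
Definition Bmx (d : 'I_L -> 'I_L -> 'I_K -> R) k l : 'M[R]_K :=
  diag_mx (\row_m bcoef d k l m).

Definition Tk (d : 'I_L -> 'I_L -> 'I_K -> R) k : R :=
  \sum_(l < L) \tr ((1%:M - Bmx d k l) *m (Dmx d k l *m Dmx d k l)) + sigma2.

Definition PhiNet (d : 'I_L -> 'I_L -> 'I_K -> R) k : 'M[R]_K :=
  (Tk d k)^-1 *: (Bmx d k k *m invmx (Dmx d k k *m Dmx d k k) *m
     \sum_(l < L) (Dmx d k l *m Dmx d k l *m Dmx d k l *m Dmx d k l)).

Definition logdet (M : 'M[R[i]]_(N, K)) (Phi : 'M[R]_K) : R :=
  log2 (complex.Re (\det (1%:M + M *m map_mx (real_complex R) Phi *m
                   (map_mx (@conjc R) M)^T))).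
End Model.

Definition cmx {R : realType} {N K : nat} (Mre Mim : 'M[R]_(N, K)) : 'M[R[i]]_(N, K) :=
  \matrix_(i, j) (Complex (Mre i j) (Mim i j)).

(** r^{(N)}_SD (value in the extended reals, the expectations being
    expectations of nonnegative quantities). *)
Definition rSD {d} {T : measurableType d} {R : realType} (P : probability T R)
  (L N K : nat) (tau_c tau_p : nat) (sigma2 : R)
  (dd : 'I_L -> 'I_L -> 'I_K -> T -> R) (Mre Mim : 'I_N -> 'I_K -> T -> R) : \bar R :=
  ((((tau_c%:R - tau_p%:R) / tau_c%:R) * (L%:R * K%:R)^-1)%:E *
   \big[Order.min/+oo%E]_(k < L)
     Ex P (fun t => logdet (cmx (\matrix_(i, j) Mre i j t) (\matrix_(i, j) Mim i j t))
                      (PhiNet tau_p%:R sigma2 (fun k l m => dd k l m t) k)))%E.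

Section Psi.
Variables (d : measure_display) (T : measurableType d) (R : realType).
Variables (P : probability T R) (A : T -> R) (beta : R).

Definition Psi_eta_eq (eta : R) : Prop :=
  0 < eta <= 1 /\ beta = (1 - eta) / (1 - fine (Ex P (fun x => 1 / (1 + eta * A x)))).

Definition Psi_eta : R := xget 1 [set eta | Psi_eta_eq eta].

Definition Psi : \bar R :=
  (beta%:E * Ex P (fun x => log2 (1 + Psi_eta * A x)) +
   (- log2 Psi_eta + (Psi_eta - 1) * log2 (expR 1))%:E)%E.
End Psi.

(** A^Net_k, built from attenuations d0 k l (standing for d_{k,l,1}) on a
    reference probability space. *)
Definition ANet {d} {T : measurableType d} {R : realType} (P : probability T R)
  (L : nat) (tau_p : nat) (sigma2 beta : R) (d0 : 'I_L -> 'I_L -> T -> R)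
  (k : 'I_L) : T -> R :=
  let b k l t := tau_p%:R * d0 k l t ^+ 2 /
                 (sigma2 + tau_p%:R * \sum_(l' < L) d0 k l' t ^+ 2) in
  fun t => b k k t * (d0 k k t ^+ 2)^-1 * (\sum_(l < L) d0 k l t ^+ 4) /
           (beta * \sum_(l < L) fine (Ex P (fun s => (1 - b k l s) * d0 k l s ^+ 2))).

(* Main.v *)
Require Import Defs.
From HB Require Import structures.
From mathcomp Require Import all_boot all_order all_algebra spectral sesquilinear.
From mathcomp Require Import all_classical all_reals all_analysis.
From mathcomp Require Import measurable_realfun normal_distribution.
From mathcomp Require Import complex ring lra.

(** Put [I e = e - 1 - ln e] and [J e = beta E ln (1 + e A) + I e]. Weighted AM-GM
    makes [ln (1 + e a)] convex in [ln e], so the solution [eta] of the fixed-point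
    equation minimises [J], and [Psi A beta = J eta / ln 2]. It remains to show
    [E ln det (I + S) = N (min J + o(1))] for [S = \sum_m phi_m v_m v_m^H], where
    [v_m] are the columns of [M]; no random matrix spectral theory is needed.

    Upper bound, conditionally on [phi]. Let [pot] be the linear form on polynomials
    with [pot 'X^j = (N eta)^(N-j) j! / N!]. For [B >= 0] and [q = det ('X + B)],
    averaging [det ('X + B + phi v v^H)] over a Gaussian [v] gives [q + phi q'], and
    [pot q' <= N eta pot q]; one column after another,
    [E pot (det ('X + S)) <= \prod_m (1 + N eta phi_m)], while [det (I + S)] is at most
    [pot (det ('X + S))] times a constant of order [exp (N I(eta))].

    Lower bound, conditionally on [phi]. As [1 / det (I + S) = E exp (- z^H S z)] for
    an independent Gaussian [z], integrating out the columns gives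
    [E (1 / det (I + S)) = E \prod_m (1 + phi_m |z|^2)^-1]; splitting the values of
    [|z|^2 / N] along a geometric grid [kappa ^ i], with Chernoff bounds, produces the
    terms [exp (- N I(kappa ^ i)) \prod_m (1 + N phi_m kappa ^ i.+1)^-1].

    Finally [ln det <= ln U + det / U - 1] turns bounds on [E det] and [E (1 / det)]
    into bounds on [E ln det]. The interference power [\sum_m resid + sigma2], divided
    by its mean, only has to be controlled through its logarithm: the upper side by
    [ln x <= x - 1], the lower side by truncation and Chebyshev's inequality. *)

Set Implicit Arguments.
Unset Strict Implicit.
Unset Printing Implicit Defensive.
Import Order.TTheory GRing.Theory Num.Theory.
Import numFieldNormedType.Exports.
Local Open Scope classical_set_scope.
Local Open Scope ring_scope.

(** Three obstacles shape the proof. The powers [phi_m] share one random denominator, the total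
    interference, so they are not independent across users; writing it as [rho] times [K c], with
    [c] the mean interference per user, and using [ln (1 + a / rho) <= ln (1 + a) + lnp rho^-1]
    leaves independent summands. Neither [E ln (1 + e A)] nor the variance of the interference is
    assumed finite; hence the estimates compare integrals of nonnegative functions in the extended
    reals, with negative terms moved to the other side, and sums over users are truncated before
    their variance is taken. Finally, no concentration of [ln det] is proved: first moments suffice
    because the bounds on [E det] and [E (1 / det)] have matching exponential order. The former
    holds for every [eta], in particular at the minimiser of [J]; the latter is roughly a sum of
    [exp (- N J)] along the grid, governed by the smallest value of [J]. *)

Local Notation Re := complex.Re.
Local Notation Im := complex.Im.
Local Notation "x %:C" := (real_complex _ x) (format "x %:C") : ring_scope.
Local Notation cgauss_sd := (Num.sqrt 2^-1).

(** * Laws of finite families of random variables *)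

Section families.
Context {R : realType} {I : finType}.

Definition boxes : set (set (I -> R)) :=
  [set A | exists2 B : I -> set R, (forall i, measurable (B i)) &
     A = [set v | forall i, B i (v i)]].

(** The cylinder sigma-algebra on real families: independence and equality in law are
    statements about measures on this one space. *)
Definition fam : measurableType boxes.-sigma := g_sigma_algebraType boxes.

Lemma boxes_setI : setI_closed boxes.
Proof.
move=> _ _ [B mB ->] [C mC ->]; exists (fun i => B i `&` C i).
  by move=> i; exact: measurableI.
by apply/seteqP; split => v /= => [[bv cv] i|bcv]; [split|split => i; case: (bcv i)].
Qed.

Lemma measurable_coord i : measurable_fun [set: fam] (fun v : fam => (v : I -> R) i).
Proof.
move=> _ B mB; rewrite setTI; apply: sub_sigma_algebra.
exists (fun j => if j == i then B else setT).
  by move=> j; case: ifP.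
apply/seteqP; split => v /= => [Bv j|/(_ i)]; last by rewrite eqxx.
by case: eqP => [->|].
Qed.

Lemma measurable_fam d (T : measurableType d) (f : T -> fam) :
  (forall i, measurable_fun setT (fun t => (f t : I -> R) i)) -> measurable_fun setT f.
Proof.
move=> mf.
have E : @measurable _ fam = <<s boxes >> by [].
apply: (@measurability _ _ T fam setT f boxes E).
move=> _ [_ [B mB ->] <-]; rewrite setTI.
rewrite [X in measurable X](_ : _ =
    \big[setI/setT]_(i : I) ((fun t => (f t : I -> R) i) @^-1` (B i))); last first.
  rewrite -bigcap_seq; apply/seteqP; split => t /= h i; first by move=> _; exact: h.
  by apply: h => /=; rewrite mem_index_enum.
apply: bigsetI_measurable => i _.
by rewrite -[X in measurable X]setTI; exact: mf.
Qed.

(** Boxes are closed under intersection and include the whole space, so they determine a probability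
    measure. *)
Lemma measure_fam_unique (m1 m2 : probability fam R) :
  (forall B : I -> set R, (forall i, measurable (B i)) ->
     m1 [set v | forall i, B i (v i)] = m2 [set v | forall i, B i (v i)]) ->
  forall A, measurable A -> m1 A = m2 A.
Proof.
move=> h A mA.
apply: (@measure_unique _ R fam boxes (fun=> setT)) => //.
- exact: boxes_setI.
- move=> _; exists (fun=> setT) => //.
  by apply/seteqP; split.
- by rewrite bigcup_const.
- by move=> _ [B mB ->]; exact: h.
- by move=> _; rewrite (le_lt_trans (probability_le1 m1 _))// ltry.
Qed.

Section law.
Context d1 d2 (T1 : measurableType d1) (T2 : measurableType d2).
Variables (P1 : probability T1 R) (P2 : probability T2 R).
Variables (X1 : T1 -> fam) (X2 : T2 -> fam).
Hypotheses (mX1 : measurable_fun setT X1) (mX2 : measurable_fun setT X2).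
Hypothesis boxE : forall B : I -> set R, (forall i, measurable (B i)) ->
  P1 [set t | forall i, B i ((X1 t : I -> R) i)] = P2 [set t | forall i, B i (X2 t i)].

(** The two spaces may differ: the second one is [T * T] in [resample] and the reference space in
    [user_law]. *)
Lemma eq_law_integral (f : fam -> \bar R) : measurable_fun setT f ->
  (forall v, 0 <= f v)%E ->
  (\int[P1]_t f (X1 t) = \int[P2]_t f (X2 t))%E.
Proof.
move=> mf f0.
pose p1 := isMeasurableFun.Build _ _ _ _ _ mX1.
pose Y1 : {mfun _ >-> _} := HB.pack X1 p1.
pose p2 := isMeasurableFun.Build _ _ _ _ _ mX2.
pose Y2 : {mfun _ >-> _} := HB.pack X2 p2.
pose m1 := distribution P1 Y1.
pose m2 := distribution P2 Y2.
have m12 : forall A, measurable A -> m1 A = m2 A.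
  by apply: measure_fam_unique => B mB; exact: boxE.
transitivity (\int[m1]_v f v)%E.
  by rewrite /m1 /distribution ge0_integral_pushforward.
rewrite (eq_measure_integral m2); last by move=> A mA _; exact: m12.
by rewrite /m2 /distribution ge0_integral_pushforward.
Qed.

End law.

Lemma prob_setT d (T : measurableType d) (P : probability T R) :
  prob P setT = 1.
Proof. by rewrite /prob probability_setT. Qed.

Lemma prob_EFin d (T : measurableType d) (P : probability T R) A :
  measurable A -> (prob P A)%:E = P A.
Proof. by move=> mA; rewrite /prob fineK// fin_num_measure. Qed.

Section resampling.
Context d (T : measurableType d) (P : probability T R) (X : I -> T -> R).
Hypothesis indepX : mutually_independent P X.

Lemma measurable_family : measurable_fun setT (fun t => (fun i => X i t) : fam).
Proof. by apply: measurable_fam => i; case: indepX => + _; apply. Qed.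

Lemma box_preimage (B : I -> set R) :
  [set t | forall i, B i (X i t)] = \bigcap_i (X i @^-1` B i).
Proof. by apply/seteqP; split => t /= h i; [move=> _|]; apply: h. Qed.

Lemma measurable_box_preimage (B : I -> set R) :
  (forall i, measurable (B i)) -> measurable [set t | forall i, B i (X i t)].
Proof.
move=> mB.
have := measurable_family measurableT (_ : measurable [set v : fam | forall i, B i ((v : I -> R) i)]).
rewrite setTI; apply; apply: sub_sigma_algebra.
by exists B.
Qed.

Lemma prob_box (B : I -> set R) : (forall i, measurable (B i)) ->
  prob P [set t | forall i, B i (X i t)] = \prod_(i : I) prob P (X i @^-1` B i).
Proof. by move=> mB; rewrite box_preimage; case: indepX => _; apply. Qed.

Lemma measurable_mix (S : pred I) :
  measurable_fun setT (fun z : T * T =>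
    (fun i => if S i then X i z.1 else X i z.2) : fam).
Proof.
apply: measurable_fam => i; case: indepX => mX _.
by case: (S i); apply: measurableT_comp.
Qed.

Lemma measurable_resample (S : pred I) (f : (I -> R) -> \bar R) :
  measurable_fun [set: fam] f -> (forall v, 0 <= f v)%E ->
  measurable_fun setT
    (fun x => \int[P]_y f (fun i => if S i then X i x else X i y))%E.
Proof.
move=> mf f0.
apply: (@measurable_fun_fubini_tonelli_F _ _ T T R P
  (fun z : T * T => f (fun i => if S i then X i z.1 else X i z.2))) => //.
exact: (measurableT_comp mf (measurable_mix S)).
Qed.

(* The family can be resampled off [S] from an independent copy living on [T * T]. *)
Lemma resample (S : pred I) (f : (I -> R) -> \bar R) :
  measurable_fun [set: fam] f -> (forall v, 0 <= f v)%E ->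
  (\int[P]_t f (X ^~ t) =
   \int[P]_x \int[P]_y f (fun i => if S i then X i x else X i y))%E.
Proof.
move=> mf f0.
pose X2 (z : T * T) : fam := fun i => if S i then X i z.1 else X i z.2.
have mX2 : measurable_fun setT X2 := measurable_mix S.
have mfX2 : measurable_fun setT (f \o X2) by apply: measurableT_comp.
transitivity (\int[P \x P]_z f (X2 z))%E; last first.
  by rewrite fubini_tonelli1.
apply: (@eq_law_integral _ _ T _ P (P \x P)%E _ X2 measurable_family mX2) => //.
move=> B mB.
(* The preimage of a box under the mixed family is the rectangle [A1 * A2], each side constraining
   only its own coordinates. *)
pose A1 : set T := [set t | forall i, (if S i then B i else setT) (X i t)].
pose A2 : set T := [set t | forall i, (if S i then setT else B i) (X i t)].
have mA1 : measurable A1 by apply: (measurable_box_preimage (B := fun i => if S i then B i else setT)) => i; case: (S i).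
have mA2 : measurable A2 by apply: (measurable_box_preimage (B := fun i => if S i then setT else B i)) => i; case: (S i).
have -> : [set t | forall i, B i ((X2 t : I -> R) i)] = A1 `*` A2.
  apply/seteqP; split => -[x y] /=.
    by move=> h; split=> i; have := h i; rewrite /X2; case: (S i).
  by move=> [h1 h2] i; have := h1 i; have := h2 i; rewrite /X2; case: (S i).
apply/esym; have /= -> := product_measure1E P P mA1 mA2.
rewrite -!prob_EFin ?[measurable _]mA1//; last exact: measurable_box_preimage.
rewrite -EFinM; congr EFin; rewrite prob_box//.
rewrite (prob_box (B := fun i => if S i then B i else setT)); last by move=> i; case: (S i).
rewrite (prob_box (B := fun i => if S i then setT else B i)); last by move=> i; case: (S i).
rewrite -big_split; apply: eq_bigr => i _ /=.
by case: (S i); rewrite preimage_setT prob_setT ?mulr1 ?mul1r.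
Qed.

(** After resampling off [S], [f] sees only the first copy and [g] only the second, so the iterated
    integral factorises. The last two hypotheses express dependence on the coordinates in [S],
    respectively off [S]. *)
Lemma indep_product (S : pred I) (f g : (I -> R) -> R) :
  measurable_fun [set: fam] f -> measurable_fun [set: fam] g ->
  (forall v, 0 <= f v) -> (forall v, 0 <= g v) ->
  (forall u v, (forall i, S i -> u i = v i) -> f u = f v) ->
  (forall u v, (forall i, ~~ S i -> u i = v i) -> g u = g v) ->
  (\int[P]_t (f (X ^~ t) * g (X ^~ t))%:E =
   \int[P]_t (f (X ^~ t))%:E * \int[P]_t (g (X ^~ t))%:E)%E.
Proof.
move=> mf mg f0 g0 fS gS.
have mF (h : (I -> R) -> R) : measurable_fun [set: fam] h ->
    measurable_fun setT (fun t => (h (X ^~ t))%:E).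
  by move=> mh; apply/measurable_EFinP; apply: measurableT_comp measurable_family.
rewrite (@resample S (fun v => (f v * g v)%:E)); last 2 first.
- by apply/measurable_EFinP; apply: measurable_funM.
- by move=> v; rewrite lee_fin mulr_ge0.
transitivity (\int[P]_x ((f (X ^~ x))%:E * \int[P]_y (g (X ^~ y))%:E))%E.
  apply: eq_integral => x _; rewrite -ge0_integralZl//; last 3 first.
  - exact: mF.
  - by move=> y _; rewrite lee_fin.
  - by rewrite lee_fin.
  apply: eq_integral => y _; rewrite -EFinM; congr (_ * _)%:E.
    by apply: fS => i ->.
  by apply: gS => i /negbTE ->.
rewrite ge0_integralZr//; first exact: mF.
- by move=> y _; rewrite lee_fin.
- by apply: integral_ge0 => y _; rewrite lee_fin.
Qed.

(** Induction on the list of factors: by disjointness, the product of the remaining ones depends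
    only on coordinates off [S m]. *)
Lemma indep_bigprod (M : finType) (S : M -> pred I) (f : M -> (I -> R) -> R)
    (c : M -> R) :
  (forall m n i, m != n -> S m i -> ~~ S n i) ->
  (forall m, measurable_fun [set: fam] (f m)) -> (forall m v, 0 <= f m v) ->
  (forall m u v, (forall i, S m i -> u i = v i) -> f m u = f m v) ->
  (forall m, (\int[P]_t (f m (X ^~ t))%:E = (c m)%:E)%E) ->
  (\int[P]_t (\prod_m f m (X ^~ t))%:E = (\prod_m c m)%:E)%E.
Proof.
move=> disj mf f0 fS fc.
have := index_enum_uniq M; elim: (index_enum M) => [_|m r IH /= /andP[mr ur]].
  by under eq_integral do rewrite big_nil; rewrite big_nil; have /= -> := integral_cst P measurableT 1; rewrite probability_setT mule1.
under eq_integral do rewrite big_cons.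
rewrite (@indep_product (S m) (f m) (fun v => \prod_(j <- r) f j v)) //.
- by rewrite fc IH// big_cons EFinM.
- by apply: measurable_prod => j _; exact: mf.
- by move=> v; apply: prodr_ge0 => j _; exact: f0.
- exact: fS.
- move=> u v uv; rewrite big_seq [RHS]big_seq; apply: eq_bigr => j jr; apply: fS => i Sji.
  apply: uv; apply: disj Sji; apply: contraNneq mr => <- //.
Qed.

End resampling.
End families.

Lemma indep_sub (R : realType) (I J : finType) d (T : measurableType d)
    (P : probability T R) (X : I -> T -> R) (h : J -> I) :
  injective h -> mutually_independent P X ->
  mutually_independent P (fun j => X (h j)).
Proof.
move=> hinj [mX iX]; split => // B mB.
(* Indices outside the image of [h] receive the whole line and contribute a factor 1. *)
pose B' i := if [pick j | h j == i] is Some j then B j else setT.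
have B'h j : B' (h j) = B j.
  rewrite /B'; case: pickP => [k /eqP /hinj -> //|/(_ j)].
  by rewrite eqxx.
have mB' i : measurable (B' i) by rewrite /B'; case: pickP.
have := iX B' mB'.
rewrite (bigID (fun i => i \in codom h))/= [X in _ = _ * X]big1 ?mulr1; last first.
  move=> i iN; rewrite /B'; case: pickP => [j /eqP E|_]; last by rewrite preimage_setT prob_setT.
  by move: iN; rewrite -E codom_f.
rewrite -big_uniq/=; last by rewrite map_inj_uniq ?enum_uniq.
rewrite big_image/=.
under eq_bigr do rewrite B'h.
move=> <-; congr prob; apply/seteqP; split => t /= H i _.
  rewrite /B'; case: pickP => [j /eqP <-|//]; exact: H.
by have := H (h i) Logic.I; rewrite /preimage/= B'h.
Qed.

(** The Radon-Nikodym derivative is determined only almost everywhere; it agrees with the density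
    because both have the same integral over every measurable set. *)
Lemma integral_normal_prob (R : realType) (m s : R) (f : R -> \bar R) :
  measurable_fun setT f -> (forall x, 0 <= f x)%E ->
  (\int[normal_prob m s]_x f x =
   \int[lebesgue_measure]_x (f x * (normal_pdf m s x)%:E))%E.
Proof.
move=> mf f0.
pose nu := normal_prob m s.
have dom : nu `<< lebesgue_measure := normal_prob_dominates m s.
rewrite -(Radon_Nikodym_SigmaFinite.change_of_variables dom)//.
have mpdf : measurable_fun setT (fun x => (normal_pdf m s x)%:E).
  by apply/measurable_EFinP; exact: measurable_normal_pdf.
apply: ae_eq_integral => //.
- apply: emeasurable_funM => //; apply: measurable_int.
  exact: Radon_Nikodym_SigmaFinite.f_integrable.
- exact: emeasurable_funM.
- apply: ae_eqe_mul2l => /=.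
  apply: integral_ae_eq => //=.
  + exact: Radon_Nikodym_SigmaFinite.f_integrable.
  + by move=> E _ mE; rewrite -Radon_Nikodym_SigmaFinite.f_integral.
Qed.

(** Completing the square: the integrand times the density of variance 1/2 is a multiple of the
    normal density of mean [- g / (1 + b)] and variance [(1 + b)^-1 / 2]. *)
Lemma gauss_exp_quadratic (R : realType) (b g : R) : 0 <= b ->
  (\int[normal_prob 0 (cgauss_sd : R)]_x (expR (- (b * x ^+ 2) - 2 * (g * x)))%:E =
   ((Num.sqrt (1 + b))^-1 * expR (g ^+ 2 / (1 + b)))%:E)%E.
Proof.
move=> b0.
have b1 : 0 < 1 + b by rewrite ltr_pwDl.
rewrite integral_normal_prob; last 2 first.
- apply/measurable_EFinP; apply: measurableT_comp => //.
  apply: measurable_funB; first by apply: measurableT_comp => //; apply: measurable_funM => //; exact: measurable_funX.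
  by apply: measurable_funM => //; exact: measurable_funM.
- by move=> x; rewrite lee_fin expR_ge0.
set k := (Num.sqrt (1 + b))^-1 * expR (g ^+ 2 / (1 + b)).
pose s := Num.sqrt ((1 + b)^-1 / 2).
have s2 : s ^+ 2 = (1 + b)^-1 / 2 by rewrite sqr_sqrtr// divr_ge0// invr_ge0 ltW.
have s0 : s != 0 by rewrite gt_eqF// sqrtr_gt0 divr_gt0// invr_gt0.
have t0 : cgauss_sd != 0 :> R by rewrite gt_eqF// sqrtr_gt0 invr_gt0.
have t2 : (cgauss_sd : R) ^+ 2 = 2^-1 by rewrite sqr_sqrtr.
transitivity (\int[lebesgue_measure]_x (k%:E * (normal_pdf (- (g / (1 + b))) s x)%:E))%E; last first.
  rewrite ge0_integralZl//; last 3 first.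
  - by apply/measurable_EFinP; exact: measurable_normal_pdf.
  - by move=> x _; rewrite lee_fin normal_pdf_ge0.
  - by rewrite lee_fin mulr_ge0 ?invr_ge0 ?sqrtr_ge0 ?expR_ge0.
  by rewrite integral_normal_pdf mule1.
apply: eq_integral => x _; rewrite -!EFinM; congr EFin.
rewrite !normal_pdfE// /normal_peak /normal_fun t2 s2.
have -> : Num.sqrt (((1 + b)^-1 / 2 * pi) *+ 2) = (Num.sqrt (1 + b))^-1 * Num.sqrt ((2^-1 * pi) *+ 2) :> R.
  rewrite -sqrtrV ?ltW// -sqrtrM ?invr_ge0 ?ltW//; congr Num.sqrt.
  by field; rewrite gt_eqF.
rewrite invfM invrK /k.
have r0 : Num.sqrt (1 + b) != 0 by rewrite gt_eqF ?sqrtr_gt0.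
rewrite mulrCA -expRD [RHS](_ : _ = (Num.sqrt ((2^-1 * pi) *+ 2))^-1 *
  (expR (g ^+ 2 / (1 + b)) * expR (- (x - - (g / (1 + b))) ^+ 2 / ((1 + b)^-1 / 2 *+ 2)))); last first.
  by field; rewrite r0 andbT gt_eqF// sqrtr_gt0 pmulrn_lgt0// mulr_gt0// pi_gt0.
rewrite -expRD; congr (_ * expR _).
by field; rewrite gt_eqF.
Qed.

(** * Rank-one updates of positive semidefinite matrices *)

Lemma deriv_prod (R : comNzRingType) (I : eqType) (r : seq I) (f : I -> {poly R}) :
  uniq r ->
  (\prod_(i <- r) f i)^`() = \sum_(i <- r) (f i)^`() * \prod_(j <- r | j != i) f j.
Proof.
elim: r => [_|i r IH /= /andP[ir ur]]; first by rewrite !big_nil derivC.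
rewrite !big_cons derivM eqxx/= IH//; congr (_ + _).
  rewrite big_seq [in RHS]big_seq_cond; congr (_ * _); apply: eq_bigl => j.
  by case: (boolP (j \in r)) => //= jr; apply/esym; apply: contraNneq ir => <-.
rewrite mulr_sumr [LHS]big_seq [RHS]big_seq; apply: eq_bigr => j jr.
rewrite big_cons ifT; first by rewrite mulrCA.
by apply: contraNneq ir => ->.
Qed.

(** Matrix determinant lemma over a domain, since it is applied to diagonal entries ['X + l i],
    which are nonzero polynomials but not invertible. *)
Lemma det_diag_rank1 (R : idomainType) n (p : 'rV[R]_n) (u : 'cV[R]_n) (w : 'rV[R]_n) :
  (forall i, p 0 i != 0) ->
  \det (diag_mx p + u *m w) =
  \prod_i p 0 i + \sum_i w 0 i * u i 0 * \prod_(j | j != i) p 0 j.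
Proof.
move=> p0.
pose d := \prod_i p 0 i.
have d0 : d != 0 by apply/prodf_neq0 => i _.
pose E i := \prod_(j | j != i) p 0 j.
have pE i : p 0 i * E i = d by rewrite /d (bigD1 i).
pose M := block_mx (1%:M : 'M[_]_1) (- w) u (diag_mx p).
pose v : 'cV[R]_n := \col_i (E i * u i 0).
have M1 : M = block_mx 1%:M 0 u 1%:M *m block_mx (1%:M : 'M[_]_1) (- w) 0 (diag_mx p + u *m w).
  rewrite mulmx_block !mul1mx !mul0mx ?mulmx0 !mulmx1 !addr0 /M.
  by rewrite mulmxN addrCA addNr addr0.
have dM : \det M = \det (diag_mx p + u *m w).
  by rewrite M1 det_mulmx det_lblock det_ublock !det1 !mul1r.
rewrite -dM; apply: (mulIf d0).
(* This factor clears denominators: [v] stands for [d] times the inverse of [diag_mx p] applied to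
   [u], so the lower left block of the product vanishes. *)
have <- : \det (block_mx (d%:M : 'M[_]_1) 0 (- v) (1%:M : 'M[R]_n)) = d.
  by rewrite det_lblock det1 mulr1 det_scalar1.
rewrite -det_mulmx mulmx_block !mul1mx ?mulmx0 !mulmx1 !add0r.
have -> : u *m d%:M + diag_mx p *m - v = 0.
  apply/matrixP => i j; rewrite !mxE big_ord1 !mxE (ord1 j) eqxx mulr1n.
  rewrite (bigD1 i)//= !mxE eqxx mulr1n big1 ?addr0; last first.
    by move=> k ki; rewrite !mxE eq_sym (negbTE ki) mulr0n mul0r.
  by rewrite mulrN mulrA pE mulrC subrr.
rewrite det_ublock det_diag det_lblock det1 mulr1 det_scalar1 -/d; congr (_ * _).
rewrite det_mx11 !mxE eqxx mulr1n; congr (_ + _).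
by apply: eq_bigr => i _; rewrite !mxE mulrNN [E i * _]mulrC mulrA.
Qed.

Lemma det_schur1 (F : fieldType) n (a : F) (r : 'rV[F]_n) (c : 'cV[F]_n) (D : 'M[F]_n) :
  a != 0 ->
  \det (block_mx (a%:M : 'M[_]_1) r c D) = a * \det (D - a^-1 *: (c *m r)).
Proof.
move=> a0.
have -> : block_mx (a%:M : 'M[_]_1) r c D =
   block_mx 1%:M 0 (a^-1 *: c) 1%:M *m block_mx (a%:M : 'M[_]_1) r 0 (D - a^-1 *: (c *m r)).
  rewrite mulmx_block !mul1mx !mul0mx ?mulmx0 !addr0.
  by rewrite mul_mx_scalar scalerA mulfV// scale1r -scalemxAl addrC subrK.
by rewrite det_mulmx det_lblock det_ublock !det1 !mul1r det_scalar1.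
Qed.

Section hermitian.
Variable C : numClosedFieldType.

Definition adjmx m n (A : 'M[C]_(m, n)) : 'M[C]_(n, m) := (map_mx Num.conj A)^T.

Lemma adjmxE m n (A : 'M[C]_(m, n)) i j : adjmx A i j = (A j i)^*.
Proof. by rewrite !mxE. Qed.

Lemma adjmxK m n (A : 'M[C]_(m, n)) : adjmx (adjmx A) = A.
Proof. by apply/matrixP => i j; rewrite !adjmxE conjCK. Qed.

Lemma adjmxM m n p (A : 'M[C]_(m, n)) (B : 'M[C]_(n, p)) :
  adjmx (A *m B) = adjmx B *m adjmx A.
Proof. by rewrite /adjmx map_mxM trmx_mul. Qed.

Lemma adjmxD m n (A B : 'M[C]_(m, n)) : adjmx (A + B) = adjmx A + adjmx B.
Proof. by apply/matrixP => i j; rewrite !mxE rmorphD. Qed.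

Lemma adjmxN m n (A : 'M[C]_(m, n)) : adjmx (- A) = - adjmx A.
Proof. by apply/matrixP => i j; rewrite !mxE rmorphN. Qed.

Lemma adjmxZ m n a (A : 'M[C]_(m, n)) : adjmx (a *: A) = a^* *: adjmx A.
Proof. by apply/matrixP => i j; rewrite !mxE rmorphM. Qed.

Definition qform n (B : 'M[C]_n) (z : 'cV[C]_n) : C := (adjmx z *m B *m z) 0 0.

Definition psdmx n (B : 'M[C]_n) := adjmx B = B /\ forall z, 0 <= qform B z.

Lemma qformD n (A B : 'M[C]_n) z : qform (A + B) z = qform A z + qform B z.
Proof. by rewrite /qform mulmxDr mulmxDl mxE. Qed.

Lemma qformZ n a (A : 'M[C]_n) z : qform (a *: A) z = a * qform A z.
Proof. by rewrite /qform -scalemxAr -scalemxAl mxE. Qed.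

Lemma qform_diag n (d : 'rV[C]_n) z : qform (diag_mx d) z = \sum_i d 0 i * `|z i 0| ^+ 2.
Proof.
rewrite /qform mul_mx_diag mxE; apply: eq_bigr => i _.
by rewrite !mxE normCK mulrAC mulrC; congr (_ * _); rewrite mulrC.
Qed.

Lemma qform_rank1 n (v z : 'cV[C]_n) : qform (v *m adjmx v) z = `|(adjmx v *m z) 0 0| ^+ 2.
Proof.
rewrite /qform mulmxA -mulmxA mxE big_ord1 normCK mulrC; congr (_ * _).
by rewrite -adjmxE adjmxM adjmxK.
Qed.

Lemma qform_delta n (B : 'M[C]_n) i : qform B (delta_mx i 0) = B i i.
Proof.
rewrite /qform (_ : adjmx (delta_mx i 0) = delta_mx 0 i); last first.
  by apply/matrixP => j k; rewrite !mxE conjC_nat andbC.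
by rewrite -rowE -colE !mxE.
Qed.

Lemma psdmx0 n : psdmx (0 : 'M[C]_n).
Proof.
split; first by apply/matrixP => i j; rewrite !mxE rmorph0.
by move=> z; rewrite /qform mulmx0 mul0mx mxE.
Qed.

Lemma psdmxD n (A B : 'M[C]_n) : psdmx A -> psdmx B -> psdmx (A + B).
Proof.
move=> [hA pA] [hB pB]; split; first by rewrite adjmxD hA hB.
by move=> z; rewrite qformD addr_ge0.
Qed.

Lemma psdmxZ n a (A : 'M[C]_n) : 0 <= a -> psdmx A -> psdmx (a *: A).
Proof.
move=> a0 [hA pA]; split; first by rewrite adjmxZ hA conj_Creal// ger0_real.
by move=> z; rewrite qformZ mulr_ge0.
Qed.

Lemma psdmx_rank1 n (v : 'cV[C]_n) : psdmx (v *m adjmx v).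
Proof.
split; first by rewrite adjmxM adjmxK.
by move=> z; rewrite qform_rank1 exprn_ge0.
Qed.

Lemma psdmx_spectral n (B : 'M[C]_n) : psdmx B ->
  exists (U : 'M[C]_n) (l : 'rV[C]_n),
  [/\ U *m adjmx U = 1%:M, adjmx U *m U = 1%:M, B = adjmx U *m diag_mx l *m U
    & forall i, 0 <= l 0 i].
Proof.
move=> [hB pB].
have Bh : B \is hermsymmx.
  apply/is_hermitianmxP; rewrite expr0 scale1r -[LHS]hB.
  by apply/matrixP => i j; rewrite !mxE.
pose U := spectralmx B; pose l := spectral_diag B.
have Uu := spectral_unitarymx B.
have UU : adjmx U = invmx U.
  by rewrite invmx_unitary//; apply/matrixP => i j; rewrite !mxE.
have BE : B = adjmx U *m diag_mx l *m U.
  by rewrite UU; apply/orthomx_spectralP; exact: hermitian_normalmx.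
have U1 : U *m adjmx U = 1%:M by rewrite UU mulmxV// spectral_unit.
have U2 : adjmx U *m U = 1%:M by rewrite UU mulVmx// spectral_unit.
exists U, l; split => // i.
(* This vector is the [i]-th eigenvector, at which the form takes the value [l i]. *)
have := pB (adjmx U *m delta_mx i 0).
rewrite /qform adjmxM adjmxK BE.
rewrite -!mulmxA (mulmxA U) U1 mul1mx (mulmxA U) U1 mul1mx mulmxA.
have := qform_diag l (delta_mx i 0); rewrite /qform => ->.
rewrite (bigD1 i)//= mxE !eqxx normr1 expr1n mulr1 big1 ?addr0//.
by move=> j ji; rewrite mxE (negbTE ji) normr0 expr0n mulr0.
Qed.

(** Characteristic polynomial of [- B]: with this sign all coefficients are nonnegative when [B] is
    positive semidefinite. *)
Definition shiftdet n (B : 'M[C]_n) : {poly C} := \det ('X%:M + map_mx polyC B).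

Lemma shiftdet1 n (B : 'M[C]_n) : (shiftdet B).[1] = \det (1%:M + B).
Proof.
rewrite /shiftdet -horner_evalE -det_map_mx; congr (\det _).
apply/matrixP => i j; rewrite !mxE raddfD/= /horner_eval hornerC hornerMn hornerX.
by [].
Qed.

(** In the eigenbasis of [B] the matrix is diagonal plus rank one. Replacing each [|(U v)_i|^2] by 1
    turns the second sum into [phi] times the derivative of the first product. *)
Lemma shiftdet_rank1 n (U B : 'M[C]_n) (l : 'rV[C]_n) phi (v : 'cV[C]_n) :
  U *m adjmx U = 1%:M -> adjmx U *m U = 1%:M -> B = adjmx U *m diag_mx l *m U ->
  shiftdet (B + phi *: (v *m adjmx v)) =
  \prod_i ('X + (l 0 i)%:P) +
  \sum_i (phi * `|(U *m v) i 0| ^+ 2) *: \prod_(j | j != i) ('X + (l 0 j)%:P).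
Proof.
move=> U1 U2 BE.
pose w := U *m v.
have -> : B + phi *: (v *m adjmx v) = adjmx U *m (diag_mx l + phi *: (w *m adjmx w)) *m U.
  rewrite mulmxDr mulmxDl -BE; congr (_ + _).
  rewrite -scalemxAr -scalemxAl /w adjmxM; congr (_ *: _).
  by rewrite !mulmxA U2 mul1mx -[_ *m adjmx U *m U]mulmxA U2 mulmx1.
rewrite /shiftdet.
have -> : 'X%:M + map_mx polyC (adjmx U *m (diag_mx l + phi *: (w *m adjmx w)) *m U) =
   map_mx polyC (adjmx U) *m ('X%:M + map_mx polyC (diag_mx l + phi *: (w *m adjmx w))) *m map_mx polyC U.
  set Q := diag_mx l + _.
  rewrite !map_mxM mulmxDr mulmxDl; congr (_ + _).
  by rewrite scalar_mxC -mulmxA -map_mxM U2 map_mx1 mulmx1.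
rewrite !det_mulmx mulrAC -det_mulmx -map_mxM U2 map_mx1 det1 mul1r.
have -> : 'X%:M + map_mx polyC (diag_mx l + phi *: (w *m adjmx w)) =
  diag_mx (\row_i ('X + (l 0 i)%:P)) + (map_mx polyC (phi *: w)) *m map_mx polyC (adjmx w).
  rewrite -map_mxM -scalemxAl map_mxD addrA; congr (_ + _).
  apply/matrixP => i j; rewrite !mxE; case: eqVneq => [->|]; last by rewrite !mulr0n addr0.
  by rewrite !mulr1n.
rewrite det_diag_rank1; last first.
  move=> i; rewrite mxE -size_poly_gt0 -[X in 'X + X]opprK -polyCN size_XsubC//.
congr (_ + _); first by apply: eq_bigr => i _; rewrite mxE.
apply: eq_bigr => i _; rewrite !mxE -polyCM mul_polyC; congr (_ *: _).
  by rewrite -/w normCK mulrCA [X in _ * X]mulrC.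
by apply: eq_bigr => j _; rewrite mxE.
Qed.

Lemma qform_block n (b : C) (r : 'rV[C]_n) (D : 'M[C]_n) (w : C) (z : 'cV[C]_n) :
  qform (block_mx (b%:M : 'M[_]_1) r (adjmx r) D) (col_mx (w%:M : 'M[_]_1) z) =
  b * `|w| ^+ 2 + (w^* * (r *m z) 0 0 + w * ((r *m z) 0 0)^*) + qform D z.
Proof.
rewrite /qform.
have -> : adjmx (col_mx (w%:M : 'M[_]_1) z) = row_mx ((w^*)%:M : 'M[_]_1) (adjmx z).
  rewrite /adjmx map_col_mx tr_col_mx; congr row_mx.
  by rewrite map_scalar_mx tr_scalar_mx.
rewrite mul_row_block mul_row_col !mulmxDl !mul_scalar_mx -!scalemxAl.
have E1 : (adjmx z *m adjmx r) 0 0 = ((r *m z) 0 0)^* by rewrite -adjmxM adjmxE.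
rewrite [LHS]mxE [X in X + _]mxE [X in _ + X]mxE.
rewrite -[b%:M *m _]/(_ *m _) mul_scalar_mx mul_mx_scalar -E1.
rewrite [X in X + _ + _ = _]mxE [X in _ + X + _ = _]mxE [X in _ + (X + _) = _]mxE.
rewrite [X in _ * X + _ + _ = _]mxE [(w%:M) 0 0]mxE eqxx mulr1n normCK.
by ring.
Qed.

(** The pivot is [1 + b] rather than [b] because [gauss_qform] integrates the first coordinate
    against a weight that itself contributes [|w|^2] to the exponent. *)
Lemma psdmx_schur n (b : C) (r : 'rV[C]_n) (D : 'M[C]_n) :
  0 <= b -> psdmx (block_mx (b%:M : 'M[_]_1) r (adjmx r) D) ->
  psdmx (D - (1 + b)^-1 *: (adjmx r *m r)).
Proof.
move=> b0 [hB pB].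
have b1 : 0 < 1 + b by rewrite ltr_pwDl.
have b1r : (1 + b)^-1 \is Num.real by rewrite rpredV ger0_real// ltW.
have hD : adjmx D = D.
  move: hB; rewrite /adjmx map_block_mx tr_block_mx => /(congr1 drsubmx).
  by rewrite !block_mxKdr.
split.
  by rewrite adjmxD adjmxN adjmxZ adjmxM adjmxK hD conj_Creal.
move=> z; pose h := (r *m z) 0 0.
have -> : qform (D - (1 + b)^-1 *: (adjmx r *m r)) z = qform D z - (1 + b)^-1 * `|h| ^+ 2.
  rewrite qformD -scaleNr qformZ mulNr -[X in _ *m X](adjmxK r) qform_rank1.
  by rewrite adjmxK.
have := pB (col_mx ((- (h / (1 + b)))%:M : 'M[_]_1) z).
have n1 : `|(1 + b)^-1| = (1 + b)^-1 by rewrite ger0_norm// invr_ge0 ltW.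
rewrite qform_block -/h normrN normrM n1 rmorphN rmorphM/= (conj_Creal b1r) => H.
(* With [w = - h / (1 + b)], the minimiser in the first coordinate, the left side is the original
   form at [(w, z)] plus [|w|^2]. *)
have -> : qform D z - (1 + b)^-1 * `|h| ^+ 2 =
  (b * (`|h| / (1 + b)) ^+ 2 + (- (h^* / (1 + b)) * h + - (h / (1 + b)) * h^*) + qform D z)
  + (`|h| / (1 + b)) ^+ 2.
  rewrite !expr_div_n normCK.
  by field; rewrite gt_eqF.
by rewrite addr_ge0// exprn_ge0// divr_ge0// ltW.
Qed.

Lemma shiftdet_spectral n (U B : 'M[C]_n) (l : 'rV[C]_n) :
  U *m adjmx U = 1%:M -> adjmx U *m U = 1%:M -> B = adjmx U *m diag_mx l *m U ->
  shiftdet B = \prod_i ('X + (l 0 i)%:P).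
Proof.
move=> U1 U2 BE; have := shiftdet_rank1 0 0 U1 U2 BE.
rewrite scale0r addr0 => ->; rewrite [X in _ + X]big1 ?addr0// => i _.
by rewrite mul0r scale0r.
Qed.

Lemma det1D_spectral n (U B : 'M[C]_n) (l : 'rV[C]_n) :
  U *m adjmx U = 1%:M -> adjmx U *m U = 1%:M -> B = adjmx U *m diag_mx l *m U ->
  \det (1%:M + B) = \prod_i (1 + l 0 i).
Proof.
move=> U1 U2 BE; rewrite -shiftdet1 (shiftdet_spectral U1 U2 BE) horner_prod.
by apply: eq_bigr => i _; rewrite hornerD hornerX hornerC.
Qed.

Lemma det1D_psd_ge1 n (B : 'M[C]_n) : psdmx B -> 1 <= \det (1%:M + B).
Proof.
move=> /psdmx_spectral[U [l [U1 U2 BE l0]]]; rewrite (det1D_spectral U1 U2 BE).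
elim/big_ind: _ => // [x y x1 y1|i _]; last by rewrite lerDl.
by rewrite -[1]mulr1 ler_pM.
Qed.

Lemma qform_spectral n (U : 'M[C]_n) (l : 'rV[C]_n) v :
  qform (adjmx U *m diag_mx l *m U) v = \sum_i l 0 i * `|(U *m v) i 0| ^+ 2.
Proof.
by rewrite -qform_diag /qform adjmxM !mulmxA.
Qed.

Lemma psdmx_spectral_inv n (U : 'M[C]_n) (l : 'rV[C]_n) :
  (forall i, 0 <= l 0 i) -> psdmx (adjmx U *m diag_mx l *m U).
Proof.
move=> l0; split.
  rewrite !adjmxM adjmxK mulmxA; congr (_ *m _ *m _); apply/matrixP => i j.
  rewrite adjmxE !mxE eq_sym; case: eqVneq => [->|_]; last by rewrite !mulr0n conjC0.
  by rewrite !mulr1n conj_Creal// ger0_real.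
by move=> z; rewrite qform_spectral; apply: sumr_ge0 => i _; rewrite mulr_ge0// exprn_ge0.
Qed.

Lemma det1D_rank1 n (phi : C) (v : 'cV[C]_n) :
  \det (1%:M + phi *: (v *m adjmx v)) = 1 + phi * \sum_i `|v i 0| ^+ 2.
Proof.
rewrite -diag_const_mx scalemxAl det_diag_rank1; last by move=> i; rewrite mxE oner_neq0.
rewrite big1; last by move=> i _; rewrite mxE.
rewrite mulr_sumr; congr (_ + _); apply: eq_bigr => i _.
rewrite big1 ?mulr1; last by move=> j _; rewrite mxE.
by rewrite adjmxE mxE normCK mulrCA [X in _ * X]mulrC.
Qed.

End hermitian.

(** * Measurability of complex-valued functions and matrices *)

Section cmeas.
Context {R : realType} d (T : measurableType d).
Implicit Types f g : T -> R[i].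

(** Stated through real and imaginary parts, so that only the sigma-algebra of the reals is
    involved. *)
Definition cmeas f := measurable_fun setT (fun t => Re (f t)) /\ measurable_fun setT (fun t => Im (f t)).

Lemma cmeas_cst c : cmeas (fun=> c).
Proof. by split; exact: measurable_cst. Qed.

Lemma cmeasD f g : cmeas f -> cmeas g -> cmeas (fun t => f t + g t).
Proof.
move=> [f1 f2] [g1 g2]; split.
- rewrite [X in measurable_fun _ X](_ : _ = (fun t => Re (f t) + Re (g t))); first exact: measurable_funD.
  by apply/funext => t; case: (f t) (g t) => [a b] [a' b'].
- rewrite [X in measurable_fun _ X](_ : _ = (fun t => Im (f t) + Im (g t))); first exact: measurable_funD.
  by apply/funext => t; case: (f t) (g t) => [a b] [a' b'].
Qed.

Lemma cmeasM f g : cmeas f -> cmeas g -> cmeas (fun t => f t * g t).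
Proof.
move=> [f1 f2] [g1 g2]; split.
- rewrite [X in measurable_fun _ X](_ : _ = (fun t => Re (f t) * Re (g t) - Im (f t) * Im (g t))).
    by apply: measurable_funB; exact: measurable_funM.
  by apply/funext => t; case: (f t) (g t) => [a b] [a' b'].
- rewrite [X in measurable_fun _ X](_ : _ = (fun t => Re (f t) * Im (g t) + Im (f t) * Re (g t))).
    by apply: measurable_funD; exact: measurable_funM.
  by apply/funext => t; case: (f t) (g t) => [a b] [a' b'].
Qed.

Lemma cmeasJ f : cmeas f -> cmeas (fun t => (f t)^*).
Proof.
move=> [f1 f2]; split.
- rewrite [X in measurable_fun _ X](_ : _ = (fun t => Re (f t)))//.
  by apply/funext => t; case: (f t).
- rewrite [X in measurable_fun _ X](_ : _ = (fun t => - Im (f t))); first exact: measurableT_comp.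
  by apply/funext => t; case: (f t).
Qed.

Lemma cmeas_sum (I : Type) (r : seq I) (p : pred I) (F : I -> T -> R[i]) :
  (forall i, cmeas (F i)) -> cmeas (fun t => \sum_(i <- r | p i) F i t).
Proof.
move=> mF; elim: r => [|i r IH].
  by under eq_fun do rewrite big_nil; exact: cmeas_cst.
under eq_fun do rewrite big_cons.
by case: (p i) => //; exact: cmeasD.
Qed.

Lemma cmeas_prod (I : Type) (r : seq I) (p : pred I) (F : I -> T -> R[i]) :
  (forall i, cmeas (F i)) -> cmeas (fun t => \prod_(i <- r | p i) F i t).
Proof.
move=> mF; elim: r => [|i r IH].
  by under eq_fun do rewrite big_nil; exact: cmeas_cst.
under eq_fun do rewrite big_cons.
by case: (p i) => //; exact: cmeasM.
Qed.

Definition mxmeas m n (F : T -> 'M[R[i]]_(m, n)) := forall i j, cmeas (fun t => F t i j).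

Lemma mxmeas_cst m n (A : 'M[R[i]]_(m, n)) : mxmeas (fun=> A).
Proof. by move=> i j; exact: cmeas_cst. Qed.

Lemma mxmeasD m n (F G : T -> 'M[R[i]]_(m, n)) :
  mxmeas F -> mxmeas G -> mxmeas (fun t => F t + G t).
Proof. by move=> mF mG i j; under eq_fun do rewrite mxE; exact: cmeasD. Qed.

Lemma mxmeasM m n p (F : T -> 'M[R[i]]_(m, n)) (G : T -> 'M[R[i]]_(n, p)) :
  mxmeas F -> mxmeas G -> mxmeas (fun t => F t *m G t).
Proof.
move=> mF mG i j; under eq_fun do rewrite mxE.
by apply: cmeas_sum => k; exact: cmeasM.
Qed.

Lemma mxmeasJ m n (F : T -> 'M[R[i]]_(m, n)) :
  mxmeas F -> mxmeas (fun t => adjmx (F t)).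
Proof. by move=> mF i j; under eq_fun do rewrite adjmxE; exact: cmeasJ. Qed.

Lemma cmeas_det n (F : T -> 'M[R[i]]_n) : mxmeas F -> cmeas (fun t => \det (F t)).
Proof.
move=> mF; apply: cmeas_sum => s; apply: cmeasM; first exact: cmeas_cst.
by apply: cmeas_prod => i; exact: mF.
Qed.

Lemma measurable_inv_gt0 (f : T -> R) : measurable_fun setT f -> (forall t, 0 < f t) ->
  measurable_fun setT (fun t => (f t)^-1).
Proof.
move=> mf f0; rewrite [X in measurable_fun _ X](_ : _ = (fun t => expR (- ln (f t)))).
  apply: measurableT_comp => //; apply: measurableT_comp => //.
  exact: measurableT_comp.
by apply/funext => t; rewrite expRN lnK// posrE.
Qed.

End cmeas.

Definition cgvec {R : realType} n (v : 'I_n * bool -> R) : 'cV[R[i]]_n :=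
  \col_i Complex (v (i, false)) (v (i, true)).

Lemma mxmeas_cgvec {R : realType} d (T : measurableType d) n (v : T -> 'I_n * bool -> R) :
  (forall i, measurable_fun setT (fun t => v t i)) -> mxmeas (fun t => cgvec (v t)).
Proof. by move=> mv i j; under eq_fun do rewrite mxE; split => /=. Qed.

(** Each real coordinate has variance 1/2, so that, under independence, the entries of [cgvec] are
    proper complex Gaussian of variance 1. *)
Definition std_cgauss {R : realType} d (T : measurableType d) (P : probability T R)
    (I : finType) (X : I -> T -> R) :=
  forall i (B : set R), measurable B -> P (X i @^-1` B) = normal_prob 0 cgauss_sd B.

Lemma law_integral {R : realType} d (T : measurableType d) (P : probability T R)
    (nu : probability (measurableTypeR R) R) (X : T -> R) (f : R -> R) :
  measurable_fun setT X -> (forall B, measurable B -> P (X @^-1` B) = nu B) ->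
  measurable_fun setT f -> (forall x, 0 <= f x) ->
  (\int[P]_t (f (X t))%:E = \int[nu]_x (f x)%:E)%E.
Proof.
move=> mX XE mf f0.
transitivity (\int[pushforward P (X : T -> measurableTypeR R)]_x (f x)%:E)%E.
  rewrite ge0_integral_pushforward//; first exact/measurable_EFinP.
  by move=> x _; rewrite lee_fin.
have mX' : @measurable_fun _ _ T (measurableTypeR R) setT X := mX.
pose p1 := isMeasurableFun.Build _ _ _ _ _ mX'.
pose Y : {mfun _ >-> measurableTypeR R} := HB.pack (X : T -> measurableTypeR R) p1.
apply: (eq_measure_integral nu) => B mB _; exact: XE.
Qed.

Lemma cgauss_integral {R : realType} d (T : measurableType d) (P : probability T R)
    (I : finType) (X : I -> T -> R) i (b g : R) : 
  mutually_independent P X -> std_cgauss P X -> 0 <= b ->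
  (\int[P]_t (expR (- (b * X i t ^+ 2) - 2 * (g * X i t)))%:E =
   ((Num.sqrt (1 + b))^-1 * expR (g ^+ 2 / (1 + b)))%:E)%E.
Proof.
move=> [mX _] gX b0.
rewrite -gauss_exp_quadratic//.
apply: (@law_integral _ _ _ P (normal_prob 0 cgauss_sd) (X i) (fun x => expR (- (b * x ^+ 2) - 2 * (g * x)))) => //.
- exact: gX.
- apply: measurableT_comp => //.
  apply: measurable_funB; first by apply: measurableT_comp => //; apply: measurable_funM => //; exact: measurable_funX.
  by apply: measurable_funM => //; exact: measurable_funM.
Qed.

Lemma Re_realM {R : rcfType} (a : R) (z : R[i]) : Re (a%:C * z) = a * Re z.
Proof. by case: z => x y /=; rewrite mul0r subr0. Qed.

Lemma ge0_ReE {R : rcfType} (z : R[i]) : 0 <= z -> z = (Re z)%:C.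
Proof. by move=> z0; rewrite RRe_real// ger0_real. Qed.

(** * Laplace transform of Gaussian quadratic forms *)

Section gauss_qform.
Context {R : realType}.

Lemma cgvec_block n (v : 'I_n.+1 * bool -> R) :
  cgvec v = col_mx ((Complex (v (ord0, false)) (v (ord0, true)))%:M : 'M[R[i]]_1)
                   (cgvec (fun i => v (lift ord0 i.1, i.2))) :> 'M[R[i]]_(1 + n, 1).
Proof.
apply/matrixP => i j; rewrite (ord1 j); rewrite !mxE; case: splitP => k ik.
  rewrite (ord1 k) !mxE eqxx mulr1n; congr (Complex (v (_, _)) (v (_, _))); apply/val_inj => /=.
    by rewrite ik (ord1 k).
  by rewrite ik (ord1 k).
by rewrite !mxE; congr (Complex (v (_, _)) (v (_, _))); apply/val_inj; rewrite /= ik.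
Qed.

Lemma measurable_qform n (B : 'M[R[i]]_n) :
  measurable_fun [set: fam] (fun v : fam => Re (qform B (cgvec (v : _ -> R)))).
Proof.
have mv : mxmeas (fun v : fam => cgvec (v : 'I_n * bool -> R)).
  by apply: mxmeas_cgvec => i; exact: measurable_coord.
have : mxmeas (fun v : fam => adjmx (cgvec (v : 'I_n * bool -> R)) *m B *m cgvec (v : 'I_n * bool -> R)).
  by apply: mxmeasM => //; apply: mxmeasM; [exact: mxmeasJ|exact: mxmeas_cst].
by move=> /(_ 0 0) [].
Qed.

Lemma measurable_qform_exp n (B : 'M[R[i]]_n) :
  measurable_fun [set: fam] (fun v : fam => expR (- Re (qform B (cgvec (v : _ -> R))))).
Proof.
apply: measurableT_comp => //; apply: measurableT_comp => //.
exact: measurable_qform.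
Qed.

(** Induction on the dimension. Given the other coordinates, the first complex coordinate is
    integrated out by two real Gaussian integrals; this gives the factor [(1 + b)^-1] and replaces
    [D] by the Schur complement [B2], just as elimination does for the determinant of [1 + B]. *)
Lemma gauss_qform n d (T : measurableType d) (P : probability T R)
    (X : 'I_n * bool -> T -> R) (B : 'M[R[i]]_n) :
  mutually_independent P X -> std_cgauss P X -> psdmx B ->
  (\int[P]_t (expR (- Re (qform B (cgvec (X ^~ t)))))%:E =
   ((Re (\det (1%:M + B)))^-1)%:E)%E.
Proof.
elim: n X B => [|n IH] X B iX gX pB.
  rewrite det_mx00 invr1.
  under eq_integral => t _ do rewrite /qform mxE big_ord0 oppr0 expR0.
  by have /= -> := integral_cst P measurableT 1; rewrite probability_setT mule1.
pose b := Re (B 0 0).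
pose r : 'rV_n := @ursubmx _ 1 n 1 n B.
pose D : 'M[R[i]]_n := @drsubmx _ 1 n 1 n B.
have b00 : 0 <= B 0 0 by case: pB => _ /(_ (delta_mx 0 0)); rewrite qform_delta.
have BE : B = block_mx ((b%:C)%:M : 'M[R[i]]_1) r (adjmx r) D :> 'M[R[i]]_(1 + n).
  rewrite -[LHS](@submxK _ 1 n 1 n B); congr block_mx.
    apply/matrixP => i j; rewrite (ord1 i) (ord1 j) !mxE eqxx mulr1n /b -ge0_ReE//.
    by congr (B _ _); apply/val_inj.
  case: pB => hB _; rewrite -[in LHS]hB.
  by apply/matrixP => i j; rewrite !mxE; congr ((B _ _)^*); apply/val_inj.
have b0 : 0 <= b by rewrite -ler0c /b -ge0_ReE.
have b1 : 0 < 1 + b by rewrite ltr_pwDl.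
have b1C : 1 + b%:C = (1 + b)%:C :> R[i] by rewrite rmorphD.
pose B2 := D - (1 + b%:C)^-1 *: (adjmx r *m r).
have pB2 : psdmx B2 by apply: psdmx_schur; [rewrite ler0c|rewrite -BE].
have dE : \det (1%:M + B) = (1 + b%:C) * \det (1%:M + B2).
  rewrite BE -[n.+1]/(1 + n)%N (scalar_mx_block 1 n) add_block_mx !add0r -raddfD /=.
  rewrite det_schur1; last by rewrite b1C -(rmorph0 (real_complex R)) (inj_eq (@complexI R)) gt_eqF.
  by rewrite /B2 addrA.
have RdE : Re (\det (1%:M + B)) = (1 + b) * Re (\det (1%:M + B2)).
  by rewrite dE b1C Re_realM.
pose w (v : 'I_n.+1 * bool -> R) := Complex (v (ord0, false)) (v (ord0, true)).
pose z (v : 'I_n.+1 * bool -> R) : 'cV[R[i]]_n := cgvec (fun i => v (lift ord0 i.1, i.2)).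
pose e (p a : R) := expR (- (b * a ^+ 2) - 2 * (p * a)).
pose p v := Re ((r *m z v) 0 0).
pose q v := Im ((r *m z v) 0 0).
have me (c : R) : measurable_fun setT (e c).
  apply: measurableT_comp => //.
  apply: measurable_funB; first by apply: measurableT_comp => //; apply: measurable_funM => //; exact: measurable_funX.
  by apply: measurable_funM => //; exact: measurable_funM.
(* The cross terms are twice the real part of [conj w * (r z)], so the real and imaginary parts of
   [w] separate, with linear coefficients [p] and [q]. *)
have fE v : expR (- Re (qform B (cgvec v))) =
    expR (- Re (qform D (z v))) * (e (p v) (v (ord0, false)) * e (q v) (v (ord0, true))).
  rewrite -!expRD; congr expR.
  rewrite BE cgvec_block -/(w v) -/(z v) qform_block.
  rewrite /p /q; case: ((r *m z v) 0 0) => h1 h2.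
  have cj x y : (Complex x y)^* = Complex x (- y) :> R[i] by [].
  rewrite normCK /w !cj; case: (qform D (z v)) => g1 g2 /=.
  ring.
have B2E v : Re (qform B2 (z v)) = Re (qform D (z v)) - ((p v) ^+ 2 + (q v) ^+ 2) / (1 + b).
  rewrite /B2 b1C -fmorphV qformD -scaleNr qformZ raddfD/= -rmorphN Re_realM mulNr.
  rewrite -[X in _ *m X](adjmxK r) qform_rank1 adjmxK /p /q; congr (_ - _).
  case: ((r *m z v) 0 0) => h1 h2.
  have cj x y : (Complex x y)^* = Complex x (- y) :> R[i] by [].
  rewrite normCK cj /=.
  by ring.
rewrite (@resample _ _ _ _ _ _ iX (fun i => i.1 != ord0) (fun v => (expR (- Re (qform B (cgvec v))))%:E)); last 2 first.
- by apply/measurable_EFinP; exact: measurable_qform_exp.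
- by move=> v; rewrite lee_fin expR_ge0.
transitivity (\int[P]_x ((1 + b)^-1%:E * (expR (- Re (qform B2 (z (X ^~ x)))))%:E))%E.
  apply: eq_integral => x _.
  pose mx y := (fun i : 'I_n.+1 * bool => if i.1 != ord0 then X i x else X i y).
  have zE y : z (mx y) = z (X ^~ x).
    by apply/matrixP => i j; rewrite !mxE /mx /=.
  have pE y : p (mx y) = p (X ^~ x) by rewrite /p zE.
  have qE y : q (mx y) = q (X ^~ x) by rewrite /q zE.
  under eq_integral => y _ do rewrite -/(mx y) fE zE pE qE EFinM.
  rewrite ge0_integralZl//; last 2 first.
  - apply/measurable_EFinP; apply: measurable_funM.
      by apply: (measurableT_comp (me _)); case: iX => mX _; exact: mX.
    by apply: (measurableT_comp (me _)); case: iX => mX _; exact: mX.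
  - by move=> y _; rewrite lee_fin mulr_ge0 ?expR_ge0.
  rewrite (@indep_product _ _ _ _ _ _ iX (fun i => i == (ord0, false))
    (fun v => e (p (X ^~ x)) (v (ord0, false))) (fun v => e (q (X ^~ x)) (v (ord0, true)))).
  - rewrite !cgauss_integral// -!EFinM; congr EFin.
    rewrite B2E opprD opprK mulrDl !expRD.
    have <- : (Num.sqrt (1 + b))^-1 * (Num.sqrt (1 + b))^-1 = (1 + b)^-1.
      by rewrite -invfM -expr2 sqr_sqrtr// ltW.
    by ring.
  - by apply: (measurableT_comp (me _)); exact: measurable_coord.
  - by apply: (measurableT_comp (me _)); exact: measurable_coord.
  - by move=> v; exact: expR_ge0.
  - by move=> v; exact: expR_ge0.
  - by move=> u v ->.
  - by move=> u v ->.
rewrite ge0_integralZl//; last 2 first.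
- apply/measurable_EFinP.
  apply: (measurableT_comp (measurable_qform_exp B2)
    (g := fun t => (fun i => X (lift ord0 i.1, i.2) t) : fam)).
  by apply: measurable_fam => i; case: iX => mX _; exact: mX.
- by rewrite lee_fin invr_ge0 ltW.
have iX' := indep_sub (h := fun i : 'I_n * bool => (lift ord0 i.1, i.2)) _ iX.
rewrite (IH (fun i => X (lift ord0 i.1, i.2))) //.
- by rewrite RdE invfM EFinM.
- apply: iX' => -[i c] [j d'] H; have /(congr1 fst) /lift_inj /= -> := H; have /(congr1 snd) /= -> // := H.
- by move=> i A mA; exact: gX.
Qed.
End gauss_qform.

(** * Second moments from the Laplace transform *)

Lemma expRN_le_inv (R : realType) (x : R) : 0 <= x -> x / (1 + x) <= 1 - expR (- x).
Proof.
move=> x0; have x1 : 0 < 1 + x by rewrite ltr_pwDl.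
rewrite expRN lerBrDr -lerBrDl.
have -> : 1 - x / (1 + x) = (1 + x)^-1 by field; rewrite gt_eqF.
by rewrite lef_pV2 ?posrE ?expR_gt0// expR_ge1Dx.
Qed.

(** Monotone convergence along [s = 1 / (n + 1)]. *)
Lemma integral_le_of_regularized (R : realType) d (T : measurableType d)
    (P : probability T R) (Q : T -> R) (c : R) :
  measurable_fun setT Q -> (forall t, 0 <= Q t) ->
  (forall s, 0 < s -> (\int[P]_t (Q t / (1 + s * Q t))%:E <= c%:E)%E) ->
  (\int[P]_t (Q t)%:E <= c%:E)%E.
Proof.
move=> mQ Q0 H.
pose s (n : nat) : R := n.+1%:R^-1.
have s0 n : 0 < s n by rewrite invr_gt0.
have d0 n t : 0 < 1 + s n * Q t by rewrite ltr_pwDl// mulr_ge0// ltW.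
pose g n t := (Q t / (1 + s n * Q t))%:E.
have mg n : measurable_fun setT (g n).
  apply/measurable_EFinP; apply: measurable_funM => //.
  by apply: measurable_inv_gt0 => //; apply: measurable_funD => //; exact: measurable_funM.
have -> : (\int[P]_t (Q t)%:E = \int[P]_t limn (g ^~ t))%E.
  apply: eq_integral => t _; apply/esym/cvg_lim => //.
  apply: cvg_EFin; first by near=> n.
  rewrite -[X in _ --> X]mulr1 -[X in _ * X]invr1.
  apply: cvgM; first exact: cvg_cst.
  apply: cvgV; first exact: oner_neq0.
  rewrite -[X in _ --> X]addr0; apply: cvgD; first exact: cvg_cst.
  rewrite -(mul0r (Q t)); apply: cvgM; last exact: cvg_cst.
  exact: cvg_harmonic.
rewrite monotone_convergence//.
- apply: lime_le => //; last by apply: nearW => n; exact: H.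
  apply: ereal_nondecreasing_is_cvgn => m n mn.
  apply: ge0_le_integral => //.
  + by move=> t _; rewrite lee_fin divr_ge0// ltW.
  + by move=> t _; rewrite lee_fin ler_wpM2l// lef_pV2 ?posrE// lerD2l ler_wpM2r// lef_pV2 ?posrE// ler_nat ltnS.
- by move=> n t _; rewrite lee_fin divr_ge0// ltW.
- move=> t _ m n mn; rewrite lee_fin ler_wpM2l// lef_pV2 ?posrE// lerD2l ler_wpM2r//.
  by rewrite lef_pV2 ?posrE// ler_nat ltnS.
Unshelve. all: end_near.
Qed.

Lemma prod1D_le_expR (R : realType) (I : Type) (r : seq I) (x : I -> R) :
  (forall i, 0 <= x i) -> \prod_(i <- r) (1 + x i) <= expR (\sum_(i <- r) x i).
Proof.
move=> x0; rewrite expR_sum; apply: ler_prod => i _.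
by rewrite expR_ge1Dx addr_ge0.
Qed.

Lemma integral_prob_cst (R : realType) d (T : measurableType d) (P : probability T R) (c : R) :
  (\int[P]_t c%:E = c%:E)%E.
Proof. by have /= -> := integral_cst P measurableT c%:E; rewrite probability_setT mule1. Qed.

Section moment.
Context {R : realType} (n : nat) d (T : measurableType d) (P : probability T R).
Variable X : 'I_n * bool -> T -> R.
Hypotheses (iX : mutually_independent P X) (gX : std_cgauss P X).

(** Read off from [gauss_qform]: for the quadratic form [Q],
    [Q / (1 + s Q) <= (1 - exp (- s Q)) / s], and the mean of [exp (- s Q)] is
    [\prod_i (1 + s c_i)^-1], which is at least [exp (- s \sum_i c_i) >= 1 - s \sum_i c_i]. Then [s]
    tends to 0. *)
Lemma cgauss_moment (U : 'M[R[i]]_n) (c : 'I_n -> R) :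
  U *m adjmx U = 1%:M -> adjmx U *m U = 1%:M -> (forall i, 0 <= c i) ->
  (\int[P]_t (\sum_i c i * Re (`|(U *m cgvec (X ^~ t)) i 0| ^+ 2))%:E
    <= (\sum_i c i)%:E)%E.
Proof.
move=> U1 U2 c0.
pose B s : 'M[R[i]]_n := adjmx U *m diag_mx (\row_i (s * c i)%:C) *m U.
have pB s : 0 <= s -> psdmx (B s).
  by move=> s0; apply: psdmx_spectral_inv => i; rewrite mxE ler0c mulr_ge0.
pose Q (v : 'I_n * bool -> R) := \sum_i c i * Re (`|(U *m cgvec v) i 0| ^+ 2).
have QE s v : Re (qform (B s) (cgvec v)) = s * Q v.
  rewrite qform_spectral /Q mulr_sumr raddf_sum; apply: eq_bigr => i _ /=.
  by rewrite mxE Re_realM mulrA.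
have Q0 v : 0 <= Q v.
  apply: sumr_ge0 => i _; rewrite mulr_ge0//.
  by have := exprn_ge0 2 (normr_ge0 ((U *m cgvec v) i 0)); rewrite lecE => /andP[].
have mQ : measurable_fun setT (fun t => Q (X ^~ t)).
  rewrite [X in measurable_fun _ X](_ : _ = (fun t => Re (qform (B 1) (cgvec (X ^~ t))))).
    apply: (measurableT_comp (measurable_qform (B 1)) (g := fun t => (X ^~ t) : fam)).
    exact: (measurable_family iX).
  by apply/funext => t; rewrite QE mul1r.
apply: integral_le_of_regularized => [//|t|s s0]; first exact: Q0.
have dB : Re (\det (1%:M + B s)) = \prod_i (1 + s * c i).
  rewrite (det1D_spectral U1 U2 erefl) (_ : \prod_i _ = (\prod_i (1 + s * c i))%:C)//.
  by rewrite rmorph_prod; apply: eq_bigr => i _; rewrite mxE rmorphD.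
have D0 : 0 < \prod_i (1 + s * c i).
  by apply: prodr_gt0 => i _; rewrite ltr_pwDl// mulr_ge0// ltW.
have d0 t : 0 < 1 + s * Q (X ^~ t) by rewrite ltr_pwDl// mulr_ge0// ltW.
have := gauss_qform iX gX (pB s (ltW s0)); rewrite dB.
under eq_integral do rewrite QE.
move=> E.
have mE : measurable_fun setT (fun t => (expR (- (s * Q (X ^~ t))))%:E).
  by apply/measurable_EFinP; do 2 apply: measurableT_comp => //; exact: measurable_funM.
have mF : measurable_fun setT (fun t => (Q (X ^~ t) / (1 + s * Q (X ^~ t)))%:E).
  apply/measurable_EFinP; apply: measurable_funM => //.
  by apply: measurable_inv_gt0 => //; apply: measurable_funD => //; exact: measurable_funM.
have : (\int[P]_t ((Q (X ^~ t) / (1 + s * Q (X ^~ t)))%:E + s^-1%:E * (expR (- (s * Q (X ^~ t))))%:E)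
   <= \int[P]_t (s^-1)%:E)%E.
  apply: ge0_le_integral => //.
  - by move=> t _; rewrite adde_ge0// -?EFinM lee_fin ?divr_ge0 ?mulr_ge0 ?invr_ge0 ?expR_ge0// ltW.
  - by apply: emeasurable_funD => //; exact: emeasurable_funM.
  - move=> t _; rewrite -EFinM -EFinD lee_fin -lerBrDr.
    have := @expRN_le_inv R (s * Q (X ^~ t)); rewrite mulr_ge0 ?(ltW s0)// => /(_ isT).
    move=> H; rewrite -(ler_pM2l s0) mulrA; apply: (le_trans H).
    by rewrite mulrBr mulrA !mulfV ?gt_eqF// mul1r.
rewrite integral_prob_cst ge0_integralD//; last 3 first.
- by move=> t _; rewrite lee_fin divr_ge0// ltW.
- by move=> t _; rewrite mule_ge0 ?lee_fin ?invr_ge0 ?expR_ge0 ?ltW.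
- exact: emeasurable_funM.
rewrite ge0_integralZl//; last by rewrite lee_fin invr_ge0 ltW.
rewrite E -EFinM -leeBrDr// -EFinB => /le_trans; apply.
rewrite lee_fin -{1}[s^-1]mulr1 -mulrBr -(ler_pM2l s0) mulrA mulfV ?gt_eqF// mul1r.
rewrite lerBlDr -lerBlDl; apply: (@le_trans _ _ (expR (- (s * \sum_i c i)))).
  exact: expR_ge1Dx.
rewrite expRN lef_pV2 ?posrE ?expR_gt0// mulr_sumr.
by apply: prod1D_le_expR => i; rewrite mulr_ge0// ltW.
Qed.

End moment.

Section pmeas.
Context {R : realType} d (T : measurableType d).
Implicit Types F G : T -> {poly R[i]}.

Definition pmeas F := forall j, cmeas (fun t => (F t)`_j).

Lemma pmeas_cst p : pmeas (fun=> p).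
Proof. by move=> j; exact: cmeas_cst. Qed.

Lemma pmeasD F G : pmeas F -> pmeas G -> pmeas (fun t => F t + G t).
Proof. by move=> mF mG j; under eq_fun do rewrite coefD; exact: cmeasD. Qed.

Lemma pmeasM F G : pmeas F -> pmeas G -> pmeas (fun t => F t * G t).
Proof.
move=> mF mG j; under eq_fun do rewrite coefM.
by apply: cmeas_sum => k; exact: cmeasM.
Qed.

Lemma pmeasC (f : T -> R[i]) : cmeas f -> pmeas (fun t => (f t)%:P).
Proof.
move=> mf j; under eq_fun do rewrite coefC.
by case: eqP => // _; exact: cmeas_cst.
Qed.

Lemma pmeas_sum (I : Type) (r : seq I) (F : I -> T -> {poly R[i]}) :
  (forall i, pmeas (F i)) -> pmeas (fun t => \sum_(i <- r) F i t).
Proof.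
move=> mF; elim: r => [|i r IH].
  by under eq_fun do rewrite big_nil; exact: pmeas_cst.
by under eq_fun do rewrite big_cons; exact: pmeasD.
Qed.

Lemma pmeas_prod (I : Type) (r : seq I) (F : I -> T -> {poly R[i]}) :
  (forall i, pmeas (F i)) -> pmeas (fun t => \prod_(i <- r) F i t).
Proof.
move=> mF; elim: r => [|i r IH].
  by under eq_fun do rewrite big_nil; exact: pmeas_cst.
by under eq_fun do rewrite big_cons; exact: pmeasM.
Qed.

Lemma pmeas_shiftdet n (B : T -> 'M[R[i]]_n) : mxmeas B -> pmeas (fun t => shiftdet (B t)).
Proof.
move=> mB; apply: pmeas_sum => s; apply: pmeasM; first exact: pmeas_cst.
apply: pmeas_prod => i; under eq_fun do rewrite mxE.
apply: pmeasD; first exact: pmeas_cst.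
by under eq_fun do rewrite mxE; apply: pmeasC; exact: mB.
Qed.

End pmeas.

Section columns.
Context {R : realType} {N K : nat}.
Local Notation idx := (('I_N * 'I_K) + ('I_N * 'I_K))%type.

Definition hcol (m : 'I_K) (x : 'I_N * bool) : idx :=
  if x.2 then inr (x.1, m) else inl (x.1, m).

Lemma hcol_inj m : injective (hcol m).
Proof. by move=> [i []] [j []] //= [->]. Qed.

Definition in_col (m : 'I_K) (x : idx) : bool :=
  match x with inl ij => ij.2 == m | inr ij => ij.2 == m end.

Lemma in_col_hcol m m' x : in_col m (hcol m' x) = (m' == m).
Proof. by case: x => i []. Qed.

Definition colv (m : 'I_K) (v : idx -> R) : 'cV[R[i]]_N := cgvec (fun x => v (hcol m x)).

(** The list [r] lets [pot_gram_integral] add the columns one at a time. *)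
Definition gram (phi : 'I_K -> R) (r : seq 'I_K) (v : idx -> R) : 'M[R[i]]_N :=
  \sum_(m <- r) (phi m)%:C *: (colv m v *m adjmx (colv m v)).

Lemma psdmx_gram phi r v : (forall m, 0 <= phi m) -> psdmx (gram phi r v).
Proof.
move=> phi0; rewrite /gram; elim: r => [|m r IH]; first by rewrite big_nil; exact: psdmx0.
by rewrite big_cons; apply: psdmxD => //; apply: psdmxZ; [rewrite ler0c|exact: psdmx_rank1].
Qed.

Lemma mxmeas_colv d (T : measurableType d) (v : T -> idx -> R) m :
  (forall i, measurable_fun setT (fun t => v t i)) -> mxmeas (fun t => colv m (v t)).
Proof. by move=> mv; apply: mxmeas_cgvec. Qed.

Lemma mxmeas_gram d (T : measurableType d) (phi : T -> 'I_K -> R) (v : T -> idx -> R) r :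
  (forall m, measurable_fun setT (fun t => phi t m)) ->
  (forall i, measurable_fun setT (fun t => v t i)) ->
  mxmeas (fun t => gram (phi t) r (v t)).
Proof.
move=> mphi mv; rewrite /gram; elim: r => [|m r IH].
  by under eq_fun do rewrite big_nil; exact: mxmeas_cst.
under eq_fun do rewrite big_cons; apply: mxmeasD => // i j.
under eq_fun do rewrite mxE; apply: cmeasM.
  by split => //=; exact: mphi.
apply: mxmeasM; first exact: mxmeas_colv.
by apply: mxmeasJ; exact: mxmeas_colv.
Qed.

End columns.

(** * Mean determinant of a Gaussian Gram matrix *)

Section potential.
Context {R : realType} (N : nat) (eta : R).
Hypotheses (N0 : (0 < N)%N) (eta0 : 0 < eta).

(** With [x = N eta], [pot p] is [x ^ (N + 1) / N!] times the integral of [p(s) exp (- x s)] over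
    [s >= 0], for [p] of degree at most [N]: a normalised Laplace transform at [x]. *)
Definition pot_weight (j : nat) : R := (N%:R * eta) ^+ (N - j) * j`!%:R / N`!%:R.

Definition pot (p : {poly R[i]}) : R[i] := \sum_(j < N.+1) (pot_weight j)%:C * p`_j.

Lemma pot_weight_gt0 j : 0 < pot_weight j.
Proof.
rewrite /pot_weight divr_gt0 ?mulr_gt0 ?exprn_gt0 ?ltr0n ?fact_gt0//.
by rewrite mulr_gt0 ?ltr0n.
Qed.

Lemma potD p q : pot (p + q) = pot p + pot q.
Proof. by rewrite /pot -big_split; apply: eq_bigr => j _; rewrite coefD mulrDr. Qed.

Lemma potZ a p : pot (a *: p) = a * pot p.
Proof. by rewrite /pot mulr_sumr; apply: eq_bigr => j _; rewrite coefZ mulrCA. Qed.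

Lemma pot_sum (I : Type) (r : seq I) (F : I -> {poly R[i]}) :
  pot (\sum_(i <- r) F i) = \sum_(i <- r) pot (F i).
Proof.
elim: r => [|i r IH]; last by rewrite !big_cons potD IH.
by rewrite !big_nil /pot big1// => j _; rewrite coef0 mulr0.
Qed.

Lemma pot_ge0 (p : {poly R[i]}) : (forall j, 0 <= p`_j) -> 0 <= pot p.
Proof.
move=> p0; apply: sumr_ge0 => j _; rewrite mulr_ge0//.
by rewrite ler0c ltW ?pot_weight_gt0.
Qed.

(** Integration by parts, carried out on coefficients; the discarded boundary term is the one of the
    constant coefficient. *)
Lemma pot_deriv (p : {poly R[i]}) : (forall j, 0 <= p`_j) -> (size p <= N.+1)%N ->
  pot p^`() <= (N%:R * eta)%:C * pot p.
Proof.
move=> p0 sp.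
have -> : pot p^`() = \sum_(j < N) (N%:R * eta)%:C * ((pot_weight j.+1)%:C * p`_(j.+1)).
  rewrite /pot big_ord_recr/= coef_deriv [p`_N.+1]nth_default// mul0rn mulr0 addr0.
  apply: eq_bigr => j _; rewrite coef_deriv mulrnAr -mulrnAl -rmorphMn/= -mulr_natr.
  rewrite [X in X%:C * _](_ : _ = N%:R * eta * pot_weight j.+1) ?rmorphM ?mulrA//.
  rewrite /pot_weight factS natrM -(subnSK (ltn_ord j)) exprS.
  by rewrite -!mulrA; congr (_ * (_ * _)); ring.
rewrite -mulr_sumr ler_pM2l; last by rewrite -(rmorph0 (real_complex R)) ltcR mulr_gt0 ?ltr0n.
rewrite /pot [leRHS]big_ord_recl /= lerDr mulr_ge0//.
by rewrite ler0c ltW ?pot_weight_gt0.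
Qed.

(** The inequality [x ^ j / j! <= exp x], for all [j] at once, makes this a bound for the inverse of
    every weight. It exceeds [exp (N I(eta))] by at most a factor linear in [N], see
    [ln_pot_bound]. *)
Definition pot_bound : R := N`!%:R / (N%:R * eta) ^+ N * expR (N%:R * eta).

Lemma pot_weight_bound j : (j <= N)%N -> 1 <= pot_bound * pot_weight j.
Proof.
move=> jN.
have x0 : 0 < N%:R * eta by rewrite mulr_gt0 ?ltr0n.
have -> : pot_bound * pot_weight j = expR (N%:R * eta) / ((N%:R * eta) ^+ j / j`!%:R).
  rewrite /pot_bound /pot_weight.
  have -> : (N%:R * eta) ^+ N = (N%:R * eta) ^+ (N - j) * (N%:R * eta) ^+ j.
    by rewrite -exprD subnK.
  have f0 (k : nat) : k`!%:R != 0 :> R by rewrite pnatr_eq0 -lt0n fact_gt0.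
  have e0 k : (N%:R * eta) ^+ k != 0 by rewrite expf_neq0 ?gt_eqF.
  move: (e0 (N - j)%N) (e0 j) (f0 N) (f0 j).
  move: ((N%:R * eta) ^+ (N - j)) ((N%:R * eta) ^+ j) (N`!%:R : R) (j`!%:R : R) (expR _).
  by move=> a b c d' e a0 b0 c0 d0; field; rewrite a0 b0 c0 d0.
rewrite ler_pdivlMr ?divr_gt0 ?exprn_gt0 ?ltr0n ?fact_gt0// mul1r.
case: j jN => [_|j _]; first by rewrite expr0 divr1; apply: le_trans (expR_ge1Dx _); rewrite lerDl ltW.
by apply: le_trans (expR_ge1Dxn j (ltW x0)); rewrite lerDr.
Qed.

Lemma horner1_le_pot (p : {poly R[i]}) : (forall j, 0 <= p`_j) -> (size p <= N.+1)%N ->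
  p.[1] <= pot_bound%:C * pot p.
Proof.
move=> p0 sp.
rewrite (horner_coef_wide _ sp) /pot mulr_sumr; apply: ler_sum => j _.
rewrite expr1n mulr1 mulrA -rmorphM -[leLHS]mul1r ler_wpM2r//.
by rewrite -(rmorph1 (real_complex R)) lecR pot_weight_bound// -ltnS.
Qed.

End potential.

Section det_upper.
Context {R : realType} {N K : nat} d (T : measurableType d) (P : probability T R).
Local Notation idx := (('I_N * 'I_K) + ('I_N * 'I_K))%type.
Variable X : idx -> T -> R.
Hypotheses (iX : mutually_independent P X) (gX : std_cgauss P X).
Variables (eta : R) (phi : 'I_K -> R).
Hypotheses (N0 : (0 < N)%N) (eta0 : 0 < eta) (phi0 : forall m, 0 <= phi m).

Lemma le_Re (x y : R[i]) : x <= y -> Re x <= Re y.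
Proof. by rewrite lecE => /andP[]. Qed.

Lemma prodXD_coef_ge0 (I : Type) (r : seq I) (p : pred I) (l : I -> R[i]) j :
  (forall i, 0 <= l i) -> 0 <= (\prod_(i <- r | p i) ('X + (l i)%:P))`_j.
Proof.
move=> l0.
move: j; apply: (big_ind (fun q : {poly R[i]} => forall j, 0 <= q`_j)).
- by move=> j; rewrite coef1; case: eqP.
- by move=> q q' q0 q0' j; rewrite coefM; apply: sumr_ge0 => k _; rewrite mulr_ge0.
- by move=> i _ j; rewrite coefD coefX coefC addr_ge0 ?ler0n//; case: eqP => // _; exact: l0.
Qed.

Lemma shiftdet_coef_ge0 (B : 'M[R[i]]_N) j : psdmx B -> 0 <= (shiftdet B)`_j.
Proof.
move=> /psdmx_spectral[U [l [U1 U2 BE l0]]]; rewrite (shiftdet_spectral U1 U2 BE).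
exact: prodXD_coef_ge0.
Qed.

Lemma size_shiftdet (B : 'M[R[i]]_N) : psdmx B -> (size (shiftdet B) <= N.+1)%N.
Proof.
move=> /psdmx_spectral[U [l [U1 U2 BE l0]]]; rewrite (shiftdet_spectral U1 U2 BE).
under eq_bigr do rewrite -[(l 0 _)%:P]opprK -polyCN.
by rewrite size_prod_XsubC -sum1_size sum1_card card_ord.
Qed.

Lemma column_indep m : mutually_independent P (fun x => X (hcol m x)).
Proof. by apply: indep_sub iX; exact: hcol_inj. Qed.

Lemma column_gauss m : std_cgauss P (fun x => X (hcol m x)).
Proof. by move=> x B mB; exact: gX. Qed.

(** By [shiftdet_rank1] the update is linear in the [|(U v)_i|^2], and [cgauss_moment] bounds the
    mean of their combination by the sum [\sum_i c i], which is [pot q'] for [q = shiftdet B]. *)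
Lemma pot_rank1_integral m (B : 'M[R[i]]_N) : psdmx B ->
  (\int[P]_y (Re (pot N eta (shiftdet (B + (phi m)%:C *: (colv m (X ^~ y) *m adjmx (colv m (X ^~ y)))))))%:E
   <= ((1 + N%:R * eta * phi m) * Re (pot N eta (shiftdet B)))%:E)%E.
Proof.
move=> pB; have [U [l [U1 U2 BE l0]]] := psdmx_spectral pB.
pose Q i := \prod_(j | j != i) ('X + (l 0 j)%:P).
pose c i := Re (pot N eta (Q i)).
have cE i : pot N eta (Q i) = (c i)%:C.
  by apply: ge0_ReE; apply: pot_ge0 => // j; apply: prodXD_coef_ge0.
have c0 i : 0 <= c i.
  by rewrite -ler0c -cE; apply: pot_ge0 => // j; apply: prodXD_coef_ge0.
have nE (z : R[i]) : `|z| ^+ 2 = (Re (`|z| ^+ 2))%:C by rewrite -ge0_ReE// exprn_ge0.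
have E y : Re (pot N eta (shiftdet (B + (phi m)%:C *: (colv m (X ^~ y) *m adjmx (colv m (X ^~ y)))))) =
   Re (pot N eta (shiftdet B)) + phi m * \sum_i c i * Re (`|(U *m colv m (X ^~ y)) i 0| ^+ 2).
  rewrite (shiftdet_rank1 _ _ U1 U2 BE) potD raddfD/= (shiftdet_spectral U1 U2 BE); congr (_ + _).
  rewrite pot_sum raddf_sum mulr_sumr; apply: eq_bigr => i _ /=.
  rewrite potZ -/(Q i) cE nE -!rmorphM/=; ring.
have sumc : \sum_i c i <= N%:R * eta * Re (pot N eta (shiftdet B)).
  have -> : \sum_i c i = Re (pot N eta (shiftdet B)^`()).
    rewrite (shiftdet_spectral U1 U2 BE) deriv_prod ?index_enum_uniq// pot_sum raddf_sum.
    by apply: eq_bigr => i _; rewrite derivD derivX derivC addr0 mul1r.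
  rewrite -Re_realM; apply: le_Re; apply: pot_deriv => //; last exact: size_shiftdet.
  by move=> j; exact: shiftdet_coef_ge0.
have q0 : 0 <= Re (pot N eta (shiftdet B)).
  by rewrite -[0]/(Re (0 : R[i])); apply: le_Re; apply: pot_ge0 => // j; exact: shiftdet_coef_ge0.
pose W v := \sum_i c i * Re (`|(U *m colv m v) i 0| ^+ 2).
have W0 v : 0 <= W v.
  by apply: sumr_ge0 => i _; rewrite mulr_ge0// -ler0c -nE exprn_ge0.
have mW : measurable_fun setT (fun t => W (X ^~ t)).
  apply: measurable_sum => i; apply: measurable_funM => //.
  have : mxmeas (fun t => U *m colv m (X ^~ t)).
    apply: mxmeasM; first exact: mxmeas_cst.
    by apply: mxmeas_colv => k; case: iX => mX _; exact: mX.
  move=> /(_ i 0) h; have [+ _] := cmeasM h (cmeasJ h).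
  by under eq_fun do rewrite -normCK.
under eq_integral do rewrite E EFinD EFinM.
rewrite ge0_integralD//; last 2 first.
- by move=> y _; rewrite -EFinM lee_fin mulr_ge0//; exact: W0.
- by apply: emeasurable_funM => //; exact/measurable_EFinP.
rewrite integral_prob_cst ge0_integralZl//; last 3 first.
- exact/measurable_EFinP.
- by move=> y _; rewrite lee_fin; exact: W0.
- by rewrite lee_fin.
rewrite mulrDl mul1r EFinD leeD2l//.
apply: (@le_trans _ _ ((phi m)%:E * (\sum_i c i)%:E)%E).
  by apply: lee_wpmul2l; [rewrite lee_fin|exact: (cgauss_moment (column_indep m) (column_gauss m))].
rewrite -EFinM lee_fin; apply: (le_trans (ler_wpM2l (phi0 m) sumc)).
by rewrite le_eqVlt; apply/orP; left; apply/eqP; ring.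
Qed.

Lemma measurable_pot_gram r :
  measurable_fun [set: fam] (fun v : fam => Re (pot N eta (shiftdet (gram phi r (v : idx -> R))))).
Proof.
have mB : mxmeas (fun v : fam => gram phi r (v : idx -> R)).
  apply: (mxmeas_gram (phi := fun=> phi)) => [m|i]; first exact: measurable_cst.
  exact: measurable_coord.
suff [] : cmeas (fun v : fam => pot N eta (shiftdet (gram phi r (v : idx -> R)))) by [].
apply: cmeas_sum => j; apply: cmeasM; first exact: cmeas_cst.
exact: pmeas_shiftdet.
Qed.

Lemma pot_gram_integral r : uniq r ->
  (\int[P]_t (Re (pot N eta (shiftdet (gram phi r (X ^~ t)))))%:E
   <= (\prod_(m <- r) (1 + N%:R * eta * phi m))%:E)%E.
Proof.
elim: r => [_|m r IH /= /andP[mr ur]].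
  under eq_integral do rewrite /gram big_nil.
  rewrite integral_prob_cst big_nil lee_fin.
  (* Without columns the polynomial is ['X^N], and the division by [N!] in the weights gives
     [pot 'X^N = 1]. *)
  rewrite /shiftdet map_mx0 addr0 det_scalar /pot big_ord_recr/=.
  rewrite big1 ?add0r; last by move=> j _; rewrite coefXn ltn_eqF// mulr0.
  rewrite coefXn eqxx mulr1 /pot_weight subnn expr0 mul1r divff// pnatr_eq0 -lt0n fact_gt0//.
have mF r' : measurable_fun [set: fam] (fun v : fam => (Re (pot N eta (shiftdet (gram phi r' (v : idx -> R)))))%:E).
  by apply/measurable_EFinP; exact: measurable_pot_gram.
have F0 r' (v : idx -> R) : (0 <= (Re (pot N eta (shiftdet (gram phi r' v))))%:E)%E.
  rewrite lee_fin -[0]/(Re (0 : R[i])); apply: le_Re; apply: pot_ge0 => // j.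
  by apply: shiftdet_coef_ge0; exact: psdmx_gram.
have mG : measurable_fun setT (fun t => (Re (pot N eta (shiftdet (gram phi r (X ^~ t)))))%:E).
  exact: (measurableT_comp (mF r) (measurable_family iX)).
rewrite (@resample _ _ _ _ _ _ iX (fun i => ~~ in_col m i)
  (fun v => (Re (pot N eta (shiftdet (gram phi (m :: r) v))))%:E))//.
pose mix x y := fun i => if ~~ in_col m i then X i x else X i y.
have mixE x y : gram phi (m :: r) (mix x y) =
    gram phi r (X ^~ x) + (phi m)%:C *: (colv m (X ^~ y) *m adjmx (colv m (X ^~ y))).
  rewrite /gram big_cons addrC; congr (_ + _).
    rewrite big_seq [RHS]big_seq; apply: eq_bigr => k kr.
    suff -> : colv k (mix x y) = colv k (X ^~ x) by [].
    apply/matrixP => i j; rewrite !mxE /mix !in_col_hcol.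
    by have /negbTE -> : k != m by apply: contraNneq mr => <-.
  suff -> : colv m (mix x y) = colv m (X ^~ y) by [].
  by apply/matrixP => i j; rewrite !mxE /mix !in_col_hcol eqxx.
apply: (@le_trans _ _ (\int[P]_x ((1 + N%:R * eta * phi m)%:E * (Re (pot N eta (shiftdet (gram phi r (X ^~ x)))))%:E))%E).
  apply: ge0_le_integral => //.
  - by move=> x _; apply: integral_ge0.
  - exact: (measurable_resample iX (fun i => ~~ in_col m i)
      (f := fun v => (Re (pot N eta (shiftdet (gram phi (m :: r) v))))%:E)).
  - exact: emeasurable_funM.
  - move=> x _; rewrite -EFinM; under eq_integral do rewrite -/(mix x _) mixE.
    by apply: pot_rank1_integral; exact: psdmx_gram.
rewrite ge0_integralZl//; last first.
  by rewrite lee_fin addr_ge0// !mulr_ge0// ltW.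
rewrite big_cons EFinM; apply: lee_wpmul2l; last exact: IH.
by rewrite lee_fin addr_ge0// !mulr_ge0// ltW.
Qed.

Lemma det_gram_integral :
  (\int[P]_t (Re (\det (1%:M + gram phi (index_enum _) (X ^~ t))))%:E
   <= (pot_bound N eta * \prod_m (1 + N%:R * eta * phi m))%:E)%E.
Proof.
pose G t := gram phi (index_enum _) (X ^~ t).
have pG t : psdmx (G t) by exact: psdmx_gram.
have mpot : measurable_fun setT (fun t => (Re (pot N eta (shiftdet (G t))))%:E).
  apply/measurable_EFinP.
  exact: (measurableT_comp (measurable_pot_gram (index_enum _)) (measurable_family iX)).
have pot0 t : 0 <= Re (pot N eta (shiftdet (G t))).
  by rewrite -[0]/(Re (0 : R[i])); apply: le_Re; apply: pot_ge0 => // j; exact: shiftdet_coef_ge0.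
have pb0 : 0 <= pot_bound N eta.
  by rewrite mulr_ge0 ?expR_ge0// divr_ge0 ?exprn_ge0// mulr_ge0// ltW.
apply: (@le_trans _ _ (\int[P]_t ((pot_bound N eta)%:E * (Re (pot N eta (shiftdet (G t))))%:E))%E).
  apply: ge0_le_integral => //.
  - move=> t _; rewrite lee_fin -[0]/(Re (0 : R[i])); apply: le_Re.
    by apply: le_trans (det1D_psd_ge1 (pG t)).
  - apply/measurable_EFinP.
    suff [] : cmeas (fun t => \det (1%:M + G t)) by [].
    apply: cmeas_det; apply: mxmeasD; first exact: mxmeas_cst.
    apply: (mxmeas_gram (phi := fun=> phi)) => [m|i]; first exact: measurable_cst.
    by case: iX => mX _; exact: mX.
  - exact: emeasurable_funM.
  - move=> t _; rewrite -EFinM lee_fin -Re_realM -shiftdet1; apply: le_Re.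
    apply: horner1_le_pot => //; last by apply: size_shiftdet; exact: pG.
    move=> j.
    by apply: shiftdet_coef_ge0; exact: pG.
rewrite ge0_integralZl ?lee_fin//; last by move=> t _; rewrite lee_fin.
by rewrite [leRHS]EFinM; apply: lee_wpmul2l; [rewrite lee_fin|exact: pot_gram_integral (index_enum_uniq _)].
Qed.

End det_upper.

(** Cramer rate function of [|z|^2 / N], with [z] a standard complex Gaussian vector. *)
Definition rate {R : realType} (e : R) : R := e - 1 - ln e.

(** * Mean inverse determinant *)

Section grid.
Context {R : realType} (N K : nat) (kappa : R) (phi : 'I_K -> R).
Hypotheses (kappa0 : 0 < kappa) (kappa1 : kappa < 1) (phi0 : forall m, 0 <= phi m).

(** At [r = |z|^2 / N] this is the mean of [exp (- z^H S z)] over the columns, for fixed [z]. *)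
Definition grid_prod (r : R) : R := \prod_m (1 + N%:R * phi m * r)^-1.

Lemma grid_prod_ge0 r : 0 <= r -> 0 <= grid_prod r.
Proof. by move=> r0; apply: prodr_ge0 => m _; rewrite invr_ge0 addr_ge0// !mulr_ge0. Qed.

Lemma grid_prod_le r s : 0 <= r -> r <= s -> grid_prod s <= grid_prod r.
Proof.
move=> r0 rs; have s0 := le_trans r0 rs; apply: ler_prod => m _.
have n0 : 0 <= N%:R * phi m by rewrite mulr_ge0.
rewrite invr_ge0 addr_ge0 ?mulr_ge0//= lef_pV2 ?posrE ?ltr_pwDl ?mulr_ge0//.
by rewrite lerD2l ler_wpM2l.
Qed.

Lemma grid_prod_le1 r : 0 <= r -> grid_prod r <= 1.
Proof.
move=> r0; apply: le_trans (grid_prod_le (lexx 0) r0) _.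
by rewrite /grid_prod big1// => m _; rewrite mulr0 addr0 invr1.
Qed.

(* Chernoff weight: at least 1 for [r <= kappa ^+ i], of mean [exp (- N I(kappa ^+ i))] at
   [r = |z|^2 / N]; the exponent [kappa ^- i - 1] is the optimal one. *)
Definition tilt (i : nat) (r : R) : R := expR ((kappa ^- i - 1) * (N%:R * kappa ^+ i - N%:R * r)).

Lemma tilt_ge1 i r : r <= kappa ^+ i -> 1 <= tilt i r.
Proof.
move=> ri; rewrite /tilt; apply: le_trans (expR_ge1Dx _); rewrite lerDl mulr_ge0//.
  by rewrite subr_ge0 invf_ge1 ?exprn_gt0// exprn_ile1// ltW.
by rewrite -mulrBr mulr_ge0// subr_ge0.
Qed.

(** The cell of [r] between [kappa ^ i.+1] and [kappa ^ i] selects the term [i]: monotonicity moves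
    [r] to the lower end, while the tilt uses the upper end. The mismatch of the two exponents is
    the price of the discretisation. *)
Lemma grid_bound_above J r : kappa ^+ J.+1 <= r ->
  grid_prod r <= \sum_(i < J.+1) tilt i r * grid_prod (kappa ^+ i.+1).
Proof.
have k0 i : 0 <= kappa ^+ i by rewrite exprn_ge0// ltW.
have t0 i r' : 0 <= tilt i r' * grid_prod (kappa ^+ i.+1).
  by rewrite mulr_ge0 ?expR_ge0 ?grid_prod_ge0.
elim: J => [|J IH] Jr.
  (* At [i = 0] the tilt is identically 1, so this term also covers all [r > 1] without an upper
     tail estimate. *)
  rewrite big_ord1 /tilt expr0 invr1 subrr mul0r expR0 mul1r.
  by apply: grid_prod_le.
rewrite big_ord_recr /=; have [|rJ] := leP (kappa ^+ J.+1) r.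
  by move=> /IH /le_trans; apply; rewrite lerDl.
apply: (@le_trans _ _ (tilt J.+1 r * grid_prod (kappa ^+ J.+2))).
  apply: (le_trans (grid_prod_le (k0 _) Jr)).
  by apply: ler_peMl; [exact: grid_prod_ge0|exact/tilt_ge1/ltW].
by rewrite lerDr sumr_ge0.
Qed.

(** Below the last grid point only [grid_prod r <= 1] is used; there the smallness comes from the
    tilt. *)
Lemma grid_bound J r : 0 <= r ->
  grid_prod r <= \sum_(i < J) tilt i r * grid_prod (kappa ^+ i.+1) + tilt J r.
Proof.
move=> r0; have k0 i : 0 <= kappa ^+ i by rewrite exprn_ge0// ltW.
have t0 i r' : 0 <= tilt i r' * grid_prod (kappa ^+ i.+1).
  by rewrite mulr_ge0 ?expR_ge0 ?grid_prod_ge0.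
have [rJ|/ltW Jr] := leP r (kappa ^+ J).
  apply: (le_trans (grid_prod_le1 r0)); apply: (le_trans (tilt_ge1 rJ)).
  by rewrite lerDr sumr_ge0.
case: J Jr => [|J] Jr.
  by rewrite big_ord0 add0r /tilt expr0 invr1 subrr mul0r expR0 grid_prod_le1.
by apply: (le_trans (grid_bound_above Jr)); rewrite lerDl expR_ge0.
Qed.

Definition grid_total (J : nat) : R :=
  \sum_(i < J) expR (- (N%:R * rate (kappa ^+ i))) * grid_prod (kappa ^+ i.+1) +
  expR (- (N%:R * rate (kappa ^+ J))).

End grid.

Section det_lower.
Context {R : realType} {N K : nat} d (T : measurableType d) (P : probability T R).
Local Notation idx := (('I_N * 'I_K) + ('I_N * 'I_K))%type.
Variable X : idx -> T -> R.
Hypotheses (iX : mutually_independent P X) (gX : std_cgauss P X).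
Variables (kappa : R) (phi : 'I_K -> R).
Hypotheses (kappa0 : 0 < kappa) (kappa1 : kappa < 1) (phi0 : forall m, 0 <= phi m).
Variable m0 : 'I_K.
Hypothesis N0 : (0 < N)%N.

Definition sqnorm (z : 'cV[R[i]]_N) : R := \sum_i Re (`|z i 0| ^+ 2).

Lemma sqnormE z : (sqnorm z)%:C = \sum_i `|z i 0| ^+ 2.
Proof.
rewrite rmorph_sum; apply: eq_bigr => i _; apply/esym/ge0_ReE; exact: exprn_ge0.
Qed.

Lemma sqnorm_ge0 z : 0 <= sqnorm z.
Proof. by rewrite -ler0c sqnormE sumr_ge0// => i _; rewrite exprn_ge0. Qed.

Lemma gauss_sqnorm m s : 0 <= s ->
  (\int[P]_y (expR (- (s * sqnorm (colv m (X ^~ y)))))%:E = ((1 + s) ^- N)%:E)%E.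
Proof.
move=> s0.
pose B : 'M[R[i]]_N := diag_mx (\row_i s%:C).
have BE z : Re (qform B z) = s * sqnorm z.
  rewrite qform_diag /sqnorm mulr_sumr raddf_sum; apply: eq_bigr => i _ /=.
  by rewrite mxE Re_realM.
have pB : psdmx B.
  split; last by move=> z; rewrite qform_diag sumr_ge0// => i _; rewrite mxE mulr_ge0 ?ler0c// exprn_ge0.
  apply/matrixP => i j; rewrite adjmxE !mxE eq_sym; case: eqVneq => _; last by rewrite !mulr0n conjC0.
  by rewrite !mulr1n conj_Creal// ger0_real// ler0c.
under eq_integral do rewrite -BE.
rewrite (gauss_qform (column_indep iX m) (column_gauss gX m) pB); congr EFin.
have -> : 1%:M + B = ((1 + s)%:C)%:M.
  apply/matrixP => i j; rewrite !mxE; case: eqVneq => _; last by rewrite !mulr0n addr0.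
  by rewrite !mulr1n rmorphD.
by rewrite det_scalar -rmorphXn.
Qed.

(** With [s = kappa ^- i - 1] the Laplace transform [(1 + s) ^- N] is [kappa ^ (i N)], and the
    exponents add up to [N (1 - kappa ^ i) + N ln (kappa ^ i)]. *)
Lemma tilt_integral m i :
  (\int[P]_y (tilt N kappa i (N%:R^-1 * sqnorm (colv m (X ^~ y))))%:E =
   (expR (- (N%:R * rate (kappa ^+ i))))%:E)%E.
Proof.
have k0 : 0 < kappa ^+ i by rewrite exprn_gt0.
have s0 : 0 <= kappa ^- i - 1 by rewrite subr_ge0 invf_ge1// exprn_ile1// ltW.
have nN : N%:R != 0 :> R by rewrite pnatr_eq0 -lt0n.
have E y : (tilt N kappa i (N%:R^-1 * sqnorm (colv m (X ^~ y))))%:E =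
    ((expR (N%:R * (1 - kappa ^+ i)))%:E *
    (expR (- ((kappa ^- i - 1) * sqnorm (colv m (X ^~ y)))))%:E)%E.
  rewrite -EFinM -expRD /tilt mulrA mulfV// mul1r; congr (expR _)%:E.
  by field; rewrite gt_eqF.
under eq_integral do rewrite E.
have mE : measurable_fun setT (fun y => sqnorm (colv m (X ^~ y))).
  apply: measurable_sum => j.
  have h : mxmeas (fun y => colv m (X ^~ y)).
    by apply: mxmeas_colv => k; case: iX => mX _; exact: mX.
  have [+ _] := cmeasM (h j 0) (cmeasJ (h j 0)).
  by under eq_fun do rewrite -normCK.
rewrite ge0_integralZl//.
- rewrite gauss_sqnorm// -EFinM; congr EFin.
  rewrite /rate [1 + (_ - _)]addrC subrK exprVn invrK.
  rewrite -[X in _ * X ^+ N](@lnK _ (kappa ^+ i)) ?posrE// -expRM_natl -expRD; congr expR.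
  by ring.
- by apply/measurable_EFinP; do 2 apply: measurableT_comp => //; exact: measurable_funM.
Qed.

(** The auxiliary vector [z] is column [m0] of a second copy of the sample space, hence independent
    of the Gram matrix on [T * T]; Tonelli then allows the columns to be integrated first. *)
Lemma inv_det_gram_integral J :
  (\int[P]_t ((Re (\det (1%:M + gram phi (index_enum _) (X ^~ t))))^-1)%:E
   <= (grid_total N kappa phi J)%:E)%E.
Proof.
pose G t := gram phi (index_enum _) (X ^~ t).
pose z y := colv m0 (X ^~ y).
have mz : mxmeas (fun y => z y).
  by apply: mxmeas_colv => k; case: iX => mX _; exact: mX.
have pG t : psdmx (G t) by exact: psdmx_gram.
have -> : (\int[P]_t ((Re (\det (1%:M + gram phi (index_enum _) (X ^~ t))))^-1)%:E =
    \int[P]_x \int[P]_y (expR (- Re (qform (G x) (z y))))%:E)%E.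
  apply: eq_integral => x _.
  by rewrite (gauss_qform (column_indep iX m0) (column_gauss gX m0)).
rewrite (fubini_tonelli (fun xy => (expR (- Re (qform (G xy.1) (z xy.2))))%:E)); last 2 first.
- apply/measurable_EFinP; do 2 apply: measurableT_comp => //.
  suff /(_ 0 0)[] : mxmeas (fun xy : T * T => adjmx (z xy.2) *m G xy.1 *m z xy.2) by [].
  have mz2 : mxmeas (fun xy : T * T => z xy.2).
    apply: mxmeas_colv => k; case: iX => mX _; exact: measurableT_comp.
  apply: mxmeasM => //; apply: mxmeasM; first exact: mxmeasJ.
  apply: (mxmeas_gram (phi := fun=> phi)) => [m|i]; first exact: measurable_cst.
  by case: iX => mX _; exact: measurableT_comp.
- by move=> xy; rewrite lee_fin expR_ge0.
have msq : measurable_fun setT (fun y => sqnorm (z y)).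
  apply: measurable_sum => j.
  have [+ _] := cmeasM (mz j 0) (cmeasJ (mz j 0)).
  by under eq_fun do rewrite -normCK.
have E y : (\int[P]_x (expR (- Re (qform (G x) (z y))))%:E =
    (grid_prod N phi (N%:R^-1 * sqnorm (z y)))%:E)%E.
  (* Since [|v^H z| = |z^H v|], the roles of column and argument can be exchanged, and each factor
     becomes a rank-one Gaussian form in its own column. *)
  pose f m (v : idx -> R) := expR (- Re (qform ((phi m)%:C *: (z y *m adjmx (z y))) (colv m v))).
  transitivity (\int[P]_x (\prod_m f m (X ^~ x))%:E)%E.
    apply: eq_integral => x _; congr EFin; rewrite /f -expR_sum; congr expR.
    rewrite sumrN; congr (- _); rewrite -raddf_sum; congr Re.
    rewrite /G /gram; elim: (index_enum _) => [|m r IH].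
      by rewrite !big_nil /qform mulmx0 mul0mx mxE.
    rewrite !big_cons qformD IH; congr (_ + _).
    rewrite !qformZ !qform_rank1; congr (_ * _ ^+ 2).
    by rewrite -[in RHS]norm_conjC -adjmxE adjmxM adjmxK.
  rewrite (@indep_bigprod _ _ _ _ _ _ iX _ (fun m => in_col m) f (fun m => (1 + phi m * sqnorm (z y))^-1)).
  - congr EFin; apply: eq_bigr => m _; congr (_ ^-1); congr (1 + _).
    by field; rewrite pnatr_eq0 -lt0n.
  - by move=> m n [] [i j] mn /= /eqP ->.
  - move=> m; apply: (measurableT_comp (measurable_qform_exp _) (g := fun v : fam => (fun x => (v : idx -> R) (hcol m x)) : fam)).
    by apply: measurable_fam => i; exact: measurable_coord.
  - by move=> m v; exact: expR_ge0.
  - move=> m u v uv; rewrite /f (_ : colv m u = colv m v)//.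
    by apply/matrixP => i j; rewrite !mxE !uv// in_col_hcol.
  - move=> m; rewrite (gauss_qform (column_indep iX m) (column_gauss gX m)); last first.
      by apply: psdmxZ; [rewrite ler0c|exact: psdmx_rank1].
    by rewrite det1D_rank1 -sqnormE -rmorphM -(rmorph1 (real_complex R)) -rmorphD.
under eq_integral do rewrite E.
have mt i : measurable_fun setT (fun y => tilt N kappa i (N%:R^-1 * sqnorm (z y))).
  apply: (measurableT_comp (@measurable_expR R)); apply: measurable_funM => //; apply: measurable_funB => //.
  by apply: measurable_funM => //; exact: measurable_funM.
have t0 i y : 0 <= tilt N kappa i (N%:R^-1 * sqnorm (z y)) by exact: expR_ge0.
have g0 i : 0 <= grid_prod N phi (kappa ^+ i) by rewrite grid_prod_ge0// exprn_ge0// ltW.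
have mS : measurable_fun setT (fun y => \sum_(i < J) tilt N kappa i (N%:R^-1 * sqnorm (z y)) * grid_prod N phi (kappa ^+ i.+1)
  + tilt N kappa J (N%:R^-1 * sqnorm (z y))).
  by apply: measurable_funD => //; apply: measurable_sum => i; exact: measurable_funM.
apply: (@le_trans _ _ (\int[P]_y (\sum_(i < J) tilt N kappa i (N%:R^-1 * sqnorm (z y)) * grid_prod N phi (kappa ^+ i.+1)
  + tilt N kappa J (N%:R^-1 * sqnorm (z y)))%:E)%E).
  apply: ge0_le_integral => //.
  - by move=> y _; rewrite lee_fin grid_prod_ge0// mulr_ge0// sqnorm_ge0.
  - apply/measurable_EFinP; apply: measurable_prod => m _.
    apply: measurable_inv_gt0 => [|t].
      by apply: measurable_funD => //; apply: measurable_funM => //; exact: measurable_funM.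
    by rewrite ltr_pwDl// !mulr_ge0// sqnorm_ge0.
  - by apply/measurable_EFinP.
  - by move=> y _; rewrite lee_fin grid_bound// mulr_ge0// sqnorm_ge0.
under eq_integral do rewrite EFinD -sumEFin.
rewrite ge0_integralD//; last 4 first.
- by move=> y _; rewrite sume_ge0// => i _; rewrite lee_fin mulr_ge0.
- by apply: emeasurable_sum => i; apply/measurable_EFinP; exact: measurable_funM.
- by move=> y _; rewrite lee_fin.
- exact/measurable_EFinP.
rewrite tilt_integral EFinD leeD2r// ge0_integral_sum//; last 2 first.
- by move=> i; apply/measurable_EFinP; exact: measurable_funM.
- by move=> i y _; rewrite lee_fin mulr_ge0.
rewrite -sumEFin; apply: lee_sum => i _.
under eq_integral do rewrite EFinM.
rewrite ge0_integralZr ?lee_fin//; last 2 first.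
- exact/measurable_EFinP.
- by move=> y _; rewrite lee_fin.
by rewrite tilt_integral EFinM.
Qed.

End det_lower.

Lemma ln_le_subr1 {R : realType} (x : R) : 0 < x -> ln x <= x - 1.
Proof.
move=> x0; rewrite -{2}(@lnK _ x) ?posrE// lerBrDl.
exact: expR_ge1Dx.
Qed.

(** * Log-determinant with random powers *)

Section random_phi.
Context {R : realType} {N K : nat} (J : finType) d (T : measurableType d) (P : probability T R).
Local Notation idx := (('I_N * 'I_K) + ('I_N * 'I_K))%type.
Variable W : J + idx -> T -> R.
Hypotheses (iW : mutually_independent P W) (gW : std_cgauss P (fun i : idx => W (inr i))).
Variable phi : (J -> R) -> 'I_K -> R.
Hypothesis mphi : forall m, measurable_fun [set: fam] (fun v : fam => phi (v : J -> R) m).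
Hypothesis phi0 : forall v m, 0 <= phi v m.
Hypothesis N0 : (0 < N)%N.

Definition gram_det (f : 'I_K -> R) (v : idx -> R) : R :=
  Re (\det (1%:M + gram f (index_enum _) v)).

Lemma gram_det_ge1 f v : (forall m, 0 <= f m) -> 1 <= gram_det f v.
Proof.
move=> f0; rewrite -[1]/(Re (1 : R[i])); apply: le_Re.
by apply: det1D_psd_ge1; exact: psdmx_gram.
Qed.

Let phit t := phi (fun j => W (inl j) t).
Let Xt t : idx -> R := fun i => W (inr i) t.

Let iX : mutually_independent P (fun i : idx => W (inr i)).
Proof. by apply: indep_sub iW => i j []. Qed.

Lemma measurable_gram_det_fam : measurable_fun [set: fam]
  (fun v : fam => gram_det (phi (fun j => (v : J + idx -> R) (inl j))) (fun i => (v : J + idx -> R) (inr i))).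
Proof.
suff [] : cmeas (fun v : fam => \det (1%:M +
    gram (phi (fun j => (v : J + idx -> R) (inl j))) (index_enum _) (fun i => (v : J + idx -> R) (inr i)))) by [].
apply: cmeas_det; apply: mxmeasD; first exact: mxmeas_cst.
apply: mxmeas_gram => [m|i]; last exact: measurable_coord.
apply: (measurableT_comp (mphi m) (g := fun v : fam => (fun j => (v : J + idx -> R) (inl j)) : fam)).
by apply: measurable_fam => j; exact: measurable_coord.
Qed.

Lemma measurable_gram_det : measurable_fun setT (fun t => gram_det (phit t) (Xt t)).
Proof. exact: (measurableT_comp measurable_gram_det_fam (measurable_family iW)). Qed.

(** The powers depend only on the coordinates in [J], so the Gaussian ones can be resampled with the
    powers held fixed. The ratio is integrated because [U] of the random powers may have infinite
    mean. *)
Lemma decoupled_bound (F : R -> R) (U : ('I_K -> R) -> R) :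
  measurable_fun setT F -> (forall x, 0 <= F x) ->
  measurable_fun [set: fam] (fun v : fam => U (phi (v : J -> R))) ->
  (forall v, 0 < U (phi v)) ->
  (forall t, (\int[P]_y (F (gram_det (phit t) (Xt y)))%:E <= (U (phit t))%:E)%E) ->
  (\int[P]_t (F (gram_det (phit t) (Xt t)) / U (phit t))%:E <= 1)%E.
Proof.
move=> mF F0 mU U0 H.
pose g (v : J + idx -> R) := (F (gram_det (phi (fun j => v (inl j))) (fun i => v (inr i)))
   / U (phi (fun j => v (inl j))))%:E.
have mg : measurable_fun [set: fam] g.
  apply/measurable_EFinP; apply: measurable_funM.
    exact: measurableT_comp measurable_gram_det_fam.
  apply: measurable_inv_gt0 => [|v]; last exact: U0.
  apply: (measurableT_comp mU (g := fun v : fam => (fun j => (v : J + idx -> R) (inl j)) : fam)).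
  by apply: measurable_fam => j; exact: measurable_coord.
have g0 v : (0 <= g v)%E by rewrite lee_fin divr_ge0// ltW.
rewrite (@resample _ _ _ _ _ _ iW (fun i => if i is inl _ then true else false) g mg g0).
apply: (@le_trans _ _ (\int[P]_x 1)%E); last by rewrite (integral_prob_cst P 1).
apply: ge0_le_integral => //.
- by move=> x _; exact: integral_ge0.
- exact: (measurable_resample iW (fun i => if i is inl _ then true else false)).
move=> x _.
rewrite (_ : 1%E = ((U (phit x))^-1 * U (phit x))%:E); last by rewrite mulVf ?gt_eqF ?U0.
rewrite EFinM; under eq_integral do rewrite /g mulrC EFinM.
rewrite ge0_integralZl ?lee_fin ?invr_ge0 ?(ltW (U0 _))//.
- by apply: lee_wpmul2l; [rewrite lee_fin invr_ge0 ltW|exact: H].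
- apply/measurable_EFinP; apply: measurableT_comp => //.
  suff [] : cmeas (fun y => \det (1%:M + gram (phit x) (index_enum _) (Xt y))) by [].
  apply: cmeas_det; apply: mxmeasD; first exact: mxmeas_cst.
  apply: (mxmeas_gram (phi := fun=> phit x)) => [m|i]; first exact: measurable_cst.
  by case: iW => + _; apply.
- by move=> y _; rewrite lee_fin.
Qed.

Lemma measurable_ln_gram_det : measurable_fun setT (fun t => ln (gram_det (phit t) (Xt t))).
Proof. by apply: measurableT_comp => //; exact: measurable_gram_det. Qed.

Let D0 t : 0 < gram_det (phit t) (Xt t).
Proof. by apply: lt_le_trans (gram_det_ge1 _ _) => // m; exact: phi0. Qed.

Let lnD0 t : 0 <= ln (gram_det (phit t) (Xt t)).
Proof. by apply: ln_ge0; apply: gram_det_ge1 => m; exact: phi0. Qed.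

Definition det_bound (eta : R) (f : 'I_K -> R) : R :=
  pot_bound N eta * \prod_m (1 + N%:R * eta * f m).

Lemma pot_bound_ge1 (eta : R) : 0 < eta -> 1 <= pot_bound N eta.
Proof.
move=> e0; have := pot_weight_bound N0 e0 (leqnn N).
by rewrite /pot_weight subnn expr0 mul1r divff ?mulr1// pnatr_eq0 -lt0n fact_gt0.
Qed.

Lemma det_bound_ge1 (eta : R) (f : 'I_K -> R) : 0 < eta -> (forall m, 0 <= f m) -> 1 <= det_bound eta f.
Proof.
move=> e0 f0; rewrite -[1]mulr1 ler_pM ?pot_bound_ge1//.
elim/big_ind: _ => // [x y x1 y1|i _]; first by rewrite -[1]mulr1 ler_pM.
by rewrite lerDl !mulr_ge0// ltW.
Qed.

Lemma ln_det_upper (eta : R) : 0 < eta ->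
  (\int[P]_t (ln (gram_det (phit t) (Xt t)))%:E <= \int[P]_t (ln (det_bound eta (phit t)))%:E)%E.
Proof.
move=> e0.
have U1 v : 1 <= det_bound eta (phi v) by apply: det_bound_ge1.
have U0 v : 0 < det_bound eta (phi v) by exact: lt_le_trans (U1 v).
have mU : measurable_fun [set: fam] (fun v : fam => det_bound eta (phi (v : J -> R))).
  apply: measurable_funM => //; apply: measurable_prod => m _.
  by apply: measurable_funD => //; exact: measurable_funM.
have mUt : measurable_fun setT (fun t => det_bound eta (phit t)).
  apply: (measurableT_comp mU (g := fun t => (fun j => W (inl j) t) : fam)).
  by apply: measurable_fam => j; case: iW => + _; apply.
have mlnU : measurable_fun setT (fun t => ln (det_bound eta (phit t))) by exact: measurableT_comp.
have mDU : measurable_fun setT (fun t => gram_det (phit t) (Xt t) / det_bound eta (phit t)).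
  by apply: measurable_funM; [exact: measurable_gram_det|apply: measurable_inv_gt0 => // t; exact: U0].
have H : (\int[P]_t (gram_det (phit t) (Xt t) / det_bound eta (phit t))%:E <= 1)%E.
  (* The identity is replaced by a function nonnegative on all of [R]; nothing changes on
     determinants, which are at least 1. *)
  pose F (x : R) := Num.max 0 x.
  have FD t y : F (gram_det (phit t) (Xt y)) = gram_det (phit t) (Xt y).
    by apply/max_idPr; apply: (le_trans ler01); apply: gram_det_ge1 => m; exact: phi0.
  under eq_integral => t _ do rewrite -FD.
  apply: decoupled_bound => //.
  - exact: measurable_maxr.
  - by move=> x; rewrite le_max lexx.
  - move=> t; under eq_integral => y _ do rewrite FD.
    exact: (det_gram_integral iX gW N0 e0 (phi0 _)).
(* The constant of [ln D <= ln U + D / U - 1] is moved to the left, so that all integrands are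
   nonnegative. *)
rewrite -(@leeD2rE _ 1%E)//.
apply: (@le_trans _ _ (\int[P]_t ((ln (det_bound eta (phit t)))%:E +
    (gram_det (phit t) (Xt t) / det_bound eta (phit t))%:E))%E).
  rewrite -{1}(integral_prob_cst P 1) -ge0_integralD//.
  - apply: ge0_le_integral => //.
    + by move=> t _; rewrite adde_ge0// lee_fin.
    + by apply: emeasurable_funD => //; apply/measurable_EFinP; exact: measurable_ln_gram_det.
    + by apply: emeasurable_funD => //; exact/measurable_EFinP.
    + move=> t _; rewrite -!EFinD lee_fin.
      have := ln_le_subr1 (divr_gt0 (D0 t) (U0 (fun j => W (inl j) t))).
      rewrite ln_div ?posrE ?U0//.
      by rewrite -/(phit t); move: (ln _) (ln (det_bound _ _)) (_ / _) => x y z; lra.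
  - by move=> t _; rewrite lee_fin.
  - by apply/measurable_EFinP; exact: measurable_ln_gram_det.
rewrite ge0_integralD//.
- by rewrite leeD2l.
- by move=> t _; rewrite lee_fin; exact/ln_ge0/U1.
- exact/measurable_EFinP.
- by move=> t _; rewrite lee_fin ltW// divr_gt0//; exact: U0.
- exact/measurable_EFinP.
Qed.

(** As [- ln (grid_total ...)] may change sign and is random through the powers, it enters only by a
    constant [c] and a nonnegative error [h]. For [c <= 0] the claim is immediate; for [c > 0] all
    integrals are of nonnegative functions. *)
Lemma ln_det_lower (kappa : R) (n : nat) (h : T -> R) (c : R) (m0 : 'I_K) :
  0 < kappa -> kappa < 1 -> measurable_fun setT h -> (forall t, 0 <= h t) ->
  (forall t, c <= - ln (grid_total N kappa (phit t) n) + h t) ->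
  (c%:E <= \int[P]_t (ln (gram_det (phit t) (Xt t)))%:E + \int[P]_t (h t)%:E)%E.
Proof.
move=> k0 k1 mh h0 Hc.
have [c0|c0] := leP c 0.
  by apply: (@le_trans _ _ 0%E); [rewrite lee_fin|rewrite adde_ge0// integral_ge0// => t _; rewrite lee_fin].
have V0 v : 0 < grid_total N kappa (phi v) n.
  rewrite ltr_wpDl ?expR_gt0//; apply: sumr_ge0 => i _.
  by rewrite mulr_ge0 ?expR_ge0// grid_prod_ge0// exprn_ge0// ltW.
have mV : measurable_fun [set: fam] (fun v : fam => grid_total N kappa (phi (v : J -> R)) n).
  apply: measurable_funD => //; apply: measurable_sum => i; apply: measurable_funM => //.
  apply: measurable_prod => m _; apply: measurable_inv_gt0 => [|v].
    by apply: measurable_funD => //; apply: measurable_funM => //; exact: measurable_funM.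
  by rewrite ltr_pwDl// !mulr_ge0// exprn_ge0// ltW.
have mVt : measurable_fun setT (fun t => grid_total N kappa (phit t) n).
  apply: (measurableT_comp mV (g := fun t => (fun j => W (inl j) t) : fam)).
  by apply: measurable_fam => j; case: iW => + _; apply.
pose G t := (gram_det (phit t) (Xt t))^-1 / grid_total N kappa (phit t) n.
have mG : measurable_fun setT G.
  apply: measurable_funM; apply: measurable_inv_gt0 => //; last by move=> t; exact: V0.
  exact: measurable_gram_det.
have G0 t : 0 < G t by rewrite divr_gt0 ?invr_gt0 ?D0//; exact: V0.
have H : (\int[P]_t (G t)%:E <= 1)%E.
  pose F (x : R) := (Num.max 1 x)^-1.
  have FD t y : F (gram_det (phit t) (Xt y)) = (gram_det (phit t) (Xt y))^-1.
    by congr (_^-1); apply/max_idPr; apply: gram_det_ge1 => m; exact: phi0.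
  rewrite /G; under eq_integral => t _ do rewrite -FD.
  apply: (decoupled_bound (F := F) (U := fun f => grid_total N kappa f n)) => //.
  - apply: measurable_inv_gt0 => [|x]; first exact: measurable_maxr.
    by rewrite lt_max ltr01.
  - by move=> x; rewrite invr_ge0 le_max ler01.
  - move=> t; under eq_integral => y _ do rewrite FD.
    exact: (inv_det_gram_integral iX gW k0 k1 (phi0 _) m0 N0).
have mlnD : measurable_fun setT (fun t => (ln (gram_det (phit t) (Xt t)))%:E).
  by apply/measurable_EFinP; exact: measurable_ln_gram_det.
rewrite -(@leeD2rE _ 1%E)//.
apply: (@le_trans _ _ (\int[P]_t ((ln (gram_det (phit t) (Xt t)))%:E + (h t)%:E + (G t)%:E))%E).
  rewrite -EFinD -(integral_prob_cst P).
  apply: ge0_le_integral => //.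
  - by move=> t _; rewrite lee_fin addr_ge0// ltW.
  - by apply: emeasurable_funD; [apply: emeasurable_funD => //|]; exact/measurable_EFinP.
  - move=> t _; rewrite -!EFinD lee_fin.
    have V0t : 0 < grid_total N kappa (phit t) n by exact: V0.
    have := ln_le_subr1 (G0 t); rewrite {1}/G ln_div ?posrE ?invr_gt0// lnV ?posrE//.
    have := Hc t; move: (ln (grid_total _ _ _ _)) (ln (gram_det _ _)) (G t) (h t) => a b e f'.
    by lra.
rewrite ge0_integralD//; last 4 first.
- by move=> t _; rewrite adde_ge0// lee_fin.
- by apply: emeasurable_funD => //; exact/measurable_EFinP.
- by move=> t _; rewrite lee_fin ltW.
- exact/measurable_EFinP.
rewrite ge0_integralD//; first by rewrite leeD2l.
- by move=> t _; rewrite lee_fin.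
- by move=> t _; rewrite lee_fin.
- exact/measurable_EFinP.
Qed.

End random_phi.

(** * Independence across users *)

Section users.
Context {R : realType} {L K : nat}.
Context d (T : measurableType d) (P : probability T R).
Context d' (T0 : measurableType d') (P0 : probability T0 R).
Variables (D : 'I_L * 'I_L * 'I_K -> T -> R) (D0 : 'I_L * 'I_L -> T0 -> R).
Hypotheses (iD : mutually_independent P D) (iD0 : mutually_independent P0 D0).
Hypothesis lawD : forall kl m (B : set R), measurable B ->
  P (D (kl, m) @^-1` B) = P0 (D0 kl @^-1` B).
Variable k : 'I_L.

Definition user (m : 'I_K) (t : T) : 'I_L -> R := fun l => D (k, l, m) t.
Definition user0 (t : T0) : 'I_L -> R := fun l => D0 (k, l) t.

Let iuser m : mutually_independent P (fun l => D (k, l, m)).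
Proof. by apply: indep_sub iD => l l' [->]. Qed.

Let iuser0 : mutually_independent P0 (fun l => D0 (k, l)).
Proof. by apply: indep_sub iD0 => l l' [->]. Qed.

Lemma measurable_user m : measurable_fun setT (fun t => user m t : fam).
Proof. exact: (measurable_family (iuser m)). Qed.

Lemma measurable_user0 : measurable_fun setT (fun t => user0 t : fam).
Proof. exact: (measurable_family iuser0). Qed.

Lemma user_law m (h : ('I_L -> R) -> \bar R) :
  measurable_fun [set: fam] h -> (forall v, 0 <= h v)%E ->
  (\int[P]_t h (user m t) = \int[P0]_t h (user0 t))%E.
Proof.
move=> mh h0.
apply: (eq_law_integral (measurable_user m) measurable_user0) => // B mB.
rewrite -!prob_EFin; last 2 first.
- exact: (measurable_box_preimage iuser0 mB).
- exact: (measurable_box_preimage (iuser m) mB).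
congr EFin; have := prob_box (iuser m) mB; rewrite /user => ->.
have := prob_box iuser0 mB; rewrite /user0 => ->.
by apply: eq_bigr => l _; rewrite /prob lawD.
Qed.

Lemma user_pair m m' (h h' : ('I_L -> R) -> R) : m != m' ->
  measurable_fun [set: fam] h -> (forall v, 0 <= h v) ->
  measurable_fun [set: fam] h' -> (forall v, 0 <= h' v) ->
  (\int[P]_t (h (user m t) * h' (user m' t))%:E =
   \int[P0]_t (h (user0 t))%:E * \int[P0]_t (h' (user0 t))%:E)%E.
Proof.
move=> mm mh h0 mh' h'0.
have mp j (g : ('I_L -> R) -> R) : measurable_fun [set: fam] g ->
    measurable_fun [set: fam] (fun v : fam => g (fun l => (v : 'I_L * 'I_L * 'I_K -> R) (k, l, j))).
  move=> mg; apply: (measurableT_comp mg (g := fun v : fam => (fun l => (v : 'I_L * 'I_L * 'I_K -> R) (k, l, j)) : fam)).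
  by apply: measurable_fam => l; exact: measurable_coord.
rewrite (@indep_product _ _ _ _ _ _ iD (fun x => x.2 == m)
  (fun v => h (fun l => v (k, l, m))) (fun v => h' (fun l => v (k, l, m')))).
- congr (_ * _)%E.
    by apply: (user_law m (h := fun v => (h v)%:E)); [exact/measurable_EFinP|move=> v; rewrite lee_fin].
  by apply: (user_law m' (h := fun v => (h' v)%:E)); [exact/measurable_EFinP|move=> v; rewrite lee_fin].
- exact: mp.
- exact: mp.
- by move=> v.
- by move=> v.
- by move=> u v uv; congr h; apply/funext => l; exact: uv.
- by move=> u v uv; congr h'; apply/funext => l; apply: uv; rewrite /= eq_sym.
Qed.

(** In the expanded second moment the diagonal terms are at most [C ^ 2] and the others equal
    [e ^ 2] by independence. *)
Lemma user_variance (h : ('I_L -> R) -> R) (C e : R) :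
  measurable_fun [set: fam] h -> (forall v, 0 <= h v <= C) ->
  (\int[P0]_t (h (user0 t))%:E = e%:E)%E ->
  (\int[P]_t ((\sum_m h (user m t) - K%:R * e) ^+ 2)%:E <= (K%:R * C ^+ 2)%:E)%E.
Proof.
move=> mh hC he.
have h0 v : 0 <= h v by case/andP: (hC v).
have hle v : h v <= C by case/andP: (hC v).
have e0 : 0 <= e by rewrite -lee_fin -he integral_ge0// => t _; rewrite lee_fin.
have mhm m : measurable_fun setT (fun t => h (user m t)) by exact: (measurableT_comp mh (measurable_user m)).
have Eh m : (\int[P]_t (h (user m t))%:E = e%:E)%E.
  by rewrite -he; apply: (user_law m (h := fun v => (h v)%:E)); [exact/measurable_EFinP|move=> v; rewrite lee_fin].
have ES : (\int[P]_t (\sum_m h (user m t))%:E = (K%:R * e)%:E)%E.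
  under eq_integral do rewrite -sumEFin.
  rewrite ge0_integral_sum//; last 2 first.
  - by move=> m; exact/measurable_EFinP.
  - by move=> m t _; rewrite lee_fin.
  under eq_bigr do rewrite Eh.
  by rewrite sumEFin sumr_const card_ord mulr_natl.
have mS : measurable_fun setT (fun t => \sum_m h (user m t)) by apply: measurable_sum.
have S0 t : 0 <= \sum_m h (user m t) by exact: sumr_ge0.
have ESS : (\int[P]_t ((\sum_m h (user m t)) ^+ 2)%:E <= (K%:R * C ^+ 2 + K%:R ^+ 2 * e ^+ 2)%:E)%E.
  under eq_integral do rewrite expr2 mulr_suml -sumEFin.
  rewrite ge0_integral_sum//; last 2 first.
  - by move=> m; apply/measurable_EFinP; exact: measurable_funM.
  - by move=> m t _; rewrite lee_fin mulr_ge0.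
  apply: (@le_trans _ _ (\sum_(m < K) (C ^+ 2 + K%:R * e ^+ 2)%:E)%E); last first.
    rewrite sumEFin sumr_const card_ord lee_fin le_eqVlt; apply/orP; left; apply/eqP.
    by rewrite -[LHS]mulr_natl; ring.
  apply: lee_sum => m _.
  under eq_integral do rewrite mulr_sumr -sumEFin.
  rewrite ge0_integral_sum//; last 2 first.
  - by move=> m'; apply/measurable_EFinP; exact: measurable_funM.
  - by move=> m' t _; rewrite lee_fin mulr_ge0.
  rewrite (bigD1 m)//= EFinD; apply: leeD.
    apply: (@le_trans _ _ (\int[P]_t (C ^+ 2)%:E)%E); last by rewrite integral_prob_cst.
    apply: ge0_le_integral => //.
    + by move=> t _; rewrite lee_fin mulr_ge0.
    + by apply/measurable_EFinP; exact: measurable_funM.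
    + by move=> t _; rewrite lee_fin expr2 ler_pM.
  apply: (@le_trans _ _ (\sum_(m' < K) (e ^+ 2)%:E)%E); last first.
    by rewrite sumEFin sumr_const card_ord mulr_natl.
  rewrite [leRHS](bigD1 m)//=; apply: (@le_trans _ _ (\sum_(i < K | i != m) (e ^+ 2)%:E)%E); last first.
    by rewrite leeDr// lee_fin sqr_ge0.
  apply: lee_sum => m' mm'; rewrite (@user_pair m m' h h) 1?eq_sym//.
  by rewrite he -EFinM expr2.
(* Adding the mean of [2 K e S], with [S] the sum, turns [(S - K e) ^ 2] into [S ^ 2 + (K e) ^ 2]
   under the integral. *)
rewrite -(@leeD2rE _ (2 * (K%:R * e) ^+ 2)%:E)//.
have -> : (2 * (K%:R * e) ^+ 2)%:E = (\int[P]_t ((2 * (K%:R * e))%:E * (\sum_m h (user m t))%:E))%E.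
  rewrite ge0_integralZl//.
  - by rewrite ES -EFinM; congr EFin; ring.
  - exact/measurable_EFinP.
  - by move=> t _; rewrite lee_fin.
  - by rewrite lee_fin !mulr_ge0.
rewrite -ge0_integralD//; last 4 first.
- by move=> t _; rewrite lee_fin sqr_ge0.
- by apply/measurable_EFinP; apply: measurable_funX; exact: measurable_funB.
- by move=> t _; rewrite -EFinM lee_fin !mulr_ge0.
- by apply: emeasurable_funM => //; exact/measurable_EFinP.
have -> : (\int[P]_x (((\sum_m h (user m x) - K%:R * e) ^+ 2)%:E + (2 * (K%:R * e))%:E * (\sum_m h (user m x))%:E)
   = \int[P]_x (((\sum_m h (user m x)) ^+ 2)%:E + ((K%:R * e) ^+ 2)%:E))%E.
  by apply: eq_integral => t _; rewrite -EFinM -!EFinD; congr EFin; ring.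
rewrite ge0_integralD//; last 3 first.
- by move=> t _; rewrite lee_fin sqr_ge0.
- by apply/measurable_EFinP; exact: measurable_funX.
- by move=> t _; rewrite lee_fin sqr_ge0.
rewrite integral_prob_cst.
apply: le_trans (leeD2r _ ESS) _.
rewrite ge0_integralZl//.
- by rewrite ES -EFinM -!EFinD lee_fin le_eqVlt; apply/orP; left; apply/eqP; ring.
- exact/measurable_EFinP.
- by move=> t _; rewrite lee_fin.
- by rewrite lee_fin !mulr_ge0.
Qed.

End users.

Lemma integral_gt0 {R : realType} d (T : measurableType d) (P : probability T R) (f : T -> R) :
  measurable_fun setT f -> (forall t, 0 < f t) -> (0 < \int[P]_t (f t)%:E)%E.
Proof.
move=> mf f0; rewrite lt0e integral_ge0 ?andbT; last by move=> t _; rewrite lee_fin ltW.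
apply/eqP => If0.
have mF : measurable_fun setT (EFin \o f) by exact/measurable_EFinP.
have /(ae_eq_integral_abs P measurableT mF) : (\int[P]_t `|(EFin \o f) t| = 0)%E.
  by rewrite -[RHS]If0; apply: eq_integral => t _; rewrite /= ger0_norm// ltW.
move=> [A [mA PA AT]].
have : A = setT.
  apply/seteqP; split => // t _; apply: AT => /= /(_ Logic.I) /eqP.
  by rewrite eqe gt_eqF.
move=> AE; move: PA; rewrite AE => PA; have := probability_setT P; rewrite [X in X = _]PA => /eqP.
by rewrite eq_sym onee_eq0.
Qed.

(** * Signal and interference of one user *)

Section channel.
Context {R : realType} {L : nat}.
Variables (tau sigma : R) (k : 'I_L).
Hypotheses (tau0 : 0 < tau) (sigma0 : 0 < sigma).
Implicit Types x : 'I_L -> R.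

Definition bgain x l : R := tau * x l ^+ 2 / (sigma + tau * \sum_(l' < L) x l' ^+ 2).
Definition alpha x : R := bgain x k * (x k ^+ 2)^-1 * \sum_(l < L) x l ^+ 4.
Definition resid x : R := \sum_(l < L) (1 - bgain x l) * x l ^+ 2.

Let den0 x : 0 < sigma + tau * \sum_(l' < L) x l' ^+ 2.
Proof. by rewrite ltr_pwDl// mulr_ge0 ?(ltW tau0)// sumr_ge0// => l _; rewrite sqr_ge0. Qed.

Lemma bgain_ge0 x l : 0 <= bgain x l.
Proof. by apply: divr_ge0; [rewrite mulr_ge0 ?sqr_ge0 ?(ltW tau0)|exact: ltW (den0 x)]. Qed.

Lemma bgain_lt1 x l : bgain x l < 1.
Proof.
rewrite ltr_pdivrMr ?den0// mul1r (bigD1 l)//= mulrDr addrA ltr_wpDr//.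
  by rewrite mulr_ge0 ?(ltW tau0)// sumr_ge0// => i _; rewrite sqr_ge0.
by rewrite ltrDr.
Qed.

Lemma resid_ge0 x : 0 <= resid x.
Proof.
by apply: sumr_ge0 => l _; rewrite mulr_ge0 ?sqr_ge0// subr_ge0 ltW ?bgain_lt1.
Qed.

Lemma alpha_ge0 x : 0 <= alpha x.
Proof.
apply: mulr_ge0; first by rewrite mulr_ge0 ?bgain_ge0 ?invr_ge0 ?sqr_ge0.
apply: sumr_ge0 => l _.
by rewrite (_ : 4 = 2 * 2)%N// exprM sqr_ge0.
Qed.

Lemma alpha_gt0 x : (forall l, 0 < x l) -> 0 < alpha x.
Proof.
move=> x0; apply: mulr_gt0.
  apply: mulr_gt0; last by rewrite invr_gt0 exprn_gt0.
  by apply: divr_gt0; [rewrite mulr_gt0// exprn_gt0|exact: den0].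
rewrite (bigD1 k)//= ltr_pwDl ?exprn_gt0// sumr_ge0// => l _.
by rewrite exprn_ge0// ltW.
Qed.

(** Form without division by [x k], used for measurability on the whole space [fam]; as [0^-1 = 0],
    [alpha] vanishes where [x k = 0]. *)
Lemma alphaE x : alpha x = (x k != 0)%:R * (tau / (sigma + tau * \sum_(l' < L) x l' ^+ 2) * \sum_(l < L) x l ^+ 4).
Proof.
rewrite /alpha /bgain; have [->|xk] := eqVneq (x k) 0.
  by rewrite expr0n/= mulr0 !mul0r.
rewrite mul1r; congr (_ * _); move: (den0 x).
move: (_ + tau * _) => e e0; field.
by rewrite xk gt_eqF.
Qed.

Lemma measurable_bgain l : measurable_fun [set: fam] (fun x : fam => bgain (x : 'I_L -> R) l).
Proof.
have mc (i : 'I_L) : measurable_fun [set: fam] (fun x : fam => (x : 'I_L -> R) i) by exact: measurable_coord.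
apply: measurable_funM; first by apply: measurable_funM => //; exact: measurable_funX.
apply: measurable_inv_gt0 => [|x]; last exact: den0.
apply: measurable_funD => //; apply: measurable_funM => //.
by apply: measurable_sum => i; exact: measurable_funX.
Qed.

Lemma measurable_resid : measurable_fun [set: fam] (fun x : fam => resid (x : 'I_L -> R)).
Proof.
apply: measurable_sum => l; apply: measurable_funM.
  by apply: measurable_funB => //; exact: measurable_bgain.
by apply: measurable_funX; exact: measurable_coord.
Qed.

Lemma measurable_alpha : measurable_fun [set: fam] (fun x : fam => alpha (x : 'I_L -> R)).
Proof.
have mc (i : 'I_L) : measurable_fun [set: fam] (fun x : fam => (x : 'I_L -> R) i) by exact: measurable_coord.
rewrite (_ : (fun x => _) = (fun x : fam => ((x : 'I_L -> R) k != 0)%:R *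
    (tau / (sigma + tau * \sum_(l' < L) (x : 'I_L -> R) l' ^+ 2) * \sum_(l < L) (x : 'I_L -> R) l ^+ 4))); last first.
  by apply/funext => x; rewrite alphaE.
apply: measurable_funM.
  rewrite (_ : (fun x => _) = (fun x : fam => if (x : 'I_L -> R) k == 0 then 0 else 1)); last first.
    by apply/funext => x; case: eqP.
  apply: measurable_fun_ifT => //.
  by apply: measurable_fun_eqr => //; exact: mc.
apply: measurable_funM; last by apply: measurable_sum => i; exact: measurable_funX.
apply: measurable_funM => //; apply: measurable_inv_gt0 => [|x]; last exact: den0.
apply: measurable_funD => //; apply: measurable_funM => //.
by apply: measurable_sum => i; exact: measurable_funX.
Qed.

End channel.

(** * Logarithmic inequalities *)

Section log_parts.
Context {R : realType}.
Implicit Types x y : R.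

(** For [x > 0], [lnp x] and [lnp x^-1] are the positive and negative parts of [ln x]. *)
Definition lnp x : R := Num.max 0 (ln x).

Lemma lnp_ge0 x : 0 <= lnp x. Proof. by rewrite le_max lexx. Qed.

Lemma ln_le_lnp x : ln x <= lnp x. Proof. by rewrite le_max lexx orbT. Qed.

Lemma lnp_eq0 x : x <= 1 -> lnp x = 0.
Proof. by move=> x1; apply/max_idPl; exact: ln_le0. Qed.

Lemma lnp_ln x : 1 <= x -> lnp x = ln x.
Proof. by move=> x1; apply/max_idPr; exact: ln_ge0. Qed.

Lemma lnp_le x y : 0 < x -> x <= y -> lnp x <= lnp y.
Proof.
move=> x0 xy; rewrite /lnp ge_max le_max lexx/= le_max.
by apply/orP; right; rewrite ler_ln// ?posrE// (lt_le_trans x0).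
Qed.

Lemma measurable_lnp d (T : measurableType d) (f : T -> R) :
  measurable_fun setT f -> measurable_fun setT (fun t => lnp (f t)).
Proof. by move=> mf; apply: measurable_maxr => //; exact: measurableT_comp. Qed.

(** This is [ln x <= x - 1] without subtraction; it reduces the positive part of [ln rho] to the
    mean of [rho] and the negative part. *)
Lemma lnp_add1_le x : 0 < x -> lnp x + 1 <= x + lnp x^-1.
Proof.
move=> x0; have [x1|/ltW x1] := leP x 1.
  rewrite lnp_eq0// lnp_ln ?invf_ge1// lnV ?posrE// add0r.
  by have := ln_le_subr1 x0; lra.
rewrite (lnp_ln x1) (@lnp_eq0 x^-1) ?invf_le1// addr0.
by have := ln_le_subr1 x0; lra.
Qed.

(** Because [1 + a / rho <= (1 + a) / min(rho, 1)]. *)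
Lemma ln1D_div_le a rho : 0 <= a -> 0 < rho -> ln (1 + a / rho) <= ln (1 + a) + lnp rho^-1.
Proof.
move=> a0 r0; have ir0 : 0 < rho^-1 by rewrite invr_gt0.
have [r1|/ltW r1] := leP rho 1.
  rewrite lnp_ln ?invf_ge1// -lnM ?posrE// ?ltr_pwDl//.
  rewrite ler_ln ?posrE ?mulr_gt0 ?ltr_pwDl ?divr_ge0 ?(ltW r0)//.
  by rewrite mulrDl mul1r lerD2r invf_ge1.
rewrite lnp_eq0 ?invf_le1// addr0 ler_ln ?posrE ?ltr_pwDl ?divr_ge0 ?(ltW r0)//.
by rewrite lerD2l ler_piMr// invf_le1.
Qed.

Lemma ln1D_le_div a rho : 0 <= a -> 0 < rho -> ln (1 + a) <= ln (1 + a / rho) + lnp rho.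
Proof.
move=> a0 r0; have ir0 : 0 < rho^-1 by rewrite invr_gt0.
have := @ln1D_div_le (a / rho) rho^-1 _ ir0; rewrite invrK divfK ?gt_eqF//.
by apply; rewrite divr_ge0// ltW.
Qed.

End log_parts.

(** A crude Stirling bound: a factor polynomial in [n] is lost, which disappears after taking
    logarithms and dividing by [N]. The induction step amounts to
    [(n + 2) ln ((n + 2) / (n + 1)) >= 1]. *)
Lemma fact_le_stirling {R : realType} n : (0 < n)%N ->
  n`!%:R <= n%:R ^+ n.+1 * expR (1 - n%:R) :> R.
Proof.
case: n => // n _; elim: n => [|n IH]; first by rewrite subrr expR0 expr1n mulr1.
have n1 : 0 < n.+1%:R :> R by rewrite ltr0n.
have n2 : 0 < n.+2%:R :> R by rewrite ltr0n.
rewrite factS natrM exprS -mulrA ler_wpM2l ?ler0n//.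
apply: (le_trans IH).
have -> : expR (1 - n.+1%:R) = expR 1 * expR (1 - n.+2%:R) :> R.
  by rewrite -expRD; congr expR; rewrite -[n.+2%:R]natr1; ring.
rewrite mulrA ler_wpM2r ?expR_ge0// -ler_pdivlMl ?exprn_gt0// -exprVn -exprMn.
rewrite -[X in _ <= X](@lnK _ _) ?posrE ?exprn_gt0 ?mulr_gt0 ?invr_gt0// ler_expR.
rewrite lnXn ?mulr_gt0 ?invr_gt0// -[leRHS]mulr_natl.
have p0 : 0 < n.+1%:R^-1 * n.+2%:R :> R by rewrite mulr_gt0 ?invr_gt0.
have p1 : 0 < (n.+1%:R^-1 * n.+2%:R)^-1 :> R by rewrite invr_gt0.
have H := ln_le_subr1 p1; rewrite lnV ?posrE// in H.
rewrite -ler_pdivrMl// mulr1.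
have E : (n.+1%:R^-1 * n.+2%:R)^-1 - 1 = - n.+2%:R^-1 :> R.
  by rewrite invfM invrK -[n.+1%:R](addrK 1) natr1 mulrBl divff ?gt_eqF// mul1r; ring.
by move: H; rewrite E lerN2.
Qed.

Lemma ln_pot_bound {R : realType} N (eta : R) : (0 < N)%N -> 0 < eta ->
  ln (pot_bound N eta) <= 1 + ln N%:R + N%:R * rate eta.
Proof.
move=> N0 e0; have n0 : 0 < N%:R :> R by rewrite ltr0n.
have f0 : 0 < N`!%:R :> R by rewrite ltr0n fact_gt0.
have x0 : 0 < N%:R * eta by rewrite mulr_gt0.
rewrite /pot_bound lnM ?posrE ?divr_gt0 ?exprn_gt0 ?expR_gt0// expRK.
rewrite ln_div ?posrE ?exprn_gt0// lnXn// lnM ?posrE// -[(_ + _) *+ N]mulr_natl.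
have : ln N`!%:R <= N.+1%:R * ln N%:R + (1 - N%:R) :> R.
  have := @fact_le_stirling R N N0; rewrite -(@ler_ln R) ?posrE ?mulr_gt0 ?exprn_gt0 ?expR_gt0//.
  by rewrite lnM ?posrE ?exprn_gt0 ?expR_gt0// expRK lnXn// mulr_natl.
rewrite /rate -natr1; move: (ln _) (ln N%:R) (ln eta) => x y z; lra.
Qed.

(** * Estimates at a fixed number of antennas *)

Section finite_n.
Context {R : realType} {L N K : nat} d (T : measurableType d) (P : probability T R).
Context d' (T0 : measurableType d') (P0 : probability T0 R).
Local Notation J := ('I_L * 'I_L * 'I_K)%type.
Local Notation idx := (('I_N * 'I_K) + ('I_N * 'I_K))%type.
Variables (W : J + idx -> T -> R) (D0 : 'I_L * 'I_L -> T0 -> R).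
Hypotheses (iW : mutually_independent P W) (gW : std_cgauss P (fun i : idx => W (inr i))).
Hypothesis iD0 : mutually_independent P0 D0.
Hypothesis lawD : forall kl m (B : set R), measurable B ->
  P (W (inl (kl, m)) @^-1` B) = P0 (D0 kl @^-1` B).
Variables (tau sigma beta c : R) (k : 'I_L).
Hypotheses (tau0 : 0 < tau) (sigma0 : 0 < sigma) (beta0 : 0 < beta) (c0 : 0 < c).
Hypotheses (N0 : (0 < N)%N) (KN : K%:R = beta * N%:R).
Hypothesis resid_mean : (\int[P0]_t (resid tau sigma (user0 D0 k t))%:E = c%:E)%E.

Let iD : mutually_independent P (fun j => W (inl j)).
Proof. by apply: indep_sub iW => j j' []. Qed.

Let K0 : 0 < K%:R :> R. Proof. by rewrite KN mulr_gt0// ltr0n. Qed.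

Let us (m : 'I_K) (t : T) : 'I_L -> R := user (fun j => W (inl j)) k m t.
Let us0 := user0 D0 k.

Definition power (v : J -> R) (m : 'I_K) : R :=
  alpha tau sigma k (fun l => v (k, l, m)) /
  (\sum_(j < K) resid tau sigma (fun l => v (k, l, j)) + sigma).

Definition relpow (t : T0) : R := alpha tau sigma k (us0 t) / (beta * c).

(** Chosen so that, by [K = beta N], [N] times the power of a user is its relative power divided by
    [rho], see [power_rho]. *)
Definition rho (t : T) : R := (\sum_(j < K) resid tau sigma (us j t) + sigma) / (K%:R * c).

Definition lndet (t : T) : R :=
  ln (gram_det (power (fun j => W (inl j) t)) (fun i => W (inr i) t)).

Let total0 (v : J -> R) : 0 < \sum_(j < K) resid tau sigma (fun l => v (k, l, j)) + sigma.
Proof. by rewrite ltr_wpDl// sumr_ge0// => j _; exact: resid_ge0. Qed.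

Lemma power_ge0 v m : 0 <= power v m.
Proof. by apply: divr_ge0; [exact: alpha_ge0|exact: ltW (total0 v)]. Qed.

Let mJ (h : ('I_L -> R) -> R) (m : 'I_K) : measurable_fun [set: fam] h ->
  measurable_fun [set: fam] (fun v : fam => h (fun l => (v : J -> R) (k, l, m))).
Proof.
move=> mh; apply: (measurableT_comp mh (g := fun v : fam => (fun l => (v : J -> R) (k, l, m)) : fam)).
by apply: measurable_fam => l; exact: measurable_coord.
Qed.

Lemma measurable_power m : measurable_fun [set: fam] (fun v : fam => power (v : J -> R) m).
Proof.
apply: measurable_funM; first by exact: (mJ (h := alpha tau sigma k) m (measurable_alpha _ tau0 sigma0)).
apply: measurable_inv_gt0 => [|v]; last exact: total0.
by apply: measurable_funD => //; apply: measurable_sum => j; exact: (mJ (h := resid tau sigma) j (measurable_resid tau0 sigma0)).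
Qed.

Lemma rho_gt0 t : 0 < rho t.
Proof. by apply: divr_gt0; [exact: (total0 (fun j => W (inl j) t))|exact: mulr_gt0]. Qed.

Let mus (h : ('I_L -> R) -> R) m : measurable_fun [set: fam] h -> measurable_fun setT (fun t => h (us m t)).
Proof. by move=> mh; exact: (measurableT_comp mh (measurable_user iD k m)). Qed.

Let law m (h : ('I_L -> R) -> R) : measurable_fun [set: fam] h -> (forall v, 0 <= h v) ->
  (\int[P]_t (h (us m t))%:E = \int[P0]_t (h (us0 t))%:E)%E.
Proof.
move=> mh h0; apply: (user_law iD iD0 lawD k m (h := fun v => (h v)%:E)).
  exact/measurable_EFinP.
by move=> v; rewrite lee_fin.
Qed.

Let sum_law (h : ('I_L -> R) -> R) : measurable_fun [set: fam] h -> (forall v, 0 <= h v) ->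
  (\int[P]_t (\sum_m h (us m t))%:E = K%:R%:E * \int[P0]_t (h (us0 t))%:E)%E.
Proof.
move=> mh h0; under eq_integral do rewrite -sumEFin.
rewrite ge0_integral_sum//; last 2 first.
- by move=> m; apply/measurable_EFinP; exact: (mus (h := h)).
- by move=> m t _; rewrite lee_fin.
transitivity (\sum_(m < K) 1%:E * \int[P0]_t (h (us0 t))%:E)%E.
  by apply: eq_bigr => m _; rewrite mul1e law.
by rewrite -ge0_sume_distrl// sumEFin sumr_const card_ord.
Qed.

Lemma measurable_rho : measurable_fun setT rho.
Proof.
apply: measurable_funM => //; apply: measurable_funD => //; apply: measurable_sum => j.
exact: (mus (h := resid tau sigma) j (measurable_resid tau0 sigma0)).
Qed.

Let mir : measurable_fun setT (fun t => (rho t)^-1).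
Proof. by apply: measurable_inv_gt0; [exact: measurable_rho|exact: rho_gt0]. Qed.

Lemma rho_mean : (\int[P]_t (rho t)%:E = (1 + sigma / (K%:R * c))%:E)%E.
Proof.
have E t : ((rho t)%:E = ((K%:R * c)^-1)%:E * ((\sum_(j < K) resid tau sigma (us j t))%:E + sigma%:E))%E.
  by rewrite -EFinD -EFinM /rho mulrC.
have S0 t : 0 <= \sum_(j < K) resid tau sigma (us j t).
  by apply: sumr_ge0 => j _; exact: resid_ge0.
have mS : measurable_fun setT (fun t => \sum_(j < K) resid tau sigma (us j t)).
  by apply: measurable_sum => j; exact: (mus (h := resid tau sigma) j (measurable_resid tau0 sigma0)).
under eq_integral do rewrite E.
rewrite ge0_integralZl//; last 3 first.
- by apply: emeasurable_funD => //; exact/measurable_EFinP.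
- by move=> t _; rewrite -EFinD lee_fin addr_ge0// ltW.
- by rewrite lee_fin invr_ge0 mulr_ge0 ?ltW.
rewrite ge0_integralD//; last 3 first.
- by move=> t _; rewrite lee_fin.
- exact/measurable_EFinP.
- by move=> t _; rewrite lee_fin ltW.
rewrite integral_prob_cst (sum_law (h := resid tau sigma))//; last 2 first.
- exact: measurable_resid.
- by move=> v; exact: resid_ge0.
rewrite resid_mean -(EFinM K%:R c) -EFinD -EFinM; congr EFin.
by rewrite mulrDr mulVf ?gt_eqF ?mulr_gt0// mulrC.
Qed.

Lemma lnp_rho_integral :
  (\int[P]_t (lnp (rho t))%:E <= (sigma / (K%:R * c))%:E + \int[P]_t (lnp (rho t)^-1)%:E)%E.
Proof.
rewrite -(@leeD2rE _ 1%E)//.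
rewrite -{1}(integral_prob_cst P 1) -ge0_integralD//; last 2 first.
- by move=> t _; rewrite lee_fin lnp_ge0.
- by apply/measurable_EFinP; apply: measurable_lnp; exact: measurable_rho.
apply: (@le_trans _ _ (\int[P]_t ((rho t)%:E + (lnp (rho t)^-1)%:E))%E).
  apply: ge0_le_integral => //.
  - by move=> t _; rewrite adde_ge0// lee_fin// lnp_ge0.
  - apply: emeasurable_funD => //; apply/measurable_EFinP; apply: measurable_lnp; exact: measurable_rho.
  - apply: emeasurable_funD; apply/measurable_EFinP; first exact: measurable_rho.
    exact: measurable_lnp.
  - by move=> t _; rewrite -!EFinD lee_fin; apply: lnp_add1_le; exact: rho_gt0.
rewrite ge0_integralD//; last 4 first.
- by move=> t _; rewrite lee_fin ltW// rho_gt0.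
- by apply/measurable_EFinP; exact: measurable_rho.
- by move=> t _; rewrite lee_fin lnp_ge0.
- by apply/measurable_EFinP; exact: measurable_lnp.
by rewrite rho_mean EFinD -[leLHS]addeA [leLHS]addeC.
Qed.

(* [rho] has mean about 1 but [resid] may have infinite variance: truncate it at [C] first. *)
Lemma lnp_rhoV_integral (eps C cC : R) : 0 < eps -> 2 * eps < 1 -> 0 <= C ->
  (\int[P0]_t (Num.min (resid tau sigma (us0 t)) C)%:E = cC%:E)%E ->
  (1 - eps) * c <= cC ->
  (\int[P]_t (lnp (rho t)^-1)%:E <=
    (- ln (1 - 2 * eps) + lnp (K%:R * c / sigma) * (C ^+ 2 / (eps * c) ^+ 2 / K%:R))%:E)%E.
Proof.
move=> e0 e1 C0 EC cCle.
pose h (x : 'I_L -> R) := Num.min (resid tau sigma x) C.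
have mh : measurable_fun [set: fam] (fun x : fam => h (x : 'I_L -> R)).
  by apply: measurable_minr => //; exact: measurable_resid.
have hC v : 0 <= h v <= C by rewrite le_min resid_ge0// C0/= ge_min lexx orbT.
pose dev t := \sum_m h (us m t) - K%:R * cC.
have mdev : measurable_fun setT dev.
  by apply: measurable_funB => //; apply: measurable_sum => m; exact: (mus (h := h)).
have Hvar := user_variance iD iD0 lawD mh hC EC.
pose q := lnp (K%:R * c / sigma) / (K%:R * (eps * c)) ^+ 2.
have q0 : 0 <= q by rewrite divr_ge0 ?lnp_ge0 ?sqr_ge0.
have l0 : 0 <= - ln (1 - 2 * eps) by rewrite oppr_ge0 ln_le0//; lra.
apply: (@le_trans _ _ (\int[P]_t ((- ln (1 - 2 * eps))%:E + q%:E * ((dev t) ^+ 2)%:E))%E).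
  apply: ge0_le_integral => //.
  - by move=> t _; rewrite lee_fin lnp_ge0.
  - by apply/measurable_EFinP; exact: measurable_lnp.
  - by apply: emeasurable_funD => //; apply: emeasurable_funM => //; apply/measurable_EFinP; exact: measurable_funX.
  - move=> t _; rewrite -EFinM -EFinD lee_fin.
    have r0 := rho_gt0 t.
    have [r1|r1] := leP (1 - 2 * eps) (rho t).
      apply: (@le_trans _ _ (- ln (1 - 2 * eps))); last by rewrite lerDl mulr_ge0 ?sqr_ge0.
      have e2 : 0 < 1 - 2 * eps by lra.
      have e3 : 1 <= (1 - 2 * eps)^-1 by rewrite invf_ge1//; lra.
      rewrite -lnV ?posrE// -(lnp_ln e3); apply: lnp_le; first by rewrite invr_gt0.
      by rewrite lef_pV2 ?posrE.
    (* On the rare event the noise alone gives [rho >= sigma / (K c)]; this costs a factor of order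
       [ln K], against the factor [1 / K] from Chebyshev. *)
    apply: (@le_trans _ _ (lnp (K%:R * c / sigma))).
      apply: lnp_le; first by rewrite invr_gt0.
      rewrite /rho invf_div ler_wpM2l ?mulr_ge0 ?(ltW c0)// lef_pV2 ?posrE//; last exact: (total0 (fun j => W (inl j) t)).
      by rewrite lerDr sumr_ge0// => j _; exact: resid_ge0.
    rewrite -[leLHS]add0r lerD// /q -[leRHS]mulrA ler_peMr ?lnp_ge0//.
    (* The truncated sum is below [(1 - 2 eps) K c], while its mean [K cC] is at least
       [(1 - eps) K c]. *)
    have dle : K%:R * (eps * c) <= - dev t.
      move: r1; rewrite /rho ltr_pdivrMr ?mulr_gt0// => r1.
      have S1 : \sum_m h (us m t) <= \sum_(j < K) resid tau sigma (us j t).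
        by apply: ler_sum => j _; rewrite ge_min lexx.
      rewrite /dev opprB.
      have : K%:R * ((1 - eps) * c) <= K%:R * cC by rewrite ler_pM2l.
      have s0 := sigma0; move: S1 r1; set a := \sum_m _; set b := \sum_(j < K) _; move: a b => a b; lra.
    have p0 : 0 < K%:R * (eps * c) by rewrite !mulr_gt0.
    rewrite mulrC ler_pdivlMr ?exprn_gt0// mul1r -[X in _ <= X]sqrrN.
    by rewrite ler_sqr ?nnegrE ?(ltW p0)// (le_trans (ltW p0)).
rewrite ge0_integralD//; last 2 first.
- by move=> t _; rewrite -EFinM lee_fin mulr_ge0 ?sqr_ge0.
- by apply: emeasurable_funM => //; apply/measurable_EFinP; exact: measurable_funX.
rewrite integral_prob_cst EFinD leeD2l//.
rewrite ge0_integralZl//; last 2 first.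
- by apply/measurable_EFinP; exact: measurable_funX.
- by move=> t _; rewrite lee_fin sqr_ge0.
apply: (@le_trans _ _ (q%:E * (K%:R * C ^+ 2)%:E)%E).
  by apply: lee_wpmul2l => //; rewrite lee_fin.
rewrite -EFinM lee_fin /q le_eqVlt; apply/orP; left; apply/eqP.
by field; rewrite !gt_eqF.
Qed.

Let relpower (x : 'I_L -> R) := alpha tau sigma k x / (beta * c).

Let relpower_ge0 x : 0 <= relpower x.
Proof. by apply: divr_ge0; [exact: alpha_ge0|rewrite mulr_ge0 ?(ltW beta0) ?(ltW c0)]. Qed.

Let mrelpower : measurable_fun [set: fam] (fun x : fam => relpower (x : 'I_L -> R)).
Proof. by apply: measurable_funM => //; exact: measurable_alpha. Qed.

Let power_rho t m eta : N%:R * eta * power (fun j => W (inl j) t) m = eta * relpower (us m t) / rho t.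
Proof.
rewrite /power /relpower /rho /us /user KN.
have := total0 (fun j => W (inl j) t); move: (\sum_(j < K) _ + sigma) => S S0.
have n0 : 0 < N%:R :> R by rewrite ltr0n.
by field; rewrite !gt_eqF.
Qed.

Let ln_law (f : R -> R) m : measurable_fun setT f -> (forall x, 0 <= x -> 0 <= f x) ->
  (\int[P]_t (f (relpower (us m t)))%:E = \int[P0]_t (f (relpow t))%:E)%E.
Proof.
move=> mf f0; apply: (law m (h := fun x => f (relpower x))).
  exact: measurableT_comp.
by move=> v; exact: f0.
Qed.

Let measurable_ln1D (e : R) : measurable_fun setT (fun x : R => ln (1 + e * x)).
Proof. by apply: measurableT_comp => //; apply: measurable_funD => //; exact: measurable_funM. Qed.

Lemma lndet_upper (eta : R) : 0 < eta ->
  (\int[P]_t (lndet t)%:E <= (ln (pot_bound N eta))%:E +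
    K%:R%:E * (\int[P0]_t (ln (1 + eta * relpow t))%:E + \int[P]_t (lnp (rho t)^-1)%:E))%E.
Proof.
move=> e0.
apply: (le_trans (ln_det_upper iW gW measurable_power power_ge0 N0 e0)).
have pb0 : 0 <= ln (pot_bound N eta) by rewrite ln_ge0// pot_bound_ge1.
have l0 x : 0 <= x -> 0 <= ln (1 + eta * x) by move=> x0; rewrite ln_ge0// lerDl mulr_ge0// ltW.
have ml m : measurable_fun setT (fun t => ln (1 + eta * relpower (us m t))).
  exact: (mus (h := fun x => ln (1 + eta * relpower x)) m (measurableT_comp (measurable_ln1D eta) mrelpower)).
have mr : measurable_fun setT (fun t => lnp (rho t)^-1) by exact: measurable_lnp.
have mS : measurable_fun setT (fun t => \sum_(m < K) (ln (1 + eta * relpower (us m t)) + lnp (rho t)^-1)).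
  by apply: measurable_sum => m; exact: measurable_funD.
have S0 t : 0 <= \sum_(m < K) (ln (1 + eta * relpower (us m t)) + lnp (rho t)^-1).
  by apply: sumr_ge0 => m _; rewrite addr_ge0 ?lnp_ge0 ?l0.
have b0 t m : 0 <= N%:R * eta * power (fun j => W (inl j) t) m.
  exact: mulr_ge0 (mulr_ge0 (ler0n _ _) (ltW e0)) (power_ge0 _ _).
apply: (@le_trans _ _ (\int[P]_t ((ln (pot_bound N eta))%:E +
    (\sum_(m < K) (ln (1 + eta * relpower (us m t)) + lnp (rho t)^-1))%:E))%E).
  apply: ge0_le_integral => //.
  - by move=> t _; rewrite lee_fin ln_ge0// det_bound_ge1// => m; exact: power_ge0.
  - apply/measurable_EFinP; apply: measurableT_comp => //; apply: measurable_funM => //.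
    apply: measurable_prod => m _; apply: measurable_funD => //; apply: measurable_funM => //.
    apply: (measurableT_comp (measurable_power m) (g := fun t => (fun j => W (inl j) t) : fam)).
    by apply: measurable_fam => j; case: iD => + _; apply.
  - by apply: emeasurable_funD => //; exact/measurable_EFinP.
  - move=> t _; rewrite -EFinD lee_fin /det_bound lnM ?posrE; last 2 first.
    + by rewrite (lt_le_trans ltr01)// pot_bound_ge1.
    + by apply: prodr_gt0 => m _; rewrite ltr_pwDl.
    rewrite lerD2l.
    elim: (index_enum _) => [|m r IH]; first by rewrite !big_nil ln1.
    rewrite !big_cons lnM ?posrE; last 2 first.
    + by rewrite ltr_pwDl.
    + by apply: prodr_gt0 => j _; rewrite ltr_pwDl.
    apply: lerD => //; rewrite power_rho; apply: ln1D_div_le; last exact: rho_gt0.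
    by rewrite mulr_ge0// ltW.
rewrite ge0_integralD//; last 2 first.
- by move=> t _; rewrite lee_fin.
- exact/measurable_EFinP.
rewrite integral_prob_cst leeD2l//.
under eq_integral do rewrite -sumEFin.
rewrite ge0_integral_sum//; last 2 first.
- by move=> m; apply/measurable_EFinP; exact: measurable_funD.
- by move=> m t _; rewrite lee_fin addr_ge0 ?lnp_ge0 ?l0.
have i0 : (0 <= \int[P0]_t (ln (1 + eta * relpow t))%:E)%E.
  by apply: integral_ge0 => t _; rewrite lee_fin l0// relpower_ge0.
have i1 : (0 <= \int[P]_t (lnp (rho t)^-1)%:E)%E.
  by apply: integral_ge0 => t _; rewrite lee_fin lnp_ge0.
rewrite (_ : K%:R%:E = \sum_(m < K) 1%:E)%E; last by rewrite sumEFin sumr_const card_ord.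
rewrite ge0_sume_distrl//; apply: lee_sum => m _; rewrite mul1e.
under eq_integral do rewrite EFinD.
rewrite ge0_integralD//; last 4 first.
- by move=> t _; rewrite lee_fin l0.
- exact/measurable_EFinP.
- by move=> t _; rewrite lee_fin lnp_ge0.
- exact/measurable_EFinP.
by rewrite (ln_law (f := fun x => ln (1 + eta * x))).
Qed.

(** [B0] bounds the exponent of every grid term from below once the sum over users is replaced by
    its mean. The truncation at [C] makes the variance of that sum finite, [delta] balances the cost
    of the deviation, and [ln n.+1] counts the terms of [grid_total]. *)
Lemma lndet_lower (kappa C delta B0 : R) (n : nat) (e : nat -> R) :
  0 < kappa -> kappa < 1 -> 0 <= C -> 0 < delta ->
  (forall i, (\int[P0]_t (Num.min (ln (1 + kappa ^+ i.+1 * relpow t)) C)%:E = (e i)%:E)%E) ->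
  (forall i, (i < n)%N -> B0 <= rate (kappa ^+ i) + beta * e i) ->
  B0 <= rate (kappa ^+ n) ->
  ((N%:R * B0)%:E <= \int[P]_t (lndet t)%:E + (sigma / c)%:E + K%:R%:E * \int[P]_t (lnp (rho t)^-1)%:E +
    (n%:R * (delta * N%:R + K%:R * C ^+ 2 / (delta * N%:R)) + ln n.+1%:R)%:E)%E.
Proof.
move=> k0 k1 C0 d0 eE HB0 HBn.
have n0 : 0 < N%:R :> R by rewrite ltr0n.
have dn0 : 0 < delta * N%:R by rewrite mulr_gt0.
have ki i : 0 < kappa ^+ i by rewrite exprn_gt0.
pose g i x := Num.min (ln (1 + kappa ^+ i.+1 * relpower x)) C.
have gC i v : 0 <= g i v <= C.
  rewrite le_min C0 andbT ge_min lexx orbT andbT ln_ge0// lerDl mulr_ge0// ltW//.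
have mg i : measurable_fun [set: fam] (fun x : fam => g i (x : 'I_L -> R)).
  by apply: measurable_minr => //; exact: measurableT_comp (measurable_ln1D _) mrelpower.
pose dev i t := \sum_m g i (us m t) - K%:R * e i.
have mdev i : measurable_fun setT (dev i).
  by apply: measurable_funB => //; apply: measurable_sum => m; exact: (mus (h := g i)).
pose h1 t := K%:R * lnp (rho t).
(* For [y > 0], [y + x ^ 2 / y >= - x]; summing over [i] dominates all negative deviations
   simultaneously, by a quantity whose mean involves only variances. *)
pose h2 t := \sum_(i < n) (delta * N%:R + (delta * N%:R)^-1 * dev i t ^+ 2).
have mh1 : measurable_fun setT h1.
  by apply: measurable_funM => //; apply: measurable_lnp; exact: measurable_rho.
have mh2 : measurable_fun setT h2.
  apply: measurable_sum => i; apply: measurable_funD => //; apply: measurable_funM => //.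
  exact: measurable_funX.
have h1_0 t : 0 <= h1 t by rewrite mulr_ge0 ?lnp_ge0.
have t0 i t : 0 <= delta * N%:R + (delta * N%:R)^-1 * dev i t ^+ 2.
  by rewrite addr_ge0 ?(ltW dn0)// mulr_ge0 ?sqr_ge0// invr_ge0 ltW.
have h2_0 t : 0 <= h2 t by apply: sumr_ge0.
have ln0 : 0 <= ln n.+1%:R :> R by rewrite ln_ge0// ler1n.
have m0 : 'I_K by apply: (@Ordinal K 0); rewrite -(ltr0n R).
pose psi t := power (fun j => W (inl j) t).
have pn t m i : 0 <= N%:R * psi t m * kappa ^+ i by exact: mulr_ge0 (mulr_ge0 (ler0n _ _) (power_ge0 _ _)) (ltW (ki i)).
have term i t : (i < n)%N -> expR (- (N%:R * rate (kappa ^+ i))) * grid_prod N (psi t) (kappa ^+ i.+1)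
    <= expR (- (N%:R * B0 - (h1 t + h2 t))).
  move=> ni.
  have -> : grid_prod N (psi t) (kappa ^+ i.+1) = expR (- \sum_m ln (1 + N%:R * psi t m * kappa ^+ i.+1)).
    rewrite /grid_prod -sumrN expR_sum; apply: eq_bigr => m _.
    by rewrite expRN lnK// posrE ltr_pwDl.
  rewrite -expRD ler_expR -opprD lerN2.
  have S1 : \sum_m g i (us m t) - h1 t <= \sum_m ln (1 + N%:R * psi t m * kappa ^+ i.+1).
    have -> : h1 t = \sum_(m < K) lnp (rho t) by rewrite sumr_const card_ord /h1 mulr_natl.
    rewrite -sumrB; apply: ler_sum => m _; rewrite lerBlDr.
    rewrite [N%:R * _ * _]mulrAC power_rho.
    apply: le_trans (ln1D_le_div _ (rho_gt0 t)); first by rewrite ge_min lexx.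
    by rewrite mulr_ge0// ltW.
  have S2 : - h2 t <= dev i t.
    rewrite lerNl; apply: (@le_trans _ _ (delta * N%:R + (delta * N%:R)^-1 * dev i t ^+ 2)).
      have := sqr_ge0 (delta * N%:R + dev i t); have := sqr_ge0 (dev i t).
      move: (dev i t) (delta * N%:R) dn0 => x y y0 x2 H.
      rewrite -(ler_pM2l y0) mulrDr mulrA mulfV ?gt_eqF// mul1r; nra.
    by rewrite /h2 (bigD1 (Ordinal ni))//= lerDl sumr_ge0.
  have S3 : N%:R * B0 <= N%:R * rate (kappa ^+ i) + K%:R * e i.
    by have := HB0 i ni; rewrite KN -(ler_pM2l n0); nra.
  move: S1 S2 S3; rewrite /dev; set a := \sum_m g i _; set b := \sum_m ln _; move: a b => a b; lra.
apply: (le_trans (ln_det_lower iW gW measurable_power power_ge0 N0 (n := n) (c := N%:R * B0)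
   (h := fun t => h1 t + h2 t + ln n.+1%:R) m0 k0 k1 _ _ _)).
- by apply: measurable_funD => //; exact: measurable_funD.
- by move=> t; rewrite !addr_ge0.
- move=> t; rewrite -/(psi t).
  have V0 : 0 < grid_total N kappa (psi t) n.
    rewrite ltr_wpDl ?expR_gt0//; apply: sumr_ge0 => i _.
    by rewrite mulr_ge0 ?expR_ge0// prodr_ge0// => m _; rewrite invr_ge0 addr_ge0.
  (* All [n.+1] terms obey the same bound; the last has no product over users and uses only the rate
     at [kappa ^ n]. *)
  have V1 : grid_total N kappa (psi t) n <= n.+1%:R * expR (- (N%:R * B0 - (h1 t + h2 t))).
    rewrite -natr1 mulrDl mul1r; apply: lerD.
      apply: (@le_trans _ _ (\sum_(i < n) expR (- (N%:R * B0 - (h1 t + h2 t))))).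
        by apply: ler_sum => i _; exact: term.
      by rewrite sumr_const card_ord -[leLHS]mulr_natl.
    rewrite ler_expR lerN2 lerBlDr; apply: (@le_trans _ _ (N%:R * rate (kappa ^+ n))).
      by rewrite ler_pM2l.
    by rewrite lerDl addr_ge0.
  have n1 : 0 < n.+1%:R :> R by rewrite ltr0n.
  move: V1; rewrite -ler_ln ?posrE ?mulr_gt0 ?expR_gt0// lnM ?posrE ?expR_gt0// expRK.
  by move: (ln (grid_total _ _ _ _)) (ln n.+1%:R) (h1 t) (h2 t) => x y z w; lra.
rewrite -addeA -addeA; apply: leeD => //.
under eq_integral do rewrite !EFinD.
rewrite ge0_integralD//; last 2 first.
- by move=> t _; rewrite -EFinD lee_fin addr_ge0.
- by apply: emeasurable_funD; exact/measurable_EFinP.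
rewrite integral_prob_cst ge0_integralD//; last 4 first.
- by move=> t _; rewrite lee_fin.
- exact/measurable_EFinP.
- by move=> t _; rewrite lee_fin.
- exact/measurable_EFinP.
have aux (x y s l a b : \bar R) : (x <= s + l -> y <= a -> x + y + b <= s + (l + (a + b)))%E.
  by move=> xs ya; rewrite !addeA leeD2r// leeD.
rewrite [X in (_ <= _ + (_ + X))%E]EFinD; apply: aux.
  under eq_integral do rewrite EFinM.
  rewrite ge0_integralZl//; last 2 first.
  - by apply/measurable_EFinP; apply: measurable_lnp; exact: measurable_rho.
  - by move=> t _; rewrite lee_fin lnp_ge0.
  apply: (@le_trans _ _ (K%:R%:E * ((sigma / (K%:R * c))%:E + \int[P]_t (lnp (rho t)^-1)%:E))%E).
    by apply: lee_wpmul2l; [rewrite lee_fin|exact: lnp_rho_integral].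
  rewrite ge0_muleDr; last 2 first.
  - by rewrite lee_fin divr_ge0 ?mulr_ge0 ?(ltW c0)// ltW.
  - by apply: integral_ge0 => t _; rewrite lee_fin lnp_ge0.
  rewrite leeD2r// -EFinM lee_fin le_eqVlt; apply/orP; left; apply/eqP.
  by field; rewrite !gt_eqF.
under eq_integral do rewrite -sumEFin.
rewrite ge0_integral_sum//; last 2 first.
- move=> i; apply/measurable_EFinP; apply: measurable_funD => //; apply: measurable_funM => //.
  exact: measurable_funX.
- by move=> i t _; rewrite lee_fin.
set u := delta * N%:R + _.
have -> : (n%:R * u)%:E = (\sum_(i < n) u%:E)%E by rewrite sumEFin sumr_const card_ord mulr_natl.
apply: lee_sum => i _.
under eq_integral do rewrite EFinD.
rewrite ge0_integralD//; last 3 first.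
- by move=> t _; rewrite lee_fin ltW.
- by move=> t _; rewrite lee_fin mulr_ge0 ?sqr_ge0// invr_ge0 ltW.
- by apply/measurable_EFinP; apply: measurable_funM => //; exact: measurable_funX.
rewrite integral_prob_cst /u EFinD leeD2l//.
under eq_integral do rewrite EFinM.
rewrite ge0_integralZl//; last 3 first.
- by apply/measurable_EFinP; exact: measurable_funX.
- by move=> t _; rewrite lee_fin sqr_ge0.
- by rewrite lee_fin invr_ge0 ltW.
rewrite [X in (_ <= X%:E)%E]mulrC [leRHS]EFinM; apply: lee_wpmul2l; first by rewrite lee_fin invr_ge0 ltW.
by apply: (user_variance iD iD0 lawD (mg i) (gC i)); exact: eE.
Qed.

End finite_n.

(** * The fixed-point equation *)

(** Includes the case of an infinite integral, which is how the lower estimate reaches a limit equal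
    to [+oo]. *)
Lemma truncated_integral {R : realType} d (T : measurableType d) (P : probability T R)
    (f : T -> R) (B : R) :
  measurable_fun setT f -> (forall t, 0 <= f t) -> (B%:E < \int[P]_t (f t)%:E)%E ->
  \forall n \near \oo, (B%:E < \int[P]_t (Num.min (f t) n%:R)%:E)%E.
Proof.
move=> mf f0 HB.
pose g (n : nat) t := (Num.min (f t) n%:R)%:E.
have gcvg : (\int[P]_t g n t @[n --> \oo] --> \int[P]_t (f t)%:E)%E.
  have -> : (\int[P]_t (f t)%:E = \int[P]_t limn (g ^~ t))%E.
    apply: eq_integral => t _; apply/esym/cvg_lim => //.
    apply: cvg_near_cst; near=> n; congr EFin; apply/min_idPl.
    near: n; exact: nbhs_infty_ger.
  apply: cvg_monotone_convergence => //.
  - by move=> n; apply/measurable_EFinP; apply: measurable_minr.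
  - by move=> n t _; rewrite lee_fin le_min ler0n f0.
  - by move=> t _ m n mn; rewrite lee_fin le_min ge_min lexx/= ge_min ler_nat mn orbT.
exact: gcvg _ (open_ereal_gt' HB).
Unshelve. all: by end_near.
Qed.

Lemma truncated_integral_fin {R : realType} d (T : measurableType d) (P : probability T R)
    (f : T -> R) (C : R) :
  measurable_fun setT f -> (forall t, 0 <= f t) -> 0 <= C ->
  (\int[P]_t (Num.min (f t) C)%:E = (fine (\int[P]_t (Num.min (f t) C)%:E))%:E)%E.
Proof.
move=> mf f0 C0; rewrite fineK// ge0_fin_numE; last first.
  by apply: integral_ge0 => t _; rewrite lee_fin le_min f0.
apply: (@le_lt_trans _ _ (\int[P]_t C%:E)%E); last by rewrite integral_prob_cst ltry.
apply: ge0_le_integral => //.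
- by move=> t _; rewrite lee_fin le_min f0.
- by apply/measurable_EFinP; apply: measurable_minr.
- by move=> t _; rewrite lee_fin ge_min lexx orbT.
Qed.

Section fixed_point.
Context {R : realType} d (T : measurableType d) (P : probability T R).
Variables (A : T -> R) (beta : R).
Hypotheses (mA : measurable_fun setT A) (A0 : forall t, 0 < A t) (beta0 : 0 < beta).

Definition qfun (e : R) : R := fine (\int[P]_t (1 / (1 + e * A t))%:E).

Let d0 e t : 0 <= e -> 0 < 1 + e * A t.
Proof. by move=> e0; rewrite ltr_pwDl// mulr_ge0// ltW. Qed.

Let mq e : 0 <= e -> measurable_fun setT (fun t => 1 / (1 + e * A t)).
Proof.
move=> e0; apply: measurable_funM => //; apply: measurable_inv_gt0 => [|t]; last exact: d0.
by apply: measurable_funD => //; exact: measurable_funM.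
Qed.

Let q_ge0 e t : 0 <= e -> 0 <= 1 / (1 + e * A t).
Proof. by move=> e0; rewrite divr_ge0// ltW// d0. Qed.

Let q_le1 e t : 0 <= e -> 1 / (1 + e * A t) <= 1.
Proof. by move=> e0; rewrite ler_pdivrMr ?d0// mul1r lerDl mulr_ge0// ltW. Qed.

Lemma qfunE e : 0 <= e -> ((qfun e)%:E = \int[P]_t (1 / (1 + e * A t))%:E)%E.
Proof.
move=> e0; rewrite /qfun fineK// ge0_fin_numE; last first.
  by apply: integral_ge0 => t _; rewrite lee_fin q_ge0.
apply: (@le_lt_trans _ _ (\int[P]_t 1%:E)%E); last by rewrite integral_prob_cst ltry.
by apply: ge0_le_integral => // [t _|| t _]; rewrite ?lee_fin ?q_ge0 ?q_le1//; exact/measurable_EFinP/mq.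
Qed.

Lemma qfun_compl e : 0 <= e -> (\int[P]_t (e * A t / (1 + e * A t))%:E = (1 - qfun e)%:E)%E.
Proof.
move=> e0.
have mc : measurable_fun setT (fun t => e * A t / (1 + e * A t)).
  apply: measurable_funM; first exact: measurable_funM.
  by have := mq e0; under eq_fun do rewrite mul1r.
have c0 t : 0 <= e * A t / (1 + e * A t) by rewrite divr_ge0 ?mulr_ge0 ?(ltW (A0 t))// ltW// d0.
have : (\int[P]_t ((e * A t / (1 + e * A t))%:E + (1 / (1 + e * A t))%:E) = 1)%E.
  rewrite -[RHS](integral_prob_cst P 1); apply: eq_integral => t _.
  by rewrite -EFinD -mulrDl addrC divff// gt_eqF// d0.
rewrite ge0_integralD//; last 4 first.
- by move=> t _; rewrite lee_fin.
- exact/measurable_EFinP.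
- by move=> t _; rewrite lee_fin q_ge0.
- exact/measurable_EFinP/mq.
by rewrite -qfunE// EFinB => <-; rewrite addeK.
Qed.

Lemma qfun_lt1 e : 0 < e -> qfun e < 1.
Proof.
move=> e0; rewrite -subr_gt0 -lte_fin -qfun_compl ?ltW//; apply: integral_gt0.
  apply: measurable_funM; first exact: measurable_funM.
  by have := mq (ltW e0); under eq_fun do rewrite mul1r.
by move=> t; rewrite divr_gt0 ?mulr_gt0// d0// ltW.
Qed.

(** The difference quotient of the integrand is at most [A / (1 + a A) <= 1 / a]. The bound is kept
    away from 0 because [A] may have infinite mean. *)
Lemma qfun_lipschitz eps a b : 0 < eps -> eps <= a -> a <= b ->
  0 <= qfun a - qfun b <= (b - a) / eps.
Proof.
move=> e0 ea ab; have a0 := lt_le_trans e0 ea; have b0 := lt_le_trans a0 ab.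
rewrite subr_ge0 lerBlDr -!lee_fin EFinD (qfunE (ltW a0)) (qfunE (ltW b0)); apply/andP; split.
  apply: ge0_le_integral => //.
  - by move=> t _; rewrite lee_fin q_ge0// ltW.
  - exact/measurable_EFinP/mq/ltW.
  - exact/measurable_EFinP/mq/ltW.
  - move=> t _; rewrite lee_fin !mul1r lef_pV2 ?posrE ?d0 ?(ltW a0) ?(ltW b0)//.
    by rewrite lerD2l ler_wpM2r// ltW.
have c0 : 0 <= (b - a) / eps by rewrite divr_ge0 ?subr_ge0// ltW.
rewrite -(integral_prob_cst P ((b - a) / eps)) -ge0_integralD//; last 2 first.
- by move=> t _; rewrite lee_fin q_ge0// ltW.
- exact/measurable_EFinP/mq/ltW.
apply: ge0_le_integral => //.
- by move=> t _; rewrite lee_fin q_ge0// ltW.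
- exact/measurable_EFinP/mq/ltW.
- by apply: emeasurable_funD => //; exact/measurable_EFinP/mq/ltW.
move=> t _; rewrite -EFinD lee_fin -lerBlDr.
have da := d0 t (ltW a0); have db := d0 t (ltW b0).
have -> : 1 / (1 + a * A t) - 1 / (1 + b * A t) = (b - a) * (A t / (1 + a * A t) / (1 + b * A t)).
  by field; rewrite !gt_eqF.
rewrite ler_wpM2l ?subr_ge0//.
apply: (@le_trans _ _ (A t / (1 + a * A t))).
  rewrite ler_pdivrMr//; apply: ler_peMr; first exact: divr_ge0 (ltW (A0 t)) (ltW da).
  by rewrite lerDl mulr_ge0// ltW.
rewrite ler_pdivrMr// ler_pdivlMl//.
by have := A0 t; nra.
Qed.

(** Intermediate value theorem for [beta (1 - qfun e) + e], which exceeds 1 at [e = 1] and is at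
    most 1 near 0, where [qfun] tends to 1. *)
Lemma eta_exists : exists e, 0 < e <= 1 /\ beta * (1 - qfun e) = 1 - e.
Proof.
pose s (n : nat) : R := n.+1%:R^-1.
have s0 n : 0 < s n by rewrite invr_gt0.
have cs : s @ \oo --> (0 : R) by exact: cvg_harmonic.
have cvg2 : \forall n \near \oo, s n <= 2^-1.
  by have /cvgr_le := cs; apply; rewrite invr_gt0.
(* This threshold gives [beta (1 - qfun) <= 1/2], hence at most [1 - s n] as soon as
   [s n <= 1/2]. *)
have cvg1 : \forall n \near \oo, 1 - (2 * beta)^-1 <= qfun (s n).
  pose g n t := (1 / (1 + s n * A t))%:E.
  have gcvg : (\int[P]_t g n t @[n --> \oo] --> 1)%E.
    have -> : (1 = \int[P]_t limn (g ^~ t))%E.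
      rewrite -[LHS](integral_prob_cst P 1); apply: eq_integral => t _.
      apply/esym/cvg_lim => //; apply: cvg_EFin; first by near=> n.
      rewrite -[X in _ --> X]mulr1 -[X in _ * X]invr1.
      apply: cvgM; first exact: cvg_cst.
      apply: cvgV; first exact: oner_neq0.
      rewrite -[X in _ --> X]addr0; apply: cvgD; first exact: cvg_cst.
      by rewrite -(mul0r (A t)); apply: cvgM => //; exact: cvg_cst.
    apply: cvg_monotone_convergence => //.
    - by move=> n; exact/measurable_EFinP/mq/ltW.
    - by move=> n t _; rewrite lee_fin q_ge0// ltW.
    - move=> t _ m n mn; rewrite lee_fin !mul1r lef_pV2 ?posrE ?d0 ?(ltW (s0 _))//.
      rewrite lerD2l ler_wpM2r ?(ltW (A0 t))//.
      by rewrite lef_pV2 ?posrE// ler_nat ltnS.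
  have /fine_cvgP[_] := gcvg.
  move=> /cvgr_ge; apply.
  by rewrite ltrBlDr ltrDl invr_gt0 mulr_gt0.
have [eps [e0 e1 He]] : exists eps, [/\ 0 < eps, eps <= 1 & beta * (1 - qfun eps) <= 1 - eps].
  have [n [n1 n2]] := filter_ex (filterI cvg1 cvg2).
  exists (n.+1%:R^-1); split; rewrite ?invr_gt0//.
    by apply: (le_trans n2); lra.
  have b2 : beta * (1 - qfun n.+1%:R^-1) <= beta * (2 * beta)^-1.
    by rewrite ler_pM2l// lerBlDl -lerBlDr.
  apply: (le_trans b2); rewrite invfM mulrCA mulfV ?gt_eqF// mulr1.
  by move: n2; rewrite /s; move: (n.+1%:R^-1) => y y2; lra.
(* Freezing the argument below [eps] makes the function Lipschitz on the whole line. *)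
pose F (x : R) := beta * (1 - qfun (Num.max eps x)) + Num.max eps x.
have lipF x y : x <= y -> `|F x - F y| <= (beta / eps + 1) * (y - x).
  move=> xy; rewrite /F.
  have m1 : eps <= Num.max eps x by rewrite le_max lexx.
  have m2 : Num.max eps x <= Num.max eps y by rewrite ge_max !le_max lexx xy orbT.
  have m3 : Num.max eps y - Num.max eps x <= y - x.
    by have [|] := leP eps x; have [|] := leP eps y => ? ?; lra.
  have /andP[q0 q1] := qfun_lipschitz e0 m1 m2.
  move: (Num.max eps x) (Num.max eps y) m1 m2 m3 q0 q1 => u v _ uv vx q0 q1.
  have q2 : beta * (qfun u - qfun v) <= beta * ((y - x) / eps).
    by rewrite ler_pM2l// (le_trans q1)// ler_pM2r// invr_gt0.
  have q3 : 0 <= beta * (qfun u - qfun v) by rewrite mulr_ge0// ltW.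
  have -> : (beta / eps + 1) * (y - x) = beta * ((y - x) / eps) + (y - x) by ring.
  by rewrite ler_norml; apply/andP; split; nra.
have cF : continuous F.
  move=> x; apply/cvgrPdist_le => e e2.
  pose M := beta / eps + 1.
  have M0 : 0 < M by rewrite ltr_wpDl// divr_ge0 ?ltW.
  near=> y.
  have xy : `|x - y| <= e / M.
    near: y; have /cvgrPdist_le h : id y @[y --> x] --> x by exact: cvg_id.
    by apply: h; rewrite divr_gt0.
  have [le|/ltW le] := leP x y.
    apply: (le_trans (lipF _ _ le)); rewrite mulrC -ler_pdivlMr//.
    by apply: le_trans xy; rewrite distrC ger0_norm ?subr_ge0.
  rewrite distrC; apply: (le_trans (lipF _ _ le)); rewrite mulrC -ler_pdivlMr//.
  by apply: le_trans xy; rewrite ger0_norm ?subr_ge0.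
have m_eps : Num.max eps eps = eps by rewrite maxxx.
have m_1 : Num.max eps 1 = 1 by apply/max_idPr.
have [|x xin Fx] := @IVT R F eps 1 1 e1 (continuous_subspaceT cF).
  rewrite /F m_eps m_1 ge_min le_max; apply/andP; split.
    by apply/orP; left; lra.
  by apply/orP; right; rewrite lerDr mulr_ge0 ?ltW// subr_gt0 qfun_lt1.
exists x; move: xin; rewrite in_itv/= => /andP[ex x1]; split.
  by rewrite x1 (lt_le_trans e0).
by move: Fx; rewrite /F (max_idPr ex); lra.
Unshelve. all: by end_near.
Qed.

Definition Jfun (e : R) : \bar R :=
  (beta%:E * \int[P]_t (ln (1 + e * A t))%:E + (rate e)%:E)%E.

Let mln e : 0 <= e -> measurable_fun setT (fun t => ln (1 + e * A t)).
Proof.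
by move=> e0; apply: measurableT_comp => //; apply: measurable_funD => //; exact: measurable_funM.
Qed.

Let ln_ge0' e t : 0 <= e -> 0 <= ln (1 + e * A t).
Proof. by move=> e0; rewrite ln_ge0// lerDl mulr_ge0// ltW. Qed.

(* Weighted AM-GM: convexity of [ln (1 + e a)] in [ln e], with slope [e' a / (1 + e' a)]. *)
Lemma ln1D_tangent (e e' a : R) : 0 < e -> 0 < e' -> 0 < a ->
  ln (1 + e' * a) + (ln e - ln e') * (e' * a / (1 + e' * a)) <= ln (1 + e * a).
Proof.
move=> e0 e'0 a0.
have x0 : 0 < 1 + e * a by rewrite ltr_pwDl// mulr_ge0 ?ltW.
have x'0 : 0 < 1 + e' * a by rewrite ltr_pwDl// mulr_ge0 ?ltW.
pose th := e' * a / (1 + e' * a).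
have th0 : 0 <= th by rewrite divr_ge0 ?mulr_ge0 ?ltW.
have th1 : 0 <= 1 - th by rewrite subr_ge0 ler_pdivrMr// mul1r lerDr.
pose y := (1 + e * a) / (1 + e' * a).
have y0 : 0 < y by rewrite divr_gt0.
have yE : y = 1 - th + th * (e / e') by rewrite /y /th; field; rewrite !gt_eqF.
have h1 : ln (e / e') - ln y <= (e / e') / y - 1.
  by rewrite -ln_div ?posrE ?divr_gt0//; apply: ln_le_subr1; rewrite !divr_gt0.
have h2 : - ln y <= y^-1 - 1 by rewrite -lnV ?posrE//; apply: ln_le_subr1; rewrite invr_gt0.
have h3 : th * ((e / e') / y - 1) + (1 - th) * (y^-1 - 1) = 0.
  have -> : th * ((e / e') / y - 1) + (1 - th) * (y^-1 - 1) = (1 - th + th * (e / e')) / y - 1 by ring.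
  by rewrite -yE divff ?subrr// gt_eqF.
have h4 := ler_wpM2l th0 h1; have h5 := ler_wpM2l th1 h2.
have yL : ln y = ln (1 + e * a) - ln (1 + e' * a) by rewrite ln_div ?posrE.
have rL : ln (e / e') = ln e - ln e' by rewrite ln_div ?posrE.
rewrite -/th; move: h3 h4 h5; rewrite rL yL.
have lin (p q r v w : R) : th * (v - 1) + (1 - th) * (w - 1) = 0 -> th * (p - (q - r)) <= th * (v - 1) ->
   (1 - th) * - (q - r) <= (1 - th) * (w - 1) -> r + p * th <= q by lra.
exact: lin.
Qed.

(** In the variable [ln e] both parts of [J] are convex. At [e'] the tangent of the logarithmic part
    has slope [beta (1 - qfun e')] and that of the rate has slope [e' - 1]; the equation says that
    they cancel. *)
Lemma Jfun_min (e e' : R) : 0 < e -> 0 < e' -> beta * (1 - qfun e') = 1 - e' ->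
  (Jfun e' <= Jfun e)%E.
Proof.
move=> e0 e'0 He'.
(* The tangent term has the sign of [u]; its positive and negative parts are put on opposite sides
   before integrating. *)
pose u := ln e - ln e'; pose up := Num.max 0 u; pose un := Num.max 0 (- u).
have uE : u = up - un by rewrite /up /un; have [|] := leP 0 u; have [|] := leP 0 (- u) => ? ?; lra.
have up0 : 0 <= up by rewrite le_max lexx.
have un0 : 0 <= un by rewrite le_max lexx.
pose th t := e' * A t / (1 + e' * A t).
have th0 t : 0 <= th t by rewrite divr_ge0 ?mulr_ge0 ?(ltW (A0 t)) ?(ltW e'0)// ltW// d0// ltW.
have mth : measurable_fun setT th.
  apply: measurable_funM; first exact: measurable_funM.
  by have := mq (ltW e'0); under eq_fun do rewrite mul1r.
have Ith : (\int[P]_t (th t)%:E = ((1 - e') / beta)%:E)%E.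
  by rewrite qfun_compl ?ltW// -He' mulrAC divff ?mul1r// gt_eqF.
have key : (\int[P]_t (ln (1 + e' * A t))%:E + up%:E * ((1 - e') / beta)%:E <=
    \int[P]_t (ln (1 + e * A t))%:E + un%:E * ((1 - e') / beta)%:E)%E.
  rewrite -Ith -!ge0_integralZl ?lee_fin//; first last.
  - by move=> t _; rewrite lee_fin.
  - exact/measurable_EFinP.
  - by move=> t _; rewrite lee_fin.
  - exact/measurable_EFinP.
  rewrite -!ge0_integralD//; first last.
  - by apply: emeasurable_funM => //; exact/measurable_EFinP.
  - by move=> t _; rewrite -EFinM lee_fin mulr_ge0.
  - exact/measurable_EFinP/mln/ltW.
  - by move=> t _; rewrite lee_fin ln_ge0'// ltW.
  - by apply: emeasurable_funM => //; exact/measurable_EFinP.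
  - by move=> t _; rewrite -EFinM lee_fin mulr_ge0.
  - exact/measurable_EFinP/mln/ltW.
  - by move=> t _; rewrite lee_fin ln_ge0'// ltW.
  apply: ge0_le_integral => //.
  - by move=> t _; rewrite -EFinM -EFinD lee_fin; apply: addr_ge0; [exact: ln_ge0' (ltW e'0)|rewrite mulr_ge0].
  - apply: emeasurable_funD; first exact/measurable_EFinP/mln/ltW.
    by apply: emeasurable_funM => //; exact/measurable_EFinP.
  - apply: emeasurable_funD; first exact/measurable_EFinP/mln/ltW.
    by apply: emeasurable_funM => //; exact/measurable_EFinP.
  - move=> t _; rewrite -!EFinM -!EFinD lee_fin.
    have := ln1D_tangent e0 e'0 (A0 t); rewrite -/u -/(th t) uE mulrBl.
    by move: (ln _) (ln (1 + e * A t)) (up * _) (un * _) => a b c f; lra.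
have rate_ge : rate e' + u * (e' - 1) <= rate e.
  have := @ln_le_subr1 R (e / e'); rewrite divr_gt0// ln_div ?posrE// => /(_ isT) H.
  have : e' * (ln e - ln e') <= e - e'.
    have -> : e - e' = e' * (e / e' - 1) by field; rewrite gt_eqF.
    by rewrite ler_pM2l.
  by rewrite /rate /u; lra.
have I0 : (0 <= \int[P]_t (ln (1 + e * A t))%:E)%E.
  by apply: integral_ge0 => t _; rewrite lee_fin ln_ge0'// ltW.
have I'0 : (0 <= \int[P]_t (ln (1 + e' * A t))%:E)%E.
  by apply: integral_ge0 => t _; rewrite lee_fin ln_ge0'// ltW.
rewrite /Jfun; move: I0 I'0 key.
move: (\int[P]_t (ln (1 + e * A t))%:E)%E (\int[P]_t (ln (1 + e' * A t))%:E)%E => [r| |] [r'| |] //=.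
- move=> _ _; rewrite -!EFinM -!EFinD !lee_fin => key.
  have := ler_wpM2l (ltW beta0) key; rewrite !mulrDr.
  have -> : beta * (up * ((1 - e') / beta)) = up * (1 - e') by field; rewrite gt_eqF.
  have -> : beta * (un * ((1 - e') / beta)) = un * (1 - e') by field; rewrite gt_eqF.
  by move: rate_ge; rewrite uE; nra.
- by move=> _ _ _; rewrite gt0_muley ?lte_fin// leey.
- by move=> _ _ _; rewrite gt0_muley ?lte_fin// leey.
Qed.

End fixed_point.

Lemma lnp_sublinear {R : realType} (a x : R) : 0 < a -> 0 < x -> lnp x <= a * x + `|ln a|.
Proof.
move=> a0 x0; have ax : 0 < a * x by rewrite mulr_gt0.
rewrite ge_max addr_ge0 ?(ltW ax)//=.
have := ln_le_subr1 ax; rewrite lnM ?posrE//.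
by have := ler_norm (- ln a); rewrite normrN; lra.
Qed.

(** * Asymptotics of the mean log-determinant *)

Section asymptotics.
Context {R : realType} {L : nat}.
Variables (Nn Kn : nat -> nat).
Variables (dT : nat -> measure_display) (T : forall n, measurableType (dT n)) (P : forall n, probability (T n) R).
Variable W : forall n, ('I_L * 'I_L * 'I_(Kn n)) + (('I_(Nn n) * 'I_(Kn n)) + ('I_(Nn n) * 'I_(Kn n))) -> T n -> R.
Context d' (T0 : measurableType d') (P0 : probability T0 R).
Variable D0 : 'I_L * 'I_L -> T0 -> R.
Hypotheses (iW : forall n, mutually_independent (P n) (@W n)) (gW : forall n, std_cgauss (P n) (fun i => W (n := n) (inr i))).
Hypothesis iD0 : mutually_independent P0 D0.
Hypothesis lawD : forall n kl m (B : set R), measurable B ->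
  P n (W (n := n) (inl (kl, m)) @^-1` B) = P0 (D0 kl @^-1` B).
Hypothesis D0_gt0 : forall kl t, 0 < D0 kl t.
Variables (tau sigma beta c : R) (k : 'I_L).
Hypotheses (tau0 : 0 < tau) (sigma0 : 0 < sigma) (beta0 : 0 < beta) (c0 : 0 < c).
Hypothesis KN : forall n, (Kn n)%:R = beta * (Nn n)%:R.
Hypothesis Noo : forall m : nat, \forall n \near \oo, (m <= Nn n)%N.
Hypothesis resid_mean : (\int[P0]_t (resid tau sigma (user0 D0 k t))%:E = c%:E)%E.

Let A := relpow D0 tau sigma beta c k.
Let G n := (\int[P n]_t (lndet (@W n) tau sigma k t)%:E)%E.
Let lam n := (\int[P n]_t (lnp (rho (@W n) tau sigma c k t)^-1)%:E)%E.

Let A_gt0 t : 0 < A t.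
Proof. by apply: divr_gt0; [apply: alpha_gt0 => // l; exact: D0_gt0|exact: mulr_gt0]. Qed.

Let mA : measurable_fun setT A.
Proof.
apply: measurable_funM => //.
exact: (measurableT_comp (measurable_alpha k tau0 sigma0) (measurable_user0 iD0 k)).
Qed.

Lemma near_large (X : R) : \forall n \near \oo, (0 < Nn n)%N /\ X <= (Nn n)%:R.
Proof.
pose m := (Num.truncn `|X|).+1.
apply: filterS (Noo m) => n mN; split; first by rewrite (leq_trans _ mN).
apply: (@le_trans _ _ m%:R); last by rewrite ler_nat.
by rewrite (le_trans (ler_norm X))// ltW// truncnS_gt.
Qed.

(** Choices in order: [eps] with [- ln (1 - 2 eps) = e / 2], a truncation level [q] that keeps the
    mean above [(1 - eps) c], then [n] so large that the term of order [ln K / K] is at most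
    [e / 2]. *)
Lemma lam_small (e : R) : 0 < e -> \forall n \near \oo, (lam n <= e%:E)%E.
Proof.
move=> e0.
pose eps := (1 - expR (- (e / 2))) / 2.
have x1 : expR (- (e / 2)) < 1 by rewrite expR_lt1 oppr_lt0 divr_gt0.
have x0 := expR_gt0 (- (e / 2)).
have eps0 : 0 < eps by rewrite /eps; lra.
have eps1 : 2 * eps < 1 by rewrite /eps; lra.
have epsE : - ln (1 - 2 * eps) = e / 2.
  have -> : 1 - 2 * eps = expR (- (e / 2)) by rewrite /eps; lra.
  by rewrite expRK opprK.
have mr : measurable_fun setT (fun t => resid tau sigma (user0 D0 k t)).
  exact: (measurableT_comp (measurable_resid tau0 sigma0) (measurable_user0 iD0 k)).
have r0 t : 0 <= resid tau sigma (user0 D0 k t) by exact: resid_ge0.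
have cc : (((1 - eps) * c)%:E < \int[P0]_t (resid tau sigma (user0 D0 k t))%:E)%E.
  by rewrite resid_mean lte_fin gtr_pMl//; lra.
have [q Hq] := filter_ex (truncated_integral mr r0 cc).
have EC := truncated_integral_fin P0 mr r0 (ler0n R q).
rewrite EC lte_fin in Hq.
set cC := fine _ in EC Hq.
pose D := q%:R ^+ 2 / (eps * c) ^+ 2.
have D_ge0 : 0 <= D by rewrite divr_ge0 ?sqr_ge0.
(* Slope for [lnp_sublinear]: after multiplication by [D / K] its linear part contributes at most
   [e / 4], whatever [K] is. *)
pose a := (e / 4) * (sigma / (c * (D + 1))).
have a0 : 0 < a by rewrite !mulr_gt0 ?invr_gt0 ?mulr_gt0 ?ltr_wpDl.
apply: filterS (near_large (4 * `|ln a| * D / e / beta)) => n [N0 NX].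
have n0 : 0 < (Nn n)%:R :> R by rewrite ltr0n.
have K0 : 0 < (Kn n)%:R :> R by rewrite KN mulr_gt0.
apply: (le_trans (lnp_rhoV_integral (iW n) iD0 (@lawD n) tau0 sigma0 beta0 c0 N0 (KN n) eps0 eps1 (ler0n _ q) EC (ltW Hq))).
rewrite epsE lee_fin -/D.
have x2 : 0 < (Kn n)%:R * c / sigma by rewrite divr_gt0 ?mulr_gt0.
have h1 := lnp_sublinear a0 x2.
have DK : 0 <= D / (Kn n)%:R by rewrite divr_ge0.
have h2 := ler_wpM2r DK h1.
have h3 : a * ((Kn n)%:R * c / sigma) * (D / (Kn n)%:R) <= e / 4.
  have -> : a * ((Kn n)%:R * c / sigma) * (D / (Kn n)%:R) = (e / 4) * (D / (D + 1)).
    by rewrite /a; field; rewrite !gt_eqF// ltr_wpDl.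
  by rewrite ler_piMr ?divr_ge0 ?(ltW e0)// ler_pdivrMr ?ltr_wpDl// mul1r lerDl.
have h4 : `|ln a| * (D / (Kn n)%:R) <= e / 4.
  rewrite mulrA ler_pdivrMr// KN.
  move: NX; rewrite !ler_pdivrMr//; lra.
by move: h2; rewrite mulrDl; lra.
Qed.

Variable e' : R.
Hypotheses (e'0 : 0 < e') (He' : beta * (1 - qfun P0 A e') = 1 - e').

Lemma lndet_mean_upper (B : R) : (Jfun P0 A beta e' < B%:E)%E ->
  \forall n \near \oo, (G n <= ((Nn n)%:R * B)%:E)%E.
Proof.
rewrite /Jfun => HB.
have mln : measurable_fun setT (fun t => ln (1 + e' * A t)).
  by apply: measurableT_comp => //; apply: measurable_funD => //; exact: measurable_funM.
have I0 : (0 <= \int[P0]_t (ln (1 + e' * A t))%:E)%E.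
  by apply: integral_ge0 => t _; rewrite lee_fin ln_ge0// lerDl mulr_ge0// ltW.
case E : (\int[P0]_t (ln (1 + e' * A t))%:E)%E I0 HB => [r| |] // r0; last first.
  by rewrite gt0_muley ?lte_fin.
rewrite -EFinM -EFinD lte_fin => HB.
pose j := beta * r + rate e'.
(* The gap [4 a] is spent as [2 a] on the interference term, [a] on the linear bound for [ln N], and
   [a] on the constant [1 + |ln a|]. *)
pose a := (B - j) / 4.
have a0 : 0 < a by rewrite /a /j; lra.
have l0 : 0 < (B - j) / (2 * beta) by rewrite divr_gt0 ?mulr_gt0// /j; lra.
apply: filterS (filterI (near_large ((1 + `|ln a|) / a)) (lam_small l0)) => n [[N0 NX] Hl].
have n0 : 0 < (Nn n)%:R :> R by rewrite ltr0n.
have HU := lndet_upper (iW n) (@gW n) iD0 (@lawD n) k tau0 sigma0 beta0 c0 N0 (KN n) e'0.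
apply: (le_trans HU).
rewrite -/A E -/(lam n).
apply: (@le_trans _ _ ((ln (pot_bound (Nn n) e'))%:E + (Kn n)%:R%:E * (r%:E + ((B - j) / (2 * beta))%:E))%E).
  by rewrite leeD2l// lee_wpmul2l ?lee_fin// leeD2l.
rewrite -(EFinD r) -EFinM -EFinD lee_fin.
apply: (le_trans (lerD (ln_pot_bound N0 e'0) (lexx _))).
have h1 := lnp_sublinear a0 n0; have h2 := ln_le_lnp ((Nn n)%:R : R).
rewrite ler_pdivrMr// in NX.
have -> : (Kn n)%:R * (r + (B - j) / (2 * beta)) = (Nn n)%:R * (beta * r) + (Nn n)%:R * (2 * a).
  by rewrite KN /a; field; rewrite gt_eqF.
have -> : B = beta * r + rate e' + 4 * a by rewrite /a /j; lra.
have lin (x l y b lb u v : R) : x <= l -> l <= b * y + lb -> 1 + lb <= y * b ->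
    1 + x + y * u + (y * v + y * (2 * b)) <= y * (v + u + 4 * b) by lra.
exact: lin h2 h1 NX.
Qed.

Lemma lndet_mean_lower (B : R) : (B%:E < Jfun P0 A beta e')%E ->
  \forall n \near \oo, (((Nn n)%:R * B)%:E <= G n)%E.
Proof.
move=> HB.
(* A finite intermediate level, so that the case of an infinite minimum needs no separate
   argument. *)
have [B' BB' HB'] : exists2 B', B < B' & (B'%:E < Jfun P0 A beta e')%E.
  move: HB; case: (Jfun _ _ _ _) => [j|_|//].
    by rewrite lte_fin => Bj; exists ((B + j) / 2); rewrite ?lte_fin; lra.
  by exists (B + 1); rewrite ?ltry//; lra.
pose dl := B' - B.
have dl0 : 0 < dl by rewrite subr_gt0.
(* By [step], one grid step of ratio [exp (- s)] costs at most [s] per user, that is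
   [beta s = dl / 3] per antenna. *)
pose s := dl / (3 * beta).
have s0 : 0 < s by rewrite divr_gt0 ?mulr_gt0.
pose kap := expR (- s).
have k0 : 0 < kap by exact: expR_gt0.
have k1 : kap < 1 by rewrite expR_lt1 oppr_lt0.
have ki i : 0 < kap ^+ i by rewrite exprn_gt0.
have mln i : measurable_fun setT (fun t => ln (1 + kap ^+ i * A t)).
  by apply: measurableT_comp => //; apply: measurable_funD => //; exact: measurable_funM.
have ln0 i t : 0 <= ln (1 + kap ^+ i * A t) by rewrite ln_ge0// lerDl mulr_ge0// ltW.
have step i : (\int[P0]_t (ln (1 + kap ^+ i * A t))%:E <= \int[P0]_t (ln (1 + kap ^+ i.+1 * A t))%:E + s%:E)%E.
  rewrite -(integral_prob_cst P0 s) -ge0_integralD//; last 3 first.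
  - by move=> t _; rewrite lee_fin.
  - exact/measurable_EFinP.
  - by move=> t _; rewrite lee_fin ltW.
  apply: ge0_le_integral => //.
  - by move=> t _; rewrite lee_fin.
  - exact/measurable_EFinP.
  - by apply: emeasurable_funD => //; exact/measurable_EFinP.
  - move=> t _; rewrite -EFinD lee_fin -lerBlDr -[s]opprK -(expRK (- s)) opprK -/kap.
    have p i' : 0 < 1 + kap ^+ i' * A t.
      by rewrite ltr_pwDl//; exact: mulr_ge0 (ltW (ki i')) (ltW (A_gt0 t)).
    rewrite -lnM ?posrE// ler_ln ?posrE ?(mulr_gt0 (p i) k0)//.
    by rewrite mulrDl mul1r lerD ?(ltW k1)// exprSr mulrAC.
have gap i : (((B' - dl / 3 - rate (kap ^+ i)) / beta)%:E < \int[P0]_t (ln (1 + kap ^+ i.+1 * A t))%:E)%E.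
  have Ji := lt_le_trans HB' (Jfun_min mA A_gt0 beta0 (ki i) e'0 He').
  rewrite -(@lteD2rE _ s%:E)//; apply: lt_le_trans (step i).
  rewrite -EFinD; move: Ji; rewrite /Jfun.
  have : (0 <= \int[P0]_t (ln (1 + kap ^+ i * A t))%:E)%E.
    by apply: integral_ge0 => t _; rewrite lee_fin.
  case: (\int[P0]_t (ln (1 + kap ^+ i * A t))%:E)%E => [r| |//] _; last by rewrite ltry.
  rewrite -EFinM -EFinD !lte_fin => H.
  have -> : (B' - dl / 3 - rate (kap ^+ i)) / beta + s = (B' - rate (kap ^+ i)) / beta.
    by rewrite /s; field; rewrite gt_eqF.
  by rewrite ltr_pdivrMr//; lra.
pose J := (Num.truncn ((`|B| + dl + 1) / s)).+1.
have rJ : B + 2 / 3 * dl <= rate (kap ^+ J).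
  have lnJ : ln (kap ^+ J) = J%:R * - s by rewrite /kap -expRM_natl expRK.
  have Js : `|B| + dl + 1 < J%:R * s by rewrite -ltr_pdivrMr//; exact: truncnS_gt.
  have lin (b b' d x y : R) : b <= b' -> b' + d + 1 < y -> 0 < d -> 0 < x ->
    b + 2 / 3 * d <= x - 1 + y by lra.
  rewrite /rate lnJ mulrN opprK.
  exact: lin (ler_norm B) Js dl0 (ki J).
have [q Hq] : exists q : nat, forall i : 'I_J,
    (((B' - dl / 3 - rate (kap ^+ i)) / beta)%:E < \int[P0]_t (Num.min (ln (1 + kap ^+ i.+1 * A t)) q%:R)%:E)%E.
  have : \forall q \near \oo, forall i : 'I_J,
    (((B' - dl / 3 - rate (kap ^+ i)) / beta)%:E < \int[P0]_t (Num.min (ln (1 + kap ^+ i.+1 * A t)) q%:R)%:E)%E.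
    apply: filter_forall => i; apply: truncated_integral => //; exact: gap.
  by move=> /filter_ex.
pose e i := fine (\int[P0]_t (Num.min (ln (1 + kap ^+ i.+1 * A t)) q%:R)%:E)%E.
have eE i : (\int[P0]_t (Num.min (ln (1 + kap ^+ i.+1 * A t)) q%:R)%:E = (e i)%:E)%E.
  by apply: truncated_integral_fin.
(* Per antenna, the deviations cost [J * De <= dl / 6]; the interference term and the bounded
   remainder [rest] cost another [dl / 6] each, and the total stays below the available
   [2 / 3 * dl]. *)
pose De := dl / (6 * J.+1%:R).
have De0 : 0 < De by rewrite divr_gt0 ?mulr_gt0.
pose rest := sigma / c + J%:R * (beta * q%:R ^+ 2 / De) + ln J.+1%:R.
have l0 : 0 < dl / (6 * beta) by rewrite divr_gt0 ?mulr_gt0.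
apply: filterS (filterI (near_large (rest / (dl / 6))) (lam_small l0)) => n [[N0 NX] Hl].
have n0 : 0 < (Nn n)%:R :> R by rewrite ltr0n.
have HL := @lndet_lower _ _ _ _ _ _ _ _ _ _ _ _ (iW n) (@gW n) iD0 (@lawD n) tau sigma beta c k tau0 sigma0 beta0 c0 N0 (KN n) resid_mean
  kap q%:R De (B + 2 / 3 * dl) J e k0 k1 (ler0n _ _) De0 eE _ rJ.
have Kn0 : 0 <= (Kn n)%:R :> R by [].
have {}HL := HL _; rewrite -/(G n) -/(lam n) in HL.
rewrite -(@leeD2rE _ ((Nn n)%:R * (2 / 3 * dl))%:E)// -EFinD -mulrDr.
apply: le_trans (HL _) _.
  move=> i iJ; have := Hq (Ordinal iJ); rewrite /= eE lte_fin ltr_pdivrMr//.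
  by rewrite /dl; lra.
have slack (g l : \bar R) (a x y z w : R) : 0 <= x -> (l <= y%:E)%E -> a + x * y + z <= w ->
    (g + a%:E + x%:E * l + z%:E <= g + w%:E)%E.
  move=> x0 ly axy; apply: (@le_trans _ _ (g + a%:E + x%:E * y%:E + z%:E)%E).
    by rewrite leeD2r// leeD2l// lee_wpmul2l ?lee_fin.
  by rewrite -EFinM -!addeA -!EFinD leeD2l// lee_fin addrA.
apply: slack Kn0 Hl _; rewrite KN.
have -> : beta * (Nn n)%:R * q%:R ^+ 2 / (De * (Nn n)%:R) = beta * q%:R ^+ 2 / De.
  by field; rewrite !gt_eqF.
have -> : beta * (Nn n)%:R * (dl / (6 * beta)) = (Nn n)%:R * (dl / 6).
  by field; rewrite gt_eqF.
have JD : J%:R * De <= dl / 6.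
  have J0 : 0 < J.+1%:R :> R by [].
  have -> : dl / 6 = J.+1%:R * De by rewrite /De; field; rewrite gt_eqF.
  by rewrite ler_wpM2r ?(ltW De0)// ler_nat.
rewrite ler_pdivrMr ?divr_gt0// in NX; move: NX; rewrite /rest.
have lin (a b x y z w u v : R) : a + x + z <= v * (w / 6) -> b * u * v <= w / 6 * v -> 0 < w * v ->
    b * y = x -> a + v * (w / 6) + (b * (u * v + y) + z) <= v * (2 / 3 * w) by lra.
by move=> NX; apply: lin NX (ler_wpM2r (ltW n0) JD) (mulr_gt0 dl0 n0) erefl.
Qed.

End asymptotics.

(** * From the matrix model to the limit *)

Lemma invmx_diag (F : fieldType) n (v : 'rV[F]_n) : (forall i, v 0 i != 0) ->
  invmx (diag_mx v) = diag_mx (\row_i (v 0 i)^-1).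
Proof.
move=> v0; have E : diag_mx v *m diag_mx (\row_i (v 0 i)^-1) = 1%:M.
  rewrite mulmx_diag -diag_const_mx; congr diag_mx.
  by apply/rowP => i; rewrite !mxE mulfV.
have [U _] := mulmx1_unit E.
by rewrite -[RHS](mulKmx U) E mulmx1.
Qed.

Lemma PhiNet_diag {R : realType} {L K : nat} (tau sigma : R) (d : 'I_L -> 'I_L -> 'I_K -> R) k :
  (forall k l m, 0 < d k l m) ->
  PhiNet tau sigma d k = diag_mx (\row_m power tau sigma k (fun j => d j.1.1 j.1.2 j.2) m).
Proof.
move=> d0.
have DD l : Dmx d k l *m Dmx d k l = diag_mx (\row_m (d k l m ^+ 2)).
  by rewrite mulmx_diag; congr diag_mx; apply/rowP => m; rewrite !mxE expr2.
have -> : PhiNet tau sigma d k = (Tk tau sigma d k)^-1 *: diag_mx (\row_m alpha tau sigma k (fun l => d k l m)).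
  rewrite /PhiNet DD invmx_diag; last by move=> i; rewrite !mxE gt_eqF// exprn_gt0.
  congr (_ *: _); rewrite (eq_bigr (fun l => diag_mx (\row_m (d k l m ^+ 4)))); last first.
    move=> l _; rewrite -(mulmxA (_ *m _)) (DD l) mulmx_diag; congr diag_mx; apply/rowP => m.
    by rewrite !mxE -exprD.
  rewrite -raddf_sum/= !mulmx_diag; congr diag_mx; apply/rowP => m.
  by rewrite !mxE summxE; congr (_ * _); apply: eq_bigr => l _; rewrite !mxE.
have -> : Tk tau sigma d k = \sum_(j < K) resid tau sigma (fun l => d k l j) + sigma.
  congr (_ + _); rewrite [RHS]exchange_big/=; apply: eq_bigr => l _.
  rewrite DD -diag_const_mx -raddfB/= mulmx_diag mxtrace_diag.
  by apply: eq_bigr => m _; rewrite !mxE.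
rewrite -linearZ/=; congr diag_mx; apply/rowP => m.
by rewrite !mxE mulrC.
Qed.

Lemma gram_mulmx {R : realType} {N K : nat} (f : 'I_K -> R) (Mre Mim : 'M[R]_(N, K)) :
  cmx Mre Mim *m map_mx (real_complex R) (diag_mx (\row_m f m)) *m (map_mx (@conjc R) (cmx Mre Mim))^T
  = gram f (index_enum _) (fun x => match x with inl ij => Mre ij.1 ij.2 | inr ij => Mim ij.1 ij.2 end).
Proof.
apply/matrixP => i j; rewrite !mxE /gram summxE; apply: eq_bigr => m _.
rewrite map_diag_mx mul_mx_diag !mxE big_ord_recl big_ord0 addr0 !mxE.
by rewrite -mulrA [RHS]mulrCA.
Qed.

Lemma logdet_lndet {R : realType} {L N K : nat} d (T : measurableType d) (P : probability T R)
    (tau sigma : R) (D : 'I_L -> 'I_L -> 'I_K -> T -> R) (Mre Mim : 'I_N -> 'I_K -> T -> R)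
    (W := fun x : ('I_L * 'I_L * 'I_K) + (('I_N * 'I_K) + ('I_N * 'I_K)) =>
      match x with
      | inl klm => D klm.1.1 klm.1.2 klm.2
      | inr (inl ij) => Mre ij.1 ij.2
      | inr (inr ij) => Mim ij.1 ij.2
      end) k :
  (forall k l m t, 0 < D k l m t) ->
  forall t, logdet (cmx (\matrix_(i, j) Mre i j t) (\matrix_(i, j) Mim i j t))
     (PhiNet tau sigma (fun k l m => D k l m t) k) = (ln 2)^-1 * lndet W tau sigma k t.
Proof.
move=> D0 t; rewrite /logdet /log2 mulrC PhiNet_diag; last by move=> *; exact: D0.
rewrite gram_mulmx /lndet /gram_det.
congr (_ * ln (complex.Re (\det (1%:M + gram _ _ _)))).
by apply/funext => -[[i j]|[i j]]; rewrite mxE.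
Qed.

(** Testing against real levels only treats finite and infinite limits alike; for [l = +oo] the
    second hypothesis is vacuous. *)
Lemma cvge_sandwich {R : realType} (x : nat -> \bar R) (l : \bar R) :
  (forall B : R, (B%:E < l)%E -> \forall n \near \oo, (B%:E <= x n)%E) ->
  (forall B : R, (l < B%:E)%E -> \forall n \near \oo, (x n <= B%:E)%E) ->
  x n @[n --> \oo] --> l.
Proof.
case: l => [r| |] Hl Hu.
- have L (e : R) : 0 < e -> \forall n \near \oo, ((r - e)%:E <= x n)%E.
    by move=> e0; apply: Hl; rewrite lte_fin; lra.
  have U (e : R) : 0 < e -> \forall n \near \oo, (x n <= (r + e)%:E)%E.
    by move=> e0; apply: Hu; rewrite lte_fin; lra.
  apply/fine_cvgP; split.
    apply: filterS (filterI (L 1 ltr01) (U 1 ltr01)) => n [].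
    by case: (x n).
  apply/cvgrPdist_le => e e0; apply: filterS (filterI (L e e0) (U e e0)) => n [] /=.
  by case: (x n) => //= y; rewrite !lee_fin ler_norml; lra.
- by apply/cvgeyPge => B; apply: Hl; rewrite ltry.
- by apply/cvgeNyPle => B; apply: Hu; rewrite ltNyr.
Qed.

Lemma bigmin_muler {R : realType} (I : finType) (r : R) (F : I -> \bar R) : 0 < r ->
  (\big[Order.min/+oo]_i (r%:E * F i) = r%:E * \big[Order.min/+oo]_i F i)%E.
Proof.
move=> r0; apply/esym; apply: (big_morph (fun x : \bar R => r%:E * x)%E).
  by move=> x y; rewrite mine_pMr// lee_fin ltW.
by rewrite gt0_muley ?lte_fin.
Qed.

Lemma cvge_min_ratio {R : realType} (L : nat) (N : nat -> nat) (x : 'I_L -> nat -> \bar R)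
    (l : 'I_L -> \bar R) :
  (0 < L)%N -> (\forall n \near \oo, (0 < N n)%N) ->
  (forall k (B : R), (B%:E < l k)%E -> \forall n \near \oo, (((N n)%:R * B)%:E <= x k n)%E) ->
  (forall k (B : R), (l k < B%:E)%E -> \forall n \near \oo, (x k n <= ((N n)%:R * B)%:E)%E) ->
  ((N n)%:R^-1%:E * \big[Order.min/+oo]_k x k n)%E @[n --> \oo] --> (\big[Order.min/+oo]_k l k)%E.
Proof.
move=> L0 N0 Hl Hu; apply: cvge_sandwich => B HB.
  have H : \forall n \near \oo, forall k, (((N n)%:R * B)%:E <= x k n)%E.
    by apply: filter_forall => k; apply: Hl; apply: lt_le_trans HB (bigmin_le_cond _ _ _).
  apply: filterS (filterI N0 H) => n [n0 {}H].
  have n1 : 0 < (N n)%:R :> R by rewrite ltr0n.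
  rewrite -bigmin_muler ?invr_gt0//; apply/bigmin_geP; split=> [|k _]; first exact: leey.
  rewrite -[B](mulKf (lt0r_neq0 n1)) EFinM lee_wpmul2l// lee_fin.
(* From above it is enough to follow one cell attaining the limiting minimum; it exists because [L]
   is positive, an empty minimum being [+oo]. *)
have [k _ Ek] := @eq_bigmin _ _ _ +oo%E (Ordinal L0) predT l erefl (fun _ _ => leey _).
rewrite Ek in HB.
apply: filterS (filterI N0 (Hu _ _ HB)) => n [n0 H].
have n1 : 0 < (N n)%:R :> R by rewrite ltr0n.
apply: (@le_trans _ _ ((N n)%:R^-1%:E * x k n)%E).
  by rewrite lee_wpmul2l ?lee_fin ?invr_ge0//; exact: bigmin_le_cond.
by rewrite -[B](mulKf (lt0r_neq0 n1)) EFinM lee_wpmul2l// lee_fin invr_ge0.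
Qed.

(** [eta_exists] shows that the choice in [Psi_eta] does not fall back on its default value;
    whichever solution is chosen, [Jfun_min] applies to it. The factor [1 / ln 2] converts to base
    2. *)
Lemma Psi_Jfun {R : realType} d (T : measurableType d) (P : probability T R) (A : T -> R) (beta : R) :
  measurable_fun setT A -> (forall t, 0 < A t) -> 0 < beta ->
  exists eta, [/\ 0 < eta, beta * (1 - qfun P A eta) = 1 - eta &
    Psi P A beta = ((ln 2)^-1%:E * Jfun P A beta eta)%E].
Proof.
move=> mA A0 b0; exists (Psi_eta P A beta).
have [e [/andP[e0 e1] He]] := eta_exists P mA A0 b0.
have /(xgetPex 1) [/andP[h0 h1] HE] : exists x, Psi_eta_eq P A beta x.
  exists e; split; first by rewrite e0.
  rewrite -[fine _]/(qfun P A e) -He mulfK// gt_eqF// subr_gt0.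
  exact: qfun_lt1.
move: h0 h1 HE; rewrite -/(Psi_eta P A beta) => h0 h1 HE.
have q1 := qfun_lt1 P mA A0 h0.
split=> //.
  have solve (b q e' : R) : q < 1 -> b = (1 - e') / (1 - q) -> b * (1 - q) = 1 - e'.
    by move=> q0 ->; rewrite divfK// gt_eqF// subr_gt0.
  exact: solve q1 HE.
rewrite /Psi /Jfun.
have l2 : 0 < ln 2 :> R by rewrite ln_gt0// ltr1n.
have mln : measurable_fun setT (fun t => ln (1 + Psi_eta P A beta * A t)).
  by apply: measurableT_comp => //; apply: measurable_funD => //; exact: measurable_funM.
have -> : (Ex P (fun x => log2 (1 + Psi_eta P A beta * A x)) =
   (ln 2)^-1%:E * \int[P]_x (ln (1 + Psi_eta P A beta * A x))%:E)%E.
  rewrite -ge0_integralZl//.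
  - by rewrite /Ex; apply: eq_integral => t _; rewrite -EFinM /log2 mulrC.
  - exact/measurable_EFinP.
  - by move=> t _; rewrite lee_fin ln_ge0// lerDl mulr_ge0// ltW.
  - by rewrite lee_fin invr_ge0 ltW.
move: (\int[P]_x _)%E => I; rewrite muleDr ?fin_num_adde_defl//; congr (_ + _)%E.
  exact: muleCA.
rewrite -EFinM /rate /log2 expRK; congr EFin.
by rewrite mulrBr mulrC mul1r [X in _ = X - _]mulrC addrC.
Qed.

Section mean_resid.
Context {R : realType} {L : nat} d' (T0 : measurableType d') (P0 : probability T0 R).
Variable D0 : 'I_L * 'I_L -> T0 -> R.
Hypothesis iD0 : mutually_independent P0 D0.
Variables (tau sigma : R) (k : 'I_L).
Hypotheses (tau0 : 0 < tau) (sigma0 : 0 < sigma).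

Let term l t := (1 - bgain tau sigma (user0 D0 k t) l) * user0 D0 k t l ^+ 2.

Let mterm l : measurable_fun setT (term l).
Proof.
apply: measurable_funM; last by apply: measurable_funX; exact: iD0.1.
apply: measurable_funB => //.
exact: (measurableT_comp (measurable_bgain tau0 sigma0 l) (measurable_user0 iD0 k)).
Qed.

Let term_ge0 l t : 0 <= term l t.
Proof. by rewrite mulr_ge0 ?sqr_ge0// subr_ge0 ltW// bgain_lt1. Qed.

Lemma mean_resid : (forall l, (Ex P0 (term l) < +oo)%E) ->
  (\int[P0]_t (resid tau sigma (user0 D0 k t))%:E = (\sum_l fine (Ex P0 (term l)))%:E)%E.
Proof.
move=> Hfin.
have -> : (\int[P0]_t (resid tau sigma (user0 D0 k t))%:E = \int[P0]_t (\sum_l (term l t)%:E))%E.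
  by apply: eq_integral => t _; rewrite sumEFin.
rewrite ge0_integral_sum//; last first.
- by move=> l t _; rewrite lee_fin.
- by move=> l; apply/measurable_EFinP; exact: mterm.
rewrite -sumEFin; apply: eq_bigr => l _; rewrite fineK// ge0_fin_numE//.
by apply: integral_ge0 => t _; rewrite lee_fin.
Qed.

Lemma mean_resid_gt0 (c : R) : (0 < L)%N -> (forall kl t, 0 < D0 kl t) ->
  (\int[P0]_t (resid tau sigma (user0 D0 k t))%:E = c%:E)%E -> 0 < c.
Proof.
move=> L0 D0_gt0 Hc; rewrite -lte_fin -Hc; apply: integral_gt0.
  exact: (measurableT_comp (measurable_resid tau0 sigma0) (measurable_user0 iD0 k)).
move=> t; rewrite /resid (bigD1 (Ordinal L0))//= ltr_pwDl//.
  by rewrite mulr_gt0 ?exprn_gt0 ?D0_gt0// subr_gt0 bgain_lt1.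
by apply: sumr_ge0 => l _; exact: term_ge0.
Qed.

End mean_resid.

Theorem theorem3
  (R : realType) (L tau_c tau_p : nat) (sigma2 beta : R)
  (* reference space: d0 k l has the common law of d_{k,l,m} (any m, any N) *)
  (d0T : measure_display) (T0 : measurableType d0T) (P0 : probability T0 R)
  (d0 : 'I_L -> 'I_L -> T0 -> R)
  (* the sequence of systems: N_n antennas, K_n users per cell *)
  (Nn Kn : nat -> nat)
  (dT : nat -> measure_display) (T : forall n, measurableType (dT n))
  (P : forall n, probability (T n) R)
  (dd : forall n, 'I_L -> 'I_L -> 'I_(Kn n) -> T n -> R)
  (Mre Mim : forall n, 'I_(Nn n) -> 'I_(Kn n) -> T n -> R) :
  (1 <= L)%N -> (0 < tau_p)%N -> (tau_p <= tau_c)%N ->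
  0 < sigma2 -> 0 < beta ->
  (* reference attenuations: independent, strictly positive,
     with E{(1 - b_{k,l,1}) d_{k,l,1}^2} finite *)
  mutually_independent P0 (fun kl : 'I_L * 'I_L => d0 kl.1 kl.2) ->
  (forall k l t, 0 < d0 k l t) ->
  (forall k l : 'I_L,
     (Ex P0 (fun s => ((1 - tau_p%:R * d0 k l s ^+ 2 /
                (sigma2 + tau_p%:R * \sum_(l' < L) d0 k l' s ^+ 2)) * d0 k l s ^+ 2)%R)
      < +oo)%E) ->
  (* N -> oo with K/N = beta *)
  (forall m : nat, \forall n \near \oo, (m <= Nn n)%N) ->
  (forall n, (Kn n)%:R = beta * (Nn n)%:R) ->
  (* the model for each n *)
  (forall n,
     mutually_independent (P n)
       (fun x : ('I_L * 'I_L * 'I_(Kn n)) + (('I_(Nn n) * 'I_(Kn n)) + ('I_(Nn n) * 'I_(Kn n))) =>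
          match x with
          | inl klm => dd n klm.1.1 klm.1.2 klm.2
          | inr (inl ij) => Mre n ij.1 ij.2
          | inr (inr ij) => Mim n ij.1 ij.2
          end)) ->
  (forall n k l m t, 0 < dd n k l m t) ->
  (forall n k l m (B : set R), measurable B ->
     P n (dd n k l m @^-1` B) = P0 (d0 k l @^-1` B)) ->
  (forall n i j (B : set R), measurable B ->
     P n (Mre n i j @^-1` B) = normal_prob 0 (Num.sqrt (2^-1)) B /\
     P n (Mim n i j @^-1` B) = normal_prob 0 (Num.sqrt (2^-1)) B) ->
  rSD (P n) tau_c tau_p sigma2 (dd n) (Mre n) (Mim n) @[n --> \oo] -->
  ((((tau_c%:R - tau_p%:R) / tau_c%:R) * (L%:R * beta)^-1)%:E *
   \big[Order.min/+oo%E]_(k < L) Psi P0 (ANet P0 tau_p sigma2 beta d0 k) beta)%E.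
Proof.
move=> L0 tp0 tpc s0 b0 iD d0_gt0 dfin Noo KN iW dd_gt0 lawd gaussM.
pose tau : R := tau_p%:R.
have tau0 : 0 < tau by rewrite ltr0n.
pose D0 (kl : 'I_L * 'I_L) := d0 kl.1 kl.2.
pose W n (x : ('I_L * 'I_L * 'I_(Kn n)) + (('I_(Nn n) * 'I_(Kn n)) + ('I_(Nn n) * 'I_(Kn n)))) :=
  match x with
  | inl klm => dd n klm.1.1 klm.1.2 klm.2
  | inr (inl ij) => Mre n ij.1 ij.2
  | inr (inr ij) => Mim n ij.1 ij.2
  end.
have gW n : std_cgauss (P n) (fun i => W n (inr i)).
  by move=> [] [i j] B mB; have [] := gaussM n i j B mB.
have lawD n kl m (B : set R) : measurable B ->
    P n (W n (inl (kl, m)) @^-1` B) = P0 (D0 kl @^-1` B).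
  by move: kl => [k l]; exact: lawd.
have D0_gt0 kl t : 0 < D0 kl t by exact: d0_gt0.
pose c k := \sum_(l < L) fine (Ex P0 (fun s => (1 - bgain tau sigma2 (user0 D0 k s) l) * user0 D0 k s l ^+ 2)).
have cE k := mean_resid iD tau0 s0 (dfin k).
have c0 k := mean_resid_gt0 iD tau0 s0 L0 D0_gt0 (cE k).
have l2 : 0 < ln 2 :> R by rewrite ln_gt0// ltr1n.
pose G k n := (\int[P n]_t (lndet (@W n) tau sigma2 k t)%:E)%E.
pose A k := relpow D0 tau sigma2 beta (c k) k.
(* Holds by conversion: [relpow] and [c k] were set up to unfold to the terms of [ANet]. *)
have AE k : ANet P0 tau_p sigma2 beta d0 k = A k by [].
have A_gt0 k t : 0 < A k t.
  by apply: divr_gt0; [apply: alpha_gt0 => // l; exact: D0_gt0|exact: mulr_gt0 (c0 k)].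
have mA k : measurable_fun setT (A k).
  apply: measurable_funM => //.
  exact: (measurableT_comp (measurable_alpha k tau0 s0) (measurable_user0 iD k)).
have N_gt0 : \forall n \near \oo, (0 < Nn n)%N by exact: Noo 1%N.
have key k : exists J : \bar R, [/\ Psi P0 (A k) beta = ((ln 2)^-1%:E * J)%E,
    forall B : R, (B%:E < J)%E -> \forall n \near \oo, (((Nn n)%:R * B)%:E <= G k n)%E &
    forall B : R, (J < B%:E)%E -> \forall n \near \oo, (G k n <= ((Nn n)%:R * B)%:E)%E].
  have [eta [eta0 Heta HPsi]] := Psi_Jfun P0 (mA k) (A_gt0 k) b0.
  exists (Jfun P0 (A k) beta eta); split=> // B HB.
    exact: (lndet_mean_lower iW gW iD lawD D0_gt0 tau0 s0 b0 (c0 k) KN Noo (cE k) eta0 Heta HB).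
  exact: (lndet_mean_upper iW gW iD lawD D0_gt0 tau0 s0 b0 (c0 k) KN Noo (cE k) eta0 HB).
have [J HJ] := choice key.
have EG k n : (Ex (P n) (fun t => logdet (cmx (\matrix_(i, j) Mre n i j t) (\matrix_(i, j) Mim n i j t))
    (PhiNet tau sigma2 (fun k l m => dd n k l m t) k)) = (ln 2)^-1%:E * G k n)%E.
  rewrite /Ex /G -ge0_integralZl//.
  - by apply: eq_integral => t _; rewrite logdet_lndet.
  - apply/measurable_EFinP; exact: (measurable_ln_gram_det (iW n) (measurable_power k tau0 s0)).
  - by move=> t _; rewrite lee_fin; apply: ln_ge0; apply: gram_det_ge1 => m; apply: power_ge0.
  - by rewrite lee_fin invr_ge0 ltW.
have l2V : 0 < (ln 2)^-1 :> R by rewrite invr_gt0.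
have HJ1 k : Psi P0 (ANet P0 tau_p sigma2 beta d0 k) beta = ((ln 2)^-1%:E * J k)%E.
  by rewrite AE; case: (HJ k).
have HJ2 k (B : R) : (B%:E < J k)%E -> \forall n \near \oo, (((Nn n)%:R * B)%:E <= G k n)%E.
  by case: (HJ k) => _ + _; exact.
have HJ3 k (B : R) : (J k < B%:E)%E -> \forall n \near \oo, (G k n <= ((Nn n)%:R * B)%:E)%E.
  by case: (HJ k) => _ _; exact.
rewrite (eq_bigr _ (fun k _ => HJ1 k)) bigmin_muler// muleA -EFinM.
pose a : R := (tau_c%:R - tau_p%:R) / tau_c%:R; rewrite -/a.
(* Since [K = beta N], the prefactor [1 / (L K)] of [rSD] splits into this constant and the [1 / N]
   normalising the log-determinants, as soon as [N > 0]. *)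
apply: cvg_trans (cvgeZl (y := (a / (L%:R * beta) / ln 2)%:E) _ (cvge_min_ratio L0 N_gt0 HJ2 HJ3)) => //.
apply: near_eq_cvg; apply: filterS N_gt0 => n n0.
have n1 : 0 < (Nn n)%:R :> R by rewrite ltr0n.
have L1 : 0 < L%:R :> R by rewrite ltr0n.
rewrite /rSD -/a -/tau (eq_bigr _ (fun k _ => EG k n)) bigmin_muler// !muleA -!EFinM KN.
congr (_%:E * _)%E.
by field; rewrite !gt_eqF.
Qed.
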